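(* Let $\Gamma$ be a metric circle, let $G=\check M_{\mathbb R}\rtimes W$ be a tropical reductive group of type $\prod_{i=1}^kA_{n_i-1}$, associated to a root datum $(M,R,\check M,\check R)$, and let $\check\lambda_G\in\pi_1(G)$ be a stable degree. Then the determinant induces a homeomorphism $$\det:\mathcal M^{\check\lambda_G}_{G,\mathrm{ind}}\longrightarrow\mathcal M_T^{\det(\check\lambda_G)},$$ where $T=\check M_{\mathbb R}/\langle\check R\rangle_{\mathbb R}$.
   Context: A metric circle is $\Gamma=\mathbb R/\ell\mathbb Z$, $\ell>0$. $\mathcal H_\Gamma$ is the sheaf of harmonic functions (continuous piecewise linear, integer slopes, outgoing slopes at each point sum to $0$); $\mathrm{Pic}(\Gamma)=H^1(\Gamma,\mathcal H_\Gamma)$, a disjoint union over degrees of torsors under the real torus $\mathrm{Pic}^0(\Gamma)$. A $G$-bundle is a torsor under $G_\Gamma=(\check M\otimes\mathcal H_\Gamma)\rtimes W$, and $\mathcal M_G=H^1(\Gamma,G_\Gamma)$. $\pi_1(G)=\check M/\langle\check R\rangle$. The degree of a $G$-bundle is its image under $H^1(\Gamma,G_\Gamma)\to H^1(\Gamma,\Omega\otimes\pi_1(G))\cong\pi_1(G)$, induced by $\mathcal H_\Gamma\to\Omega=\mathcal H_\Gamma/\mathbb R$ and the homomorphism $\check M\rtimes W\to\check M/\langle\check R\rangle$, $(m,w)\mapsto\overline m$, with $H^1(\Gamma,\Omega)\cong\mathbb Z$. $G$ is of type $\prod A_{n_i-1}$ if its root system is; then $W=\prod_iS_{n_i}$.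 Let $\check M^{\mathrm{ad}}=\{m\in\check M_{\mathbb Q}/R^{\perp}:\langle r,m\rangle\in\mathbb Z\ \forall r\in R\}$ be the adjoint cocharacter lattice (dual to $\langle R\rangle$), so $\pi_1(G^{\mathrm{ad}})=\check M^{\mathrm{ad}}/\langle\check R\rangle\cong\prod_i\mathbb Z/n_i\mathbb Z$. A degree $\check\lambda_G\in\pi_1(G)$ is stable if its image in $\prod_i\mathbb Z/n_i\mathbb Z$ is $(d_i)_i$ with $\gcd(d_i,n_i)=1$ for all $i$. $\mathrm{ind}$ is the indecomposable $W$-torsor on $\Gamma$, unique up to isomorphism: the one whose monodromy is a product of an $n_i$-cycle in each factor $S_{n_i}$. $\mathcal M^{\check\lambda_G}_{G,\mathrm{ind}}$ is the set of isomorphism classes of $G$-bundles of degree $\check\lambda_G$ with associated $W$-torsor isomorphic to $\mathrm{ind}$. Topology: let $\widetilde{\mathcal M}_{G,\mathrm{ind}}$ be the set of isomorphism classes of $G$-bundles with a chosen isomorphism of their $W$-torsor with $\mathrm{ind}$, and let $f:\Gamma'\to\Gamma$ be the connected cyclic cover of degree $\mathrm{lcm}(n_1,\dots,n_k)$, with a trivialization of $f^*\mathrm{ind}$. Pulling back along $f$ and reducing the structure group to $\check M\otimes\mathcal H_{\Gamma'}$ embeds $\widetilde{\mathcal M}_{G,\mathrm{ind}}$ in $\mathrm{Pic}(\Gamma')\otimes\check M$; it has the subspace topology and $\mathcal M_{G,\mathrm{ind}}=\widetilde{\mathcal M}_{G,\mathrm{ind}}/\mathrm{Aut}(\mathrm{ind})$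 the quotient topology. $T$ is the tropical reductive group with cocharacter lattice $\check M/\langle\check R\rangle^{\mathrm{sat}}$ (sat = saturation in $\check M$) and trivial Weyl group, so $\mathcal M_T=\mathrm{Pic}(\Gamma)\otimes(\check M/\langle\check R\rangle^{\mathrm{sat}})$ and $\pi_1(T)=\check M/\langle\check R\rangle^{\mathrm{sat}}$. The determinant is the quotient homomorphism $\det:G\to T$, $(m,w)\mapsto\overline m$, the induced pushforward of bundles, and the induced map $\pi_1(G)\to\pi_1(T)$. *)

(* Defs.v *)
From HB Require Import structures.
From mathcomp Require Import all_boot all_order all_algebra perm.
From mathcomp Require Import all_classical all_reals all_analysis.

Set Implicit Arguments.
Unset Strict Implicit.
Unset Printing Implicit Defensive.

Import Order.TTheory GRing.Theory Num.Theory.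
Import numFieldNormedType.Exports.
Local Open Scope classical_set_scope.
Local Open Scope ring_scope.

(* Topological spaces whose points may form a large type.  The moduli  *)
(* sets below consist of isomorphism classes of torsors and live in a  *)
(* universe above the carriers of topologicalType, so that structure   *)
(* cannot be put on them.                                              *)

Record tspace := TSpace {
  tpt :> Type;
  topen : (tpt -> Prop) -> Prop;
  topenT : topen (fun _ => True);
  topenI : forall A B, topen A -> topen B -> topen (fun x => A x /\ B x);
  topenU : forall C : (tpt -> Prop) -> Prop, (forall A, C A -> topen A) ->
    topen (fun x => exists2 A, C A & A x) }.

Definition homeomorphism (S T : tspace) (f : S -> T) :=
  exists g : T -> S,
    [/\ forall x, g (f x) = x, forall y, f (g y) = y,
        forall B, topen B -> topen (fun x => B (f x))
      & forall A, topen A -> topen (fun y => A (g y))].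

Definition tspace_of (T : topologicalType) : tspace.
Proof.
refine (@TSpace T (fun A => open (A : set T)) openT _ _).
- by move=> A B; exact: openI.
- move=> C hC.
  rewrite (_ : (fun x => exists2 A, C A & A x) = \bigcup_(A in C) A) //.
  exact: bigcup_open.
Defined.

Section Induced.
Variables (S : tspace) (T : Type) (rel : T -> S -> Prop).

(* The topology on T transported from S along a correspondence: A is open *)
(* if it corresponds to an open set B of S.  This is the initial topology *)
(* if rel is the graph of a map T -> S, and the quotient topology if rel  *)
(* is the converse of the graph of a map from S onto T.                   *)
Definition induced_open (A : T -> Prop) :=
  exists2 B : S -> Prop, topen B & forall x y, rel x y -> (A x <-> B y).

Lemma induced_openT : induced_open (fun _ => True).
Proof. by exists (fun _ => True); first exact: topenT. Qed.

Lemma induced_openI A B :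
  induced_open A -> induced_open B -> induced_open (fun x => A x /\ B x).
Proof.
move=> [A' oA hA] [B' oB hB]; exists (fun x => A' x /\ B' x).
  exact: topenI.
by move=> x y h; rewrite (hA _ _ h) (hB _ _ h).
Qed.

Lemma induced_openU (C : (T -> Prop) -> Prop) :
  (forall A, C A -> induced_open A) ->
  induced_open (fun x => exists2 A, C A & A x).
Proof.
move=> hC; exists (fun y => exists2 B : S -> Prop, topen B /\
  (exists2 A, C A & forall x y, rel x y -> (A x <-> B y)) & B y).
  by apply: topenU => B [].
move=> x y h; split=> [[A CA Ax]|[B [_ [A CA hA]] By]].
  have [B oB hB] := hC A CA; exists B; last exact/(hB _ _ h).
  by split=> //; exists A.
by exists A => //; apply/(hA _ _ h).
Qed.

Definition induced_tspace := TSpace induced_openT induced_openI induced_openU.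
End Induced.

Definition subspace_of (S : tspace) (D : S -> Prop) : tspace :=
  @induced_tspace S {x : S | D x} (fun x y => sval x = y).

Section Classes.
Variables (T : Type) (r : T -> T -> Prop).

Definition classes := {C : T -> Prop | exists x, C = r x}.

Definition class_of (x : T) : classes := exist _ (r x) (ex_intro _ x erefl).

Definition in_class (c : classes) (x : T) : Prop := sval c x.
End Classes.

(* An oriented metric 1-manifold X without boundary, given with a local *)
(* isometry R -> X which is onto; open sets are those of the quotient   *)
(* topology.  Only R itself and R / l Z are used.                       *)
Record curve (R : realType) := Curve { cpt :> Type; chart : R -> cpt }.

Record oset (R : realType) (X : curve R) := OSet {
  oset_set :> set X;
  oset_open : open ((chart X) @^-1` oset_set) }.

Definition omem (R : realType) (X : curve R) (U : oset X) (c : X) : Prop :=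
  oset_set U c.
Coercion omem : oset >-> Funclass.

Definition ofull (R : realType) (X : curve R) : oset X :=
  @OSet R X setT openT.

Section Circle.
Variables (R : realType) (l : R).

Definition circle_rel (x y : R) : bool :=
  `[< exists n : int, y - x = n%:~R * l >].

Lemma circle_rel_equiv : equiv_class_of circle_rel.
Proof.
split=> [x|x y|y x z].
- by apply/asboolP; exists 0; rewrite subrr mul0r.
- by apply/asboolP/asboolP => -[n e]; exists (- n); rewrite mulrNz mulNr -e opprB.
- move=> /asboolP[n e] /asboolP[m e']; apply/asboolP; exists (n + m).
  by rewrite intrD mulrDl -e -e' [RHS]addrC addrA subrK.
Qed.
Canonical circle_equiv := EquivRelPack circle_rel_equiv.
Canonical circle_encModRel := defaultEncModRel circle_rel.

Definition circle_pt := {eq_quot circle_rel}%qT.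
HB.instance Definition _ := EqQuotient.on circle_pt.

Definition circle : curve R := Curve (\pi_circle_pt : R -> circle_pt)%qT.
End Circle.

Definition line (R : realType) : curve R := Curve (id : R -> R).

Definition circle_cover (R : realType) (l : R) (N : nat)
    (c : circle (N%:R * l)) : circle l :=
  chart (circle l) (repr (c : circle_pt (N%:R * l))).

(* A sheaf of groups on X all of whose sections are functions with values *)
(* in a fixed group F, singled out by a local condition at each point:    *)
(* "adm x g" is the condition on g at the point chart X x.  Functions are *)
(* total, but only their values on the open set at hand are relevant.     *)
Record gsheaf (R : realType) (X : curve R) (F : groupType) := GSheaf {
  adm : R -> (X -> F) -> Prop;
  adm_near : forall x g g', (\forall y \near x, g (chart X y) = g' (chart X y)) ->
    adm x g -> adm x g';
  adm1 : forall x, adm x (fun _ => 1%g);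
  admM : forall x g g', adm x g -> adm x g' -> adm x (fun c => g c * g' c)%g;
  admV : forall x g, adm x g -> adm x (fun c => (g c)^-1)%g }.

Definition gsec (R : realType) (X : curve R) (F : groupType) (G : gsheaf X F)
    (U : oset X) (g : X -> F) : Prop :=
  forall x, U (chart X x) -> adm G x g.

(* Right torsors under G: sheaves of sets on X, locally non-empty, on which *)
(* G acts simply transitively.                                              *)
Record torsor (R : realType) (X : curve R) (F : groupType) (G : gsheaf X F) :=
  Torsor {
  tsec :> oset X -> Type;
  tres : forall U V : oset X, V `<=` U -> tsec U -> tsec V;
  tres_id : forall (U : oset X) (h : U `<=` U) p, tres h p = p;
  tres_comp : forall (U V W : oset X)
    (h : V `<=` U) (h' : W `<=` V) (h'' : W `<=` U) p,
    tres h' (tres h p) = tres h'' p;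
  tsep : forall (I : Type) (U : oset X) (V : I -> oset X)
      (h : forall i, V i `<=` U) p q,
    (forall c, U c -> exists i, V i c) ->
    (forall i, tres (h i) p = tres (h i) q) -> p = q;
  tglue : forall (I : Type) (U : oset X) (V : I -> oset X)
      (h : forall i, V i `<=` U) (p : forall i, tsec (V i)),
    (forall c, U c -> exists i, V i c) ->
    (forall i j (W : oset X) (hi : W `<=` V i) (hj : W `<=` V j),
       tres hi (p i) = tres hj (p j)) ->
    exists q, forall i, tres (h i) q = p i;
  tact : forall U, tsec U -> (X -> F) -> tsec U;
  tact_ext : forall U (p : tsec U) g g', gsec G U g -> gsec G U g' ->
    (forall c, U c -> g c = g' c) -> tact p g = tact p g';
  tact1 : forall U (p : tsec U), tact p (fun _ => 1%g) = p;
  tactM : forall U (p : tsec U) g g', gsec G U g -> gsec G U g' ->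
    tact (tact p g) g' = tact p (fun c => g c * g' c)%g;
  tact_res : forall (U V : oset X) (h : V `<=` U) p g, gsec G U g ->
    tres h (tact p g) = tact (tres h p) g;
  tfree : forall U (p : tsec U) g g', gsec G U g -> gsec G U g' ->
    tact p g = tact p g' -> forall c, U c -> g c = g' c;
  ttrans : forall U (p q : tsec U), exists2 g, gsec G U g & q = tact p g;
  tnonempty : forall c, exists2 U : oset X, U c & inhabited (tsec U) }.

(* Morphisms P -> P' over a map f of curves, equivariant for a homomorphism *)
(* of sheaves phi : G -> f_* G'.  They send a section over U to sections    *)
(* over all open V with f(V) contained in U, compatibly with restriction.   *)
Record tmor (R : realType) (X Y : curve R) (F F' : groupType)
    (G : gsheaf X F) (G' : gsheaf Y F') (f : Y -> X)
    (phi : (X -> F) -> (Y -> F')) (P : torsor G) (P' : torsor G') := TMor {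
  tmap :> forall (U : oset X) (V : oset Y), V `<=` f @^-1` U -> P U -> P' V;
  tmap_res : forall (U U1 : oset X) (V V1 : oset Y) (h : V `<=` f @^-1` U)
      (h1 : V1 `<=` f @^-1` U1) (hU : U1 `<=` U) (hV : V1 `<=` V) p,
    tmap h1 (tres hU p) = tres hV (tmap h p);
  tmap_act : forall (U : oset X) (V : oset Y) (h : V `<=` f @^-1` U) p g, gsec G U g ->
    tmap h (tact p g) = tact (tmap h p) (phi g) }.

(* P' is the torsor obtained from P by change of structure group along   *)
(* phi : G -> G', equivalently there is a phi-equivariant map P -> P'.   *)
Definition is_pushforward (R : realType) (X : curve R) (F F' : groupType)
    (G : gsheaf X F) (G' : gsheaf X F') (phi : (X -> F) -> (X -> F'))
    (P : torsor G) (P' : torsor G') : Prop :=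
  inhabited (tmor id phi P P').

Definition torsor_iso (R : realType) (X : curve R) (F : groupType)
    (G : gsheaf X F) (P Q : torsor G) : Prop :=
  exists m : tmor id id P Q, forall U, bijective (m U U (@subset_refl _ U)).

Definition H1 (R : realType) (X : curve R) (F : groupType) (G : gsheaf X F) :=
  classes (@torsor_iso R X F G).

(* The pullback of P to the universal cover R of R / l Z has a            *)
(* trivialization (carrying a local section p to the function d p) on     *)
(* which the deck transformation x |-> x + l acts through c, a section    *)
(* over R of the pulled back sheaf of groups G'.                          *)
Definition has_automorphy (R : realType) (l : R) (F : groupType)
    (G : gsheaf (circle l) F) (G' : gsheaf (line R) F) (P : torsor G)
    (c : R -> F) : Prop :=
  exists d : forall U : oset (circle l), P U -> R -> F,
  [/\ forall (U : oset (circle l)) p x, U (chart _ x) -> adm G' x (d U p),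
      forall (U V : oset (circle l)) (h : V `<=` U) p x, V (chart _ x) ->
        d V (tres h p) x = d U p x,
      forall (U : oset (circle l)) p g x, gsec G U g -> U (chart _ x) ->
        d U (tact p g) x = (d U p x * g (chart _ x))%g
    & forall (U : oset (circle l)) p x, U (chart _ x) -> d U p (x + l) = (c x * d U p x)%g].

Section ConstSheaf.
Variables (R : realType) (X : curve R) (A : groupType).

Definition locally_constant (x : R) (g : X -> A) :=
  \forall y \near x, g (chart X y) = g (chart X x).

Lemma locally_constant_near x g g' :
  (\forall y \near x, g (chart X y) = g' (chart X y)) ->
  locally_constant x g -> locally_constant x g'.
Proof.
move=> gg' cg; have /= e := nbhs_singleton gg'; rewrite /locally_constant -e.
by near=> y; rewrite -(near gg' y) //; near: y.
Unshelve. all: by end_near. Qed.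

Lemma locally_constant1 x : locally_constant x (fun _ => 1%g).
Proof. by near=> y. Unshelve. all: by end_near. Qed.

Lemma locally_constantM x g g' : locally_constant x g -> locally_constant x g' ->
  locally_constant x (fun c => g c * g' c)%g.
Proof.
move=> cg cg'; near=> y; congr (_ * _)%g; [exact: (near cg y)|exact: (near cg' y)].
Unshelve. all: by end_near. Qed.

Lemma locally_constantV x g : locally_constant x g ->
  locally_constant x (fun c => (g c)^-1)%g.
Proof.
move=> cg; near=> y; congr (_^-1)%g; exact: (near cg y).
Unshelve. all: by end_near. Qed.

Definition const_sheaf : gsheaf X A :=
  GSheaf locally_constant_near locally_constant1 locally_constantM
    locally_constantV.
End ConstSheaf.

Notation realmx R A := (map_mx (intr : int -> R) A).

Section HarmonicSheaf.
Variables (R : realType) (X : curve R) (s : nat).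

(* h is linear with integer slopes on either side of the point chart X x, *)
(* and its outgoing slopes a, b there sum to 0.  The values are vectors:  *)
(* these are the sections of Z^s (x) H_X.                                 *)
Definition harmonic (x : R) (h : X -> 'cV[R]_s) :=
  exists a b : 'cV[int]_s, a + b = 0 /\
    \forall t \near 0^'+,
      h (chart X (x + t)) = h (chart X x) + t *: realmx R a /\
      h (chart X (x - t)) = h (chart X x) + t *: realmx R b.

Lemma near_sides (x : R) (P : R -> Prop) : (\forall y \near x, P y) ->
  \forall t \near 0^'+, P (x + t) /\ P (x - t).
Proof.
move=> /nbhs_ballP[e /= e0 he]; near=> t.
have t0 : 0 < t by [].
have te : t < e by near: t; exact: nbhs_right_lt.
split; apply: he; rewrite /ball /=.
  by rewrite opprD addrA subrr sub0r normrN gtr0_norm.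
by rewrite opprB addrC subrK gtr0_norm.
Unshelve. all: by end_near. Qed.

Lemma harmonic_near x h h' :
  (\forall y \near x, h (chart X y) = h' (chart X y)) ->
  harmonic x h -> harmonic x h'.
Proof.
move=> hh' [a [b [ab H]]]; exists a, b; split=> //.
have e := nbhs_singleton hh'; have S := near_sides hh'.
near=> t; rewrite -e.
have [<- <-] : h (chart X (x + t)) = h' (chart X (x + t)) /\
  h (chart X (x - t)) = h' (chart X (x - t)) by near: t.
by near: t.
Unshelve. all: by end_near. Qed.

Lemma harmonic0 x : harmonic x (fun _ => 0).
Proof.
exists 0, 0; split; first by rewrite addr0.
by near=> t; rewrite map_mx0 scaler0 addr0.
Unshelve. all: by end_near. Qed.

Lemma harmonicD x h h' : harmonic x h -> harmonic x h' ->
  harmonic x (fun c => h c + h' c).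
Proof.
move=> [a [b [ab H]]] [a' [b' [ab' H']]]; exists (a + a'), (b + b'); split.
  by rewrite addrACA ab ab' addr0.
near=> t.
have [-> ->] : h (chart X (x + t)) = h (chart X x) + t *: realmx R a /\
  h (chart X (x - t)) = h (chart X x) + t *: realmx R b by near: t.
have [-> ->] : h' (chart X (x + t)) = h' (chart X x) + t *: realmx R a' /\
  h' (chart X (x - t)) = h' (chart X x) + t *: realmx R b' by near: t.
by rewrite !map_mxD !scalerDr; split; rewrite addrACA.
Unshelve. all: by end_near. Qed.

Lemma harmonicM (A : 'M[int]_s) x h : harmonic x h ->
  harmonic x (fun c => realmx R A *m h c).
Proof.
move=> [a [b [ab H]]]; exists (A *m a), (A *m b); split.
  by rewrite -mulmxDr ab mulmx0.
near=> t.
have [-> ->] : h (chart X (x + t)) = h (chart X x) + t *: realmx R a /\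
  h (chart X (x - t)) = h (chart X x) + t *: realmx R b by near: t.
by rewrite !map_mxM !mulmxDr !scalemxAr.
Unshelve. all: by end_near. Qed.

Lemma harmonicN x h : harmonic x h -> harmonic x (fun c => - h c).
Proof.
move=> /(@harmonicM (- 1%:M)); apply: harmonic_near; near=> y.
by rewrite map_mxN map_mx1 mulNmx mul1mx.
Unshelve. all: by end_near. Qed.

Definition harm_sheaf : gsheaf X (GRing.to_multiplicative 'cV[R]_s) :=
  @GSheaf R X (GRing.to_multiplicative 'cV[R]_s) harmonic harmonic_near harmonic0
    harmonicD harmonicN.

(* The slope of h at c in the positive direction; it identifies           *)
(* Omega = H_X / R with the locally constant integer valued functions.    *)
Definition slope (h : X -> 'cV[R]_s) (c : X) : 'cV[int]_s :=
  xget 0 [set a | forall x, chart X x = c ->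
    \forall t \near 0^'+, h (chart X (x + t)) = h c + t *: realmx R a].
End HarmonicSheaf.

(* Picard groups: Pic(Gamma) (x) Z^s = H^1(Gamma, Z^s (x) H_Gamma)      *)

Section Picard.
Variables (R : realType) (l : R) (s : nat).

Definition pic_fun (m : 'cV[int]_s) (v : 'cV[R]_s) :
    R -> GRing.to_multiplicative 'cV[R]_s :=
  fun x => v + x *: realmx R m.

(* The bundles with factor of automorphy v + x m form one isomorphism     *)
(* class, of degree m.  For fixed m this makes the set of classes of      *)
(* degree m a quotient of R^s by the translations in l Z^s, hence a       *)
(* torsor under the real torus R^s / l Z^s; Pic is the disjoint union.    *)
Definition Pic : tspace :=
  @induced_tspace (tspace_of {m : 'cV[int]_s & 'cV[R]_s})
    (H1 (harm_sheaf (circle l) s))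
    (fun c mv => exists2 P, c = class_of _ P &
      has_automorphy (harm_sheaf (line R) s) P
        (pic_fun (tag mv) (tagged mv))).

Definition to_slope (X : curve R) (h : X -> GRing.to_multiplicative 'cV[R]_s) :
    X -> GRing.to_multiplicative 'cV[int]_s :=
  @slope R X s h.

Definition pic_has_degree (P : torsor (harm_sheaf (circle l) s))
    (d : 'cV[int]_s) : Prop :=
  exists2 E : torsor (const_sheaf (circle l) (GRing.to_multiplicative 'cV[int]_s)),
    is_pushforward (@to_slope (circle l)) P E
  & has_automorphy (const_sheaf (line R) _) E (fun _ => d).

Definition Pic_deg (d : 'cV[int]_s) : tspace :=
  subspace_of (fun c : Pic => exists2 P, in_class c P & pic_has_degree P d).
End Picard.

(* M = Z^r (rows), M^vee = Z^r (columns), with the canonical pairing m *m v. *)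
Record root_datum (r : nat) := RootDatum {
  ridx : finType;
  rd_root : ridx -> 'rV[int]_r;
  rd_coroot : ridx -> 'cV[int]_r;
  root_inj : injective rd_root;
  coroot_inj : injective rd_coroot;
  root_coroot : forall i, (rd_root i *m rd_coroot i) 0 0 = 2;
  root_refl : forall i j, exists k,
    rd_root k = rd_root j - (rd_root j *m rd_coroot i) 0 0 *: rd_root i;
  coroot_refl : forall i j, exists k,
    rd_coroot k = rd_coroot j - (rd_root i *m rd_coroot j) 0 0 *: rd_coroot i }.

Section Weyl.
Variables (r : nat) (D : root_datum r).

Definition refl (i : ridx D) : 'M[int]_r := 1%:M - rd_coroot i *m rd_root i.

Definition refl_word (s : seq (ridx D)) : 'M[int]_r :=
  foldr (fun i A => refl i *m A) 1%:M s.

Definition is_weyl (w : 'M[int]_r) : bool := `[< exists s, w = refl_word s >].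

Record weyl := Weyl { weyl_mx :> 'M[int]_r; weylP : is_weyl weyl_mx }.
HB.instance Definition _ := [isSub for weyl_mx].
HB.instance Definition _ := [Choice of weyl by <:].

Lemma refl_word_cat s t : refl_word (s ++ t) = refl_word s *m refl_word t.
Proof. by elim: s => [|i s IH] /=; rewrite ?mul1mx // IH mulmxA. Qed.

Lemma reflK i : refl i *m refl i = 1%:M.
Proof.
have e : rd_coroot i *m rd_root i *m (rd_coroot i *m rd_root i) = (rd_coroot i *m rd_root i) *+ 2.
  rewrite -mulmxA (mulmxA (rd_root i)) [rd_root i *m rd_coroot i]mx11_scalar.
  by rewrite root_coroot mul_scalar_mx -scalemxAr scaler_nat.
rewrite /refl mulmxBl mul1mx mulmxBr mulmx1 e mulr2n opprB.
by rewrite addrK subrK.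
Qed.

Lemma refl_word_rev s : refl_word (rev s) *m refl_word s = 1%:M.
Proof.
elim: s => [|i s IH] /=; first by rewrite mul1mx.
rewrite rev_cons -cats1 refl_word_cat /= mulmx1 -mulmxA (mulmxA (refl i)).
by rewrite reflK mul1mx.
Qed.

Lemma is_weylM (w w' : weyl) : is_weyl (w *m w').
Proof.
have /asboolP[s ->] := weylP w; have /asboolP[s' ->] := weylP w'.
by apply/asboolP; exists (s ++ s'); rewrite refl_word_cat.
Qed.

Lemma is_weyl1 : is_weyl 1%:M.
Proof. by apply/asboolP; exists [::]. Qed.

Lemma weyl_unit (w : weyl) : weyl_mx w \in unitmx.
Proof.
have /asboolP[s ->] := weylP w.
by case: (mulmx1_unit (refl_word_rev s)).
Qed.

Lemma is_weylV (w : weyl) : is_weyl (invmx w).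
Proof.
have := weyl_unit w; have /asboolP[s ->] := weylP w; move=> u.
apply/asboolP; exists (rev s).
by rewrite -[RHS]mulmx1 -(mulmxV u) mulmxA refl_word_rev mul1mx.
Qed.

Definition weyl_mul w w' := Weyl (is_weylM w w').
Definition weyl_one := Weyl is_weyl1.
Definition weyl_inv w := Weyl (is_weylV w).

Lemma weyl_mulA : associative weyl_mul.
Proof. by move=> x y z; apply/val_inj; exact: mulmxA. Qed.
Lemma weyl_mul1w : left_id weyl_one weyl_mul.
Proof. by move=> x; apply/val_inj; exact: mul1mx. Qed.
Lemma weyl_mulw1 : right_id weyl_one weyl_mul.
Proof. by move=> x; apply/val_inj; exact: mulmx1. Qed.
Lemma weyl_mulVw : left_inverse weyl_one weyl_inv weyl_mul.
Proof. by move=> x; apply/val_inj; exact: mulVmx (weyl_unit x). Qed.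
Lemma weyl_mulwV : right_inverse weyl_one weyl_inv weyl_mul.
Proof. by move=> x; apply/val_inj; exact: mulmxV (weyl_unit x). Qed.

HB.instance Definition _ := isGroup.Build weyl
  weyl_mulA weyl_mul1w weyl_mulw1 weyl_mulVw weyl_mulwV.

Definition coroot_lattice (v : 'cV[int]_r) : bool :=
  `[< exists z : ridx D -> int, v = \sum_i z i *: rd_coroot i >].

Lemma coroot_lattice_closed : zmod_closed coroot_lattice.
Proof.
split=> [|x y /asboolP[z ->] /asboolP[z' ->]]; apply/asboolP.
  by exists (fun _ => 0); rewrite big1 // => i _; rewrite scale0r.
exists (fun i => z i - z' i); rewrite -sumrB.
by apply: eq_bigr => i _; rewrite scalerBl.
Qed.
HB.instance Definition _ :=
  GRing.isZmodClosed.Build _ coroot_lattice coroot_lattice_closed.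

Definition pi1 := Quotient.quot (GRing.ZmodClosed.clone _ coroot_lattice _).
HB.instance Definition _ := GRing.Zmodule.on pi1.

Definition pi1_class (v : 'cV[int]_r) : pi1 := (\pi_pi1 v)%qT.

Definition coroot_saturation (v : 'cV[int]_r) : Prop :=
  exists2 c : nat, (0 < c)%N & coroot_lattice (v *+ c).

Variable R : realType.

Definition tropG : Type := ('cV[R]_r * weyl)%type.
HB.instance Definition _ := Choice.on tropG.

Definition tropG_mul (g g' : tropG) : tropG :=
  (g.1 + realmx R g.2 *m g'.1, (g.2 * g'.2)%g).
Definition tropG_one : tropG := (0, 1%g).
Definition tropG_inv (g : tropG) : tropG :=
  (- (realmx R (g.2^-1)%g *m g.1), (g.2^-1)%g).

Lemma realmx1 : realmx R (1%g : weyl) = 1%:M :> 'M[R]_r.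
Proof. exact: map_mx1. Qed.
Lemma realmxM (w w' : weyl) :
  realmx R (w * w')%g = realmx R w *m realmx R w' :> 'M[R]_r.
Proof. exact: map_mxM. Qed.

Lemma tropG_mulA : associative tropG_mul.
Proof.
move=> x y z; rewrite /tropG_mul /= realmxM mulmxDr !mulmxA addrA.
by congr pair; exact: mulgA.
Qed.
Lemma tropG_mul1 : left_id tropG_one tropG_mul.
Proof.
by case=> v w; rewrite /tropG_mul /= realmx1 mul1mx add0r mul1g.
Qed.
Lemma tropG_mulg1 : right_id tropG_one tropG_mul.
Proof. by case=> v w; rewrite /tropG_mul /= mulmx0 addr0 mulg1. Qed.
Lemma tropG_mulV : left_inverse tropG_one tropG_inv tropG_mul.
Proof. by case=> v w; rewrite /tropG_mul /= addNr mulVg. Qed.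
Lemma tropG_mulgV : right_inverse tropG_one tropG_inv tropG_mul.
Proof.
case=> v w; congr pair; last exact: mulgV.
rewrite /tropG_inv [X in realmx R X *m _]/= [X in _ *m X]/= mulmxN mulmxA.
by rewrite -(realmxM w w^-1%g) mulgV realmx1 mul1mx subrr.
Qed.
HB.instance Definition _ := isGroup.Build tropG
  tropG_mulA tropG_mul1 tropG_mulg1 tropG_mulV tropG_mulgV.

Variable X : curve R.

Definition G_adm (x : R) (g : X -> tropG) : Prop :=
  harmonic x (fun c => (g c).1) /\ locally_constant x (fun c => (g c).2).

Lemma G_adm_near x g g' : (\forall y \near x, g (chart X y) = g' (chart X y)) ->
  G_adm x g -> G_adm x g'.
Proof.
move=> gg' [h c]; split.
  by apply: harmonic_near h; near=> y; congr fst; near: y.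
by apply: locally_constant_near c; near=> y; congr snd; near: y.
Unshelve. all: by end_near. Qed.

Lemma G_adm1 x : G_adm x (fun _ => 1%g).
Proof. by split; [exact: harmonic0|exact: locally_constant1]. Qed.

Lemma G_admM x g g' : G_adm x g -> G_adm x g' ->
  G_adm x (fun c => g c * g' c)%g.
Proof.
move=> [h c] [h' c']; split; last exact: locally_constantM.
apply: harmonicD h _.
apply: harmonic_near (harmonicM (weyl_mx (g (chart X x)).2) h').
by near=> y; congr (realmx R (weyl_mx _) *m _); apply/esym; near: y.
Unshelve. all: by end_near. Qed.

Lemma G_admV x g : G_adm x g -> G_adm x (fun c => (g c)^-1)%g.
Proof.
move=> [h c]; have c' := locally_constantV c; split=> //.
apply: harmonicN.
apply: harmonic_near (harmonicM (weyl_mx ((g (chart X x)).2^-1)%g) h).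
by near=> y; congr (realmx R (weyl_mx _) *m _); apply/esym; near: y.
Unshelve. all: by end_near. Qed.

Definition G_sheaf : gsheaf X tropG :=
  GSheaf G_adm_near G_adm1 G_admM G_admV.
End Weyl.

Definition std_root (E : finType) (s t : E) : {ffun E -> int} :=
  [ffun e => (e == s)%:R - (e == t)%:R].

(* An isomorphism of the root system of D with that of                    *)
(* prod_i A_(n_i - 1), whose roots are the e_s - e_t for s <> t in the    *)
(* same block of E = {(i, a) | a < n_i}.  The last field says that root j *)
(* |-> e_(src j) - e_(tgt j) extends to a well-defined and injective      *)
(* linear map on the span of the roots.                                   *)
Record typeA (r : nat) (D : root_datum r) (k : nat) (n : 'I_k -> nat) := TypeA {
  typeA_gt0 : forall i, (0 < n i)%N;
  src : ridx D -> {i : 'I_k & 'I_(n i)};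
  tgt : ridx D -> {i : 'I_k & 'I_(n i)};
  src_tgt : forall j, tag (src j) = tag (tgt j) /\ src j <> tgt j;
  typeA_surj : forall s t, tag s = tag t -> s <> t ->
    exists j, src j = s /\ tgt j = t;
  typeA_lin : forall c : ridx D -> int,
    \sum_j c j *: rd_root j = 0 <->
    \sum_j (std_root (src j) (tgt j)) *~ c j = 0 }.

Section TypeA.
Variables (r : nat) (D : root_datum r) (k : nat) (n : 'I_k -> nat).
Variable tA : typeA D n.

(* The coweight lattice of A_(n-1), dual to its root lattice, is Z^n modulo *)
(* (1, ..., 1); modulo coroots it is Z/n by the sum of coordinates.  So if  *)
(* x represents the image of v in M^vee_ad, the i-th component of its image *)
(* in pi_1(G^ad) is the sum of x over the i-th block, modulo n_i.           *)
Definition stable (lam : pi1 D) : Prop :=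
  forall v, pi1_class D v = lam ->
  exists2 x : {i : 'I_k & 'I_(n i)} -> int,
    forall j, (rd_root j *m v) 0 0 = x (src tA j) - x (tgt tA j)
  & forall i, coprime (absz (\sum_(e | tag e == i) x e)) (n i).

(* Under W = prod_i S_(n_i), w is an n_i-cycle in each factor. *)
Definition is_coxeter (w : weyl D) : Prop :=
  exists sigma : {perm {i : 'I_k & 'I_(n i)}},
  [/\ forall e, tag (sigma e) = tag e,
      forall j, exists j', [/\ src tA j' = sigma (src tA j),
        tgt tA j' = sigma (tgt tA j) & rd_root j = rd_root j' *m weyl_mx w]
    & forall e e', tag e = tag e' -> e' \in porbit sigma e].

Definition cover_degree : nat := \big[lcmn/1%N]_(i < k) n i.
End TypeA.

Section Moduli.
Variables (R : realType) (l : R) (r : nat) (D : root_datum r).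

Definition bundle := torsor (G_sheaf D (circle l)).

Definition to_W (X : curve R) (g : X -> tropG D R) : X -> weyl D :=
  fun c => (g c).2.

(* G_X -> Omega (x) pi_1(G), with Omega (x) pi_1(G) seen as the sheaf of *)
(* locally constant functions with values in pi_1(G).                    *)
Definition to_pi1 (X : curve R) (g : X -> tropG D R) :
    X -> GRing.to_multiplicative (pi1 D) :=
  fun c => pi1_class D (slope (fun c' => (g c').1) c).

Definition incl_mod (X : curve R) (h : X -> GRing.to_multiplicative 'cV[R]_r) :
    X -> tropG D R :=
  fun c => (h c : 'cV[R]_r, 1%g).

Definition has_degree (P : bundle) (lam : pi1 D) : Prop :=
  exists2 E : torsor (const_sheaf (circle l) (GRing.to_multiplicative (pi1 D))),
    is_pushforward (@to_pi1 (circle l)) P E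
  & has_automorphy (const_sheaf (line R) _) E (fun _ => lam).

Definition W_torsor (X : curve R) := torsor (const_sheaf X (weyl D)).

Definition has_monodromy (E : W_torsor (circle l)) (w : weyl D) : Prop :=
  has_automorphy (const_sheaf (line R) _) E (fun _ => w).

Variable ind : W_torsor (circle l).

(* A bundle with an isomorphism between its W-torsor and ind: by the      *)
(* universal property of the associated W-torsor, the latter amounts to   *)
(* an equivariant map to ind.                                             *)
Record framed := Framed {
  fbundle : bundle;
  framing : tmor id (@to_W (circle l)) fbundle ind }.

Definition framed_iso (P Q : framed) : Prop :=
  exists2 m : tmor id id (fbundle P) (fbundle Q),
    forall U, bijective (m U U (@subset_refl _ U))
  & forall U p, framing Q U U (@subset_refl _ U) (m U U (@subset_refl _ U) p) =
      framing P U U (@subset_refl _ U) p.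

(* The cover f : Gamma' -> Gamma, with ind' = f^* ind and a global section *)
(* triv of ind' (a trivialization).                                        *)
Variables (N : nat) (ind' : W_torsor (circle (N%:R * l))).
Let f : circle (N%:R * l) -> circle l := @circle_cover R l N.
Variable pull : tmor f (fun g => g \o f) ind ind'.
Variable triv : ind' (ofull _).

(* Q is the reduction of f^* P to M^vee (x) H_Gamma' given by triv: with  *)
(* P' = f^* P and the induced map s : P' -> ind', the image of Q in P' is *)
(* sent to triv by s.                                                     *)
Definition is_reduction (P : framed)
    (Q : torsor (harm_sheaf (circle (N%:R * l)) r)) : Prop :=
  exists (P' : torsor (G_sheaf D (circle (N%:R * l))))
    (b : tmor f (fun g => g \o f) (fbundle P) P')
    (s : tmor id (@to_W _) P' ind') (i : tmor id (@incl_mod _) Q P'),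
    (forall (U : oset (circle l)) (V : oset (circle (N%:R * l)))
        (h : V `<=` f @^-1` U) p,
       s V V (@subset_refl _ V) (b U V h p) =
       pull U V h (framing P U U (@subset_refl _ U) p)) /\
    (forall V q, s V V (@subset_refl _ V) (i V V (@subset_refl _ V) q) =
       tres (U := ofull _) (@subsetT _ V) triv).

(* M_framed has the topology induced from Pic(Gamma') (x) M^vee. *)
Definition M_framed : tspace :=
  @induced_tspace (Pic (N%:R * l) r) (classes framed_iso)
    (fun c q => exists P Q,
      [/\ c = class_of _ P, q = class_of _ Q & is_reduction P Q]).

(* The isomorphism classes of bundles with W-torsor isomorphic to ind, as  *)
(* a quotient of M_framed; the fibres are the orbits of Aut(ind).          *)
Definition M_ind : tspace :=
  @induced_tspace M_framed
    {c : H1 (G_sheaf D (circle l)) | exists P, c = class_of _ (fbundle P)}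
    (fun c x => exists2 P, sval c = class_of _ (fbundle P) & x = class_of _ P).

Definition M_ind_deg (lam : pi1 D) : tspace :=
  subspace_of
    (fun c : M_ind => exists2 P, in_class (sval c) P & has_degree P lam).
End Moduli.

(* Q presents the quotient of M^vee by the saturation of the coroot lattice *)
(* as Z^s: it is the determinant on cocharacters, for a choice of basis.    *)
Definition is_det_matrix (r : nat) (D : root_datum r) (s : nat)
    (Q : 'M[int]_(s, r)) : Prop :=
  (forall u : 'cV[int]_s, exists v : 'cV[int]_r, Q *m v = u) /\
  (forall v : 'cV[int]_r, Q *m v = 0 <-> coroot_saturation D v).

(* The induced map on pi_1 (Q is constant on classes modulo coroots). *)
Definition det_pi1 (r : nat) (D : root_datum r) (s : nat)
    (Q : 'M[int]_(s, r)) (lam : pi1 D) : 'cV[int]_s :=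
  Q *m repr lam.

Definition det_map (R : realType) (X : curve R) (r : nat) (D : root_datum r)
    (s : nat) (Q : 'M[int]_(s, r)) (g : X -> tropG D R) :
    X -> GRing.to_multiplicative 'cV[R]_s :=
  fun c => realmx R Q *m (g c).1.

(* Main.v *)
(* A torsor on R / l Z is trivial on the universal cover R, hence is described *)
(* by a factor of automorphy; for a G-bundle with W-torsor ind this is         *)
(* x |-> (v + x m, w), with m in M^vee of class the degree, v in M^vee_R and   *)
(* w the monodromy of ind.  A change of trivialization by (a + x mu, u), with  *)
(* u in the centralizer of w, replaces (m, v) by                               *)
(*   (u m + (1 - w) mu, u v + (1 - w) a + l mu),                               *)
(* and the determinant is (m, v) |-> (Q m, Q v), with v only defined modulo    *)
(* l Z^s in the target.  Its kernel on v is the real span of the coroots,      *)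
(* which is (1 - w) M^vee_R as w is a product of full cycles.  So injectivity  *)
(* amounts to: if m is stable, every z in the coroot lattice can be written    *)
(* (u - 1) m + (1 - w) mu with u centralizing w and mu in the coroot lattice.  *)
(* Let u act on the i-th block as w ^ a_i, and let d_i be the i-th component of *)
(* the degree.  Solving for mu in the coweights is immediate, and mu lies in   *)
(* the coroot lattice when c_i + a_i d_i = 0 modulo n_i, for some c_i given by  *)
(* z: such an a_i exists as gcd(d_i, n_i) = 1.                                  *)
(* For the topology, let N be the degree of the cover Gamma'; the reduction to *)
(* Pic(Gamma') (x) M^vee has factor (t S m, t (S v + l T m)) for fixed         *)
(* matrices with Q t S = N Q and Q t T = c Q, so that (Q m, Q v) depends       *)
(* continuously on it; conversely, for m fixed and v = B (Q v) with Q B = 1,   *)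
(* it is an affine function of Q v.                                            *)

Require Import Defs.
From mathcomp Require Import all_boot all_order all_algebra.
From mathcomp Require Import all_classical all_reals all_analysis.
From mathcomp Require Import perm ring lra zify.

Set Implicit Arguments.
Unset Strict Implicit.
Unset Printing Implicit Defensive.

Import Order.TTheory GRing.Theory Num.Theory.
Import numFieldNormedType.Exports.
Local Open Scope classical_set_scope.
Local Open Scope ring_scope.

Local Notation realmx R A := (map_mx (intr : int -> R) A).

(** * Torsors and their trivializations on the universal cover *)

(** Pulled back to the universal cover, a torsor on the circle becomes trivial, and the deck
    transformation then acts through a factor of automorphy, unique up to twisted conjugation
    ([factor_exists], [compare_factored]). Every factor occurs ([factor_torsor]), and torsors with a
    common factor are isomorphic ([iso_of_factor]). Sections over the line are affine, so a G-bundle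
    is encoded by a triple (m, v, w); its degree is the class of m modulo coroots and its
    determinant is (Q m, Q v) ([G_factor_degree], [G_factor_det]).

    Surjectivity comes from an integral right inverse of Q. Injectivity ([same_det_iso]) has an
    integral and a real half. Slopes of equal degree differ by an element of the coroot lattice, and
    [stable_orbit] absorbs it: if u acts on block i as the a_i-th power of the n_i-cycle, then m - u
    m is 1 - w applied to a partial geometric sum of total a_i d_i. As d_i is prime to n_i, the a_i
    can be chosen so that all block sums become divisible by n_i, and block constants, which w
    fixes, remove them. Once the slopes agree, the remaining discrepancy in v is killed by Q, hence
    lies in the image of 1 - w ([det_kernel]), because every coroot has a positive multiple there
    ([coxeter_image]).

    For the topology, both sides are compared at the level of factors. [reduction_factor] computes
    the factor of the reduction on the cover. Its determinant returns (Q m, Q v) up to the factor N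
    and a shift depending on the slope only, which gives continuity ([det_ind_continuous]). In the
    other direction, a fixed slope and a linear section of Q give an affine family of bundles over
    the target ([det_ind_open]). *)

Section CircleChart.
Variables (R : realType) (l : R).

Lemma chart_eqP x y : chart (circle l) x = chart (circle l) y <->
  exists n : int, y - x = n%:~R * l.
Proof.
split=> [/eqP|h].
  by rewrite -[_ == _]/(_ == _ %[mod circle_pt l])%qT eqmodE => /asboolP.
apply/eqP; rewrite -[_ == _]/(_ == _ %[mod circle_pt l])%qT eqmodE.
exact/asboolP.
Qed.

Lemma chart_addz x (n : int) :
  chart (circle l) (x + n%:~R * l) = chart (circle l) x.
Proof. by apply/esym/chart_eqP; exists n; rewrite addrC addKr. Qed.

Lemma chart_addl x : chart (circle l) (x + l) = chart (circle l) x.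
Proof. by have := chart_addz x 1; rewrite mul1r. Qed.

Lemma chart_repr (c : circle l) : chart (circle l) (repr (c : circle_pt l)) = c.
Proof. exact: (@reprK _ (circle_pt l)). Qed.

Lemma chart_surj (c : circle l) : exists x, chart (circle l) x = c.
Proof. by exists (repr (c : circle_pt l)); exact: chart_repr. Qed.

Lemma periodicz (T : Type) (U : circle l -> Prop) (f : R -> T) :
  (forall x, U (chart _ x) -> f (x + l) = f x) ->
  forall (n : int) x, U (chart _ x) -> f (x + n%:~R * l) = f x.
Proof.
move=> fl; elim/int_ind => [x _|n IH x Ux|n IH x Ux]; first by rewrite mul0r addr0.
  have -> : x + n.+1%:~R * l = (x + n%:~R * l) + l by rewrite intS intrD; ring.
  by rewrite fl ?chart_addz //; exact: IH.
rewrite -(IH x Ux).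
have -> : x + (- n%:Z)%:~R * l = (x + (- n.+1%:Z)%:~R * l) + l.
  by rewrite intS opprD intrD; ring.
by rewrite fl ?chart_addz.
Qed.
End CircleChart.

Section OpenSets.
Variables (R : realType) (X : curve R).

Definition ointer (U V : oset X) : oset X := @OSet R X (U `&` V) (openI (@oset_open _ _ U) (@oset_open _ _ V)).

Lemma ointerl U V : ointer U V `<=` U. Proof. by move=> c []. Qed.
Lemma ointerr U V : ointer U V `<=` V. Proof. by move=> c []. Qed.

Lemma near_oset (U : oset X) x : U (chart X x) -> \forall y \near x, U (chart X y).
Proof. by move=> Ux; apply: open_nbhs_nbhs; split; first exact: (@oset_open _ _ U). Qed.

End OpenSets.

Section TorsorDifference.
Variables (R : realType) (X : curve R) (F : groupType) (G : gsheaf X F).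

Lemma gsec_sub (U V : oset X) g : V `<=` U -> gsec G U g -> gsec G V g.
Proof. by move=> VU sg x /VU; apply: sg. Qed.

Lemma tact_const1 (P : torsor G) U (p : P U) g : gsec G U g ->
  (forall c, U c -> g c = 1%g) -> tact p g = p.
Proof.
move=> sg g1; rewrite -[RHS](tact1 p); apply: tact_ext => //.
by move=> x _; exact: adm1.
Qed.
End TorsorDifference.

Section Twisted.
Variables (R : realType) (X Y : curve R) (F F' : groupType) (G : gsheaf X F).
Variables (L : gsheaf (line R) F').
Variables (phi : (X -> F) -> Y -> F').

(* e carries local sections of P to functions on the universal cover, as a *)
(* trivialization of the pushforward of P along phi does.                  *)
Definition twisted_on (P : torsor G) (I : R -> Prop)
    (e : forall U : oset X, P U -> R -> F') : Prop :=
  [/\ forall (U : oset X) p x, I x -> U (chart _ x) -> adm L x (e U p),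
      forall (U V : oset X) (h : V `<=` U) p x, I x -> V (chart _ x) ->
        e V (tres h p) x = e U p x
    & forall (U : oset X) p g x, I x -> gsec G U g -> U (chart _ x) ->
        e U (tact p g) x = (e U p x * phi g (chart _ x))%g].

(** Two local sections differ by some g, which multiplies e and e' on the right by the same value of
    phi g. So e' e^-1 does not depend on the section and defines b. *)
Lemma compare_twisted (P : torsor G) (I : R -> Prop) (e e' : forall U : oset X, P U -> R -> F') :
  (forall x, I x -> \forall y \near x, I y) ->
  twisted_on I e -> twisted_on I e' ->
  exists b : R -> F', (forall x, I x -> adm L x b) /\
    forall (U : oset X) p x, I x -> U (chart _ x) -> e' U p x = (b x * e U p x)%g.
Proof.
move=> oI [ea er et] [ea' er' et'].
have indep x (U V : oset X) (p : P U) (q : P V) : I x -> U (chart _ x) -> V (chart _ x) ->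
    (e' U p x * (e U p x)^-1 = e' V q x * (e V q x)^-1)%g.
  move=> Ix Ux Vx; pose W := ointer U V.
  have Wx : W (chart _ x) by split.
  rewrite -(er _ _ (@ointerl _ _ U V)) // -(er' _ _ (@ointerl _ _ U V)) //.
  rewrite -(er _ _ (@ointerr _ _ U V)) // -(er' _ _ (@ointerr _ _ U V)) //.
  have [g sg ->] := ttrans (tres (@ointerl _ _ U V) p) (tres (@ointerr _ _ U V) q).
  by rewrite et // et' // invgM mulgA mulgK.
have [b hb] : exists b : R -> F', forall x (U : oset X) (p : P U), I x ->
    U (chart _ x) -> b x = (e' U p x * (e U p x)^-1)%g.
  have H x : exists a, forall (U : oset X) (p : P U), I x -> U (chart _ x) -> a = (e' U p x * (e U p x)^-1)%g.
    have [U Ux [p]] := tnonempty P (chart _ x).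
    by exists (e' U p x * (e U p x)^-1)%g => V q Ix Vx; exact: indep.
  by exists (fun x => sval (cid (H x))) => x; case: (cid (H x)).
exists b; split=> [x Ix|U p x Ix Ux]; last by rewrite (hb x U p) // mulgVK.
have [U Ux [p]] := tnonempty P (chart _ x).
apply: adm_near (admM (ea' U p x Ix Ux) (admV (ea U p x Ix Ux))).
near=> y; apply/esym/hb; near: y; first exact: oI.
exact: near_oset.
Unshelve. all: by end_near. Qed.

Lemma twisted_mul (P : torsor G) (I : R -> Prop) (e : forall U : oset X, P U -> R -> F') (b : R -> F') :
  (forall x, I x -> adm L x b) -> twisted_on I e ->
  twisted_on I (fun U p x => b x * e U p x)%g.
Proof.
move=> ab [ea er et]; split=> [U p x Ix Ux|U V h p x Ix Vx|U p g x Ix sg Ux].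
- exact: admM (ab x Ix) (ea U p x Ix Ux).
- by rewrite er.
- by rewrite et // mulgA.
Qed.

Lemma twisted_sub (P : torsor G) (I J : R -> Prop) (e : forall U : oset X, P U -> R -> F') :
  (forall x, J x -> I x) -> twisted_on I e -> twisted_on J e.
Proof.
move=> JI [ea er et]; split=> [U p x Ix|U V h p x Ix|U p g x Ix]; 
  [exact/ea/JI|exact/er/JI|exact/et/JI].
Qed.
End Twisted.

Section Factor.
Variables (R : realType) (X Y : curve R) (l' : R) (F F' : groupType) (G : gsheaf X F).
Variables (L : gsheaf (line R) F').
Variables (phi : (X -> F) -> Y -> F').

(** The period l' is independent of the curve X carrying P, so that the same predicate covers
    trivializations, pushforwards and pullbacks to a cover. *)
Definition factored (c : R -> F') (P : torsor G) (e : forall U : oset X, P U -> R -> F') :=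
  twisted_on L phi (fun=> True) e /\
  forall (U : oset X) p x, U (chart _ x) -> e U p (x + l') = (c x * e U p x)%g.

(** Factors are unique up to twisted conjugation: evaluating e' = b e at x and at x + l' gives the
    coboundary relation. *)
Lemma compare_factored (P : torsor G) c c' (e e' : forall U : oset X, P U -> R -> F') :
  (forall x, chart X (x + l') = chart X x) ->
  factored c e -> factored c' e' -> exists b : R -> F', [/\ forall x, adm L x b,
    forall (U : oset X) p x, U (chart _ x) -> e' U p x = (b x * e U p x)%g
    & forall x, (b (x + l') * c x = c' x * b x)%g].
Proof.
move=> per [te ce] [te' ce'].
have near_true (x : R) : True -> \forall y \near x, True by move=> _; near=> y.
have [b [ab hb]] := compare_twisted near_true te te'.
exists b; split=> [x|U p x Ux|x]; [exact: ab|exact: hb|].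
have [U Ux [p]] := tnonempty P (chart _ x).
have Uxl : U (chart _ (x + l')) by rewrite per.
have := hb U p _ I Uxl; rewrite ce // ce' // hb // !mulgA => /mulIg.
exact: esym.
Unshelve. all: by end_near. Qed.

Lemma factored_mul (P : torsor G) c (e : forall U : oset X, P U -> R -> F') (b : R -> F') :
  (forall x, adm L x b) -> factored c e ->
  factored (fun x => b (x + l') * c x * (b x)^-1)%g (fun U p x => b x * e U p x)%g.
Proof.
move=> ab [te ce]; split; first by apply: twisted_mul => // x _; exact: ab.
by move=> U p x Ux; rewrite ce // !mulgA mulgVK.
Qed.
End Factor.

Lemma has_automorphyP (R : realType) (l : R) (F : groupType) (G : gsheaf (circle l) F)
    (L : gsheaf (line R) F) (P : torsor G) c :
  has_automorphy L P c <-> exists d, factored (Y := circle l) l L id c (P := P) d.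
Proof.
split=> [[d [h1 h2 h3 h4]]|[d [[h1 h2 h3] h4]]]; exists d.
  split=> //; split=> [U p x _|U V h p x _|U p g x _]; [exact: h1|exact: h2|exact: h3].
split=> // [U p x|U V h p x|U p g x]; [exact: h1|exact: h2|exact: h3].
Qed.

(** L is the pullback of G to the universal cover. [lift_shift] lets deck transformations act on its
    sections; [lift_extend] is the softness that allows trivializations on overlapping intervals to
    be glued. *)
Record lifted_sheaf (R : realType) (l : R) (F : groupType) (G : gsheaf (circle l) F)
    (L : gsheaf (line R) F) : Prop := LiftedSheaf {
  lift_adm : forall x g, adm G x g <-> adm L x (g \o chart (circle l));
  lift_shift : forall a x g, adm L (x + a) g -> adm L x (fun y => g (y + a));
  lift_extend : forall a b g, (forall x, a < x < b -> adm L x g) ->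
    exists2 g', forall x, adm L x g' & forall x, a < x < b -> g' x = g x }.

Section Sections.
Variables (R : realType) (l : R) (F : groupType).
Variables (G : gsheaf (circle l) F) (L : gsheaf (line R) F).
Hypothesis GL : lifted_sheaf G L.
Variables (P : torsor G) (c : R -> F) (d : forall U : oset (circle l), P U -> R -> F).
Hypothesis dc : factored (Y := circle l) l L id c d.

Lemma eq_section (U : oset (circle l)) (p q : P U) :
  (forall x, U (chart _ x) -> d p x = d q x) -> p = q.
Proof.
have [g sg ->] := ttrans p q => e; apply/esym/tact_const1 => // z Uz.
have [x xz] := chart_surj z; rewrite -xz in Uz *.
have [[_ _ da] _] := dc.
by have := e x Uz; rewrite da // -{1}[d p x]mulg1 => /mulgI.
Qed.

(** For a local section q, the quotient of f by d q is periodic because both have factor c. It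
    descends to a section of G, by which q is corrected; the corrected sections agree on overlaps
    and glue. *)
Lemma section_exists (V : oset (circle l)) (f : R -> F) :
  (forall x, V (chart _ x) -> adm L x f) ->
  (forall x, V (chart _ x) -> f (x + l) = (c x * f x)%g) ->
  exists p : P V, forall x, V (chart _ x) -> d p x = f x.
Proof.
move=> af fc; have [[dadm dres dact] dl] := dc.
have loc (z : circle l) : exists W : {U : oset (circle l) & P U}, tag W z.
  by have [U Uz [q]] := tnonempty P z; exists (existT _ U q).
pose J := {z : circle l | V z}.
pose Wz (j : J) := tag (sval (cid (loc (sval j)))).
pose qz (j : J) : P (Wz j) := tagged (sval (cid (loc (sval j)))).
pose Vz (j : J) := ointer V (Wz j).
pose q j : P (Vz j) := tres (@ointerr _ _ V (Wz j)) (qz j).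
pose g j (z : circle l) := let y := repr (z : circle_pt l) in ((d (q j) y)^-1 * f y)%g.
have gE j x : Vz j (chart _ x) -> g j (chart _ x) = ((d (q j) x)^-1 * f x)%g.
  move=> Vx; rewrite /g; set y := repr _.
  have /chart_eqP[n yx] : chart (circle l) x = chart _ y by rewrite chart_repr.
  have -> : y = x + n%:~R * l by rewrite -yx addrC subrK.
  apply: (periodicz (U := Vz j) (f := fun x => ((d (q j) x)^-1 * f x)%g)) => // x' [Vx' Wx].
  by rewrite dl // fc // invgM -mulgA mulKg.
have gs j : gsec G (Vz j) (g j).
  move=> x Vx; apply/(lift_adm GL).
  apply: adm_near (admM (admV (dadm _ (q j) x I Vx)) (af x (Vx.1))).
  near=> y; rewrite /= gE //; near: y; exact: near_oset.
have dE j x : Vz j (chart _ x) -> d (tact (q j) (g j)) x = f x.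
  by move=> Vx; rewrite dact // gE // mulVKg.
have [|i j W hi hj|p hp] := @tglue _ _ _ _ P J V Vz (fun j => @ointerl _ _ V (Wz j))
    (fun j => tact (q j) (g j)).
- move=> z Vz'; exists (exist _ z Vz'); split=> //; rewrite /Wz /=; by case: cid.
- apply: eq_section => x Wx; rewrite !dres // dE ?dE //; [exact: hj|exact: hi].
exists p => x Vx.
pose j : J := exist _ _ Vx.
have Wx : Vz j (chart _ x) by split=> //; rewrite /Wz /=; case: cid.
by rewrite -(dE j) // -hp dres.
Unshelve. all: by end_near. Qed.
End Sections.

Section MorphismOfFactor.
Variables (R : realType) (X : curve R) (l' : R) (F F' : groupType).
Variables (G : gsheaf X F) (G' : gsheaf (circle l') F') (L' : gsheaf (line R) F').
Hypothesis GL' : lifted_sheaf G' L'.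
Variables (f : circle l' -> X) (phi : (X -> F) -> circle l' -> F').
Hypothesis fE : forall x, f (chart _ x) = chart X x.
Hypothesis phi_sec : forall x g, adm G x g -> adm G' x (phi g).
Variables (P : torsor G) (P' : torsor G').

(** A map into P' may be prescribed by its values on the universal cover: since e has the factor of
    d', [section_exists] turns these values into sections, and [eq_section] makes the choice
    unique. *)
Lemma tmor_of_factored c' (d' : forall V : oset (circle l'), P' V -> R -> F')
    (e : forall U : oset X, P U -> R -> F') :
  factored (Y := circle l') l' L' id c' d' -> factored l' L' phi c' e ->
  exists m : tmor f phi P P', forall (U : oset X) (V : oset (circle l')) (h : V `<=` f @^-1` U) p x, V (chart _ x) ->
    d' V (m U V h p) x = e U p x.
Proof.
move=> dc [[ea er et] ec]; have [[_ dr dt] _] := dc.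
have UV (U : oset X) (V : oset (circle l')) : V `<=` f @^-1` U -> forall x, V (chart _ x) -> U (chart _ x).
  by move=> h x /h; rewrite /preimage /= fE.
have ex (U : oset X) (V : oset (circle l')) (h : V `<=` f @^-1` U) p :
    exists p' : P' V, forall x, V (chart _ x) -> d' V p' x = e U p x.
  apply: (section_exists GL' dc) => x Vx; first by apply: ea => //; exact: UV Vx.
  by apply: ec; exact: UV Vx.
pose m U V h p := sval (cid (ex U V h p)).
have mE (U : oset X) (V : oset (circle l')) (h : V `<=` f @^-1` U) p x : V (chart _ x) -> d' V (m U V h p) x = e U p x.
  by rewrite /m; case: cid => p' /= H Vx; exact: H.
have mres (U U1 : oset X) (V V1 : oset (circle l')) (h : V `<=` f @^-1` U)
      (h1 : V1 `<=` f @^-1` U1) (hU : U1 `<=` U) (hV : V1 `<=` V) p :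
    m U1 V1 h1 (tres hU p) = tres hV (m U V h p).
  apply: (eq_section dc) => x Vx; rewrite mE // dr // mE ?er //; last exact: hV.
  exact: UV Vx.
have mact (U : oset X) (V : oset (circle l')) (h : V `<=` f @^-1` U) p g : gsec G U g ->
    m U V h (tact p g) = tact (m U V h p) (phi g).
  move=> sg; apply: (eq_section dc) => x Vx; have Ux := UV _ _ h x Vx.
  rewrite mE // et // dt // ?mE // => y Vy.
  by apply: phi_sec; apply: sg; exact: UV Vy.
by exists (TMor mres mact).
Qed.

Lemma factored_of_tmor c' (d' : forall V : oset (circle l'), P' V -> R -> F')
    (m : tmor f phi P P') :
  (forall U : oset X, open (chart (circle l') @^-1` (f @^-1` U))) ->
  factored (Y := circle l') l' L' id c' d' ->
  exists2 e : forall U : oset X, P U -> R -> F', factored l' L' phi c' e &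
    forall (U : oset X) (V : oset (circle l')) (h : V `<=` f @^-1` U) p x, V (chart _ x) -> d' V (m U V h p) x = e U p x.
Proof.
move=> fo [[da dr dt] dc].
pose fU U := OSet (fo U).
(* The image over the full preimage of U determines the images over all smaller V. *)
pose e (U : oset X) p := d' (fU U) (m U (fU U) (@subset_refl _ _) p).
have inU (U : oset X) x : U (chart _ x) -> fU U (chart _ x).
  by rewrite /fU /omem /= /preimage /= fE.
have eE (U : oset X) (V : oset (circle l')) (h : V `<=` f @^-1` U) p x : V (chart _ x) -> d' V (m U V h p) x = e U p x.
  move=> Vx; have hV : V `<=` fU U := h.
  rewrite -[e U p x](dr _ _ hV) //; congr (d' V _ x).
  by rewrite -[in LHS](tres_id (@subset_refl _ _) p) (tmap_res m (@subset_refl _ (fU U)) h _ hV).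
exists e => //; split; last first.
  by move=> U p x Ux; apply: dc; exact: inU.
split=> [U p x _ Ux|U V h p x _ Vx|U p g x _ sg Ux].
- by apply: da => //; exact: inU.
- have hV : fU V `<=` fU U by move=> z /h.
  rewrite /e (tmap_res m (@subset_refl _ (fU U)) (@subset_refl _ (fU V)) h hV) dr //.
  exact: inU.
- rewrite /e tmap_act // dt //; last exact: inU.
  move=> y Uy; apply: phi_sec; apply: sg; move: Uy.
  by rewrite /fU /omem /= /preimage /= fE.
Qed.
End MorphismOfFactor.

(** * Factors of automorphy of torsors on the circle *)

Section Iterates.
Variables (R : realType) (l : R) (F : groupType).
Implicit Type c : R -> F.

Fixpoint iter_factor c (n : nat) (x : R) : F :=
  if n is n'.+1 then (c (x + n'%:R * l) * iter_factor c n' x)%g else 1%g.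

(* The automorphy factor of the deck transformation x |-> x + k l. *)
Definition iterz_factor c (k : int) (x : R) : F :=
  match k with
  | Posz n => iter_factor c n x
  | Negz n => (iter_factor c n.+1 (x - n.+1%:R * l))^-1%g
  end.

Lemma iter_factorSr c n x : iter_factor c n.+1 x = (iter_factor c n (x + l) * c x)%g.
Proof.
elim: n x => [|n IH] x; first by rewrite /= mul0r addr0 mulg1 mul1g.
rewrite [LHS]/= -/(iter_factor c n.+1 x) IH mulgA /=.
by congr (c _ * _ * _)%g; rewrite mulrS; ring.
Qed.

Lemma iterz_factorS c k x :
  iterz_factor c (k + 1) x = (c (x + k%:~R * l) * iterz_factor c k x)%g.
Proof.
case: k => n; first by rewrite -PoszD addn1.
rewrite NegzE -[in LHS]addn1 PoszD opprD addrNK.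
set y := x - n.+1%:R * l.
have -> : x + (- n.+1%:Z)%:~R * l = y by rewrite /y mulrNz mulNr.
rewrite -[- n.+1%:Z]NegzE [iterz_factor c (Negz n) x]/= -/y.
rewrite -/(iter_factor c n.+1 y) iter_factorSr invgM mulVKg.
have -> : y + l = x - n%:R * l by rewrite /y mulrS; ring.
by case: n y => [|n] y; rewrite ?oppr0 /= ?invg1 // -NegzE.
Qed.

(** The cocycle identity with the extra step taken first. By [step] the identities for k and k + 1
    are equivalent, so induction runs from 0 in both directions. *)
Lemma iterz_factorSr c k x :
  iterz_factor c (k + 1) x = (iterz_factor c k (x + l) * c x)%g.
Proof.
have step j : iterz_factor c (j + 1) x = (iterz_factor c j (x + l) * c x)%g <->
    iterz_factor c (j + 1 + 1) x = (iterz_factor c (j + 1) (x + l) * c x)%g.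
  rewrite (iterz_factorS c (j + 1)) [iterz_factor c (j + 1) (x + l)]iterz_factorS -mulgA.
  have -> : x + (j + 1)%:~R * l = x + l + j%:~R * l by rewrite intrD; ring.
  by split=> [->//|/mulgI].
elim/int_ind: k => [|n IH|n IH].
- by rewrite add0r /= mul0r addr0 mulg1 mul1g.
- by rewrite -addn1 PoszD; exact: (step n).1.
- by apply: (step _).2; move: IH; rewrite -addn1 PoszD opprD subrK.
Qed.

Variables (L : gsheaf (line R) F).
Hypothesis shiftL : forall a x g, adm L (x + a) g -> adm L x (fun y => g (y + a)).

Lemma iterz_factor_adm c k : (forall x, adm L x c) -> forall x, adm L x (iterz_factor c k).
Proof.
move=> ac; have an n x : adm L x (iter_factor c n).
  elim: n x => [|n IH] x; first exact: adm1.
  by apply: admM (IH x); exact/shiftL.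
by case: k => n x /=; [exact: an|apply: admV; apply/(shiftL (a := - _))/(an n.+1)].
Qed.
End Iterates.

Section Floor.
Variables (R : realType) (l : R) (l_gt0 : 0 < l).

Definition sheet (x : R) : int := Num.floor (x / l).

Lemma sheet_bounds x : 0 <= x - (sheet x)%:~R * l < l.
Proof.
apply/andP; split.
  by rewrite subr_ge0 -ler_pdivlMr //; exact: floor_le.
have := floorD1_gt (x / l); rewrite ltr_pdivrMr // intrD mulrDl mul1r.
by rewrite -/(sheet x); lra.
Qed.

Lemma sheet_def x k : 0 <= x - k%:~R * l < l -> sheet x = k.
Proof.
move=> /andP[h1 h2]; apply: floor_def; rewrite intrD.
by rewrite ler_pdivlMr // -subr_ge0 h1 ltr_pdivrMr //; move: h2; lra.
Qed.

Lemma sheetD x : sheet (x + l) = sheet x + 1.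
Proof.
apply: sheet_def; rewrite intrD mulrDl mul1r opprD addrACA subrr addr0.
exact: sheet_bounds.
Qed.

(** Strictness excludes the left end of the sheet, where the floor jumps. *)
Lemma sheet_near x : 0 < x - (sheet x)%:~R * l -> \forall y \near x, sheet y = sheet x.
Proof.
move=> h0; have /andP[_ h1] := sheet_bounds x; set k := sheet x in h0 h1 *.
near=> y; apply: sheet_def; apply/andP; split.
  rewrite subr_ge0; apply/ltW; near: y; apply: lt_nbhsr; rewrite -subr_gt0 //.
rewrite ltrBlDr; near: y; apply: lt_nbhsl; by rewrite -ltrBlDr.
Unshelve. all: by end_near. Qed.
End Floor.

(** * The torsor with a given factor of automorphy *)

Section FactorTorsor.
Variables (R : realType) (l : R) (l_gt0 : 0 < l) (F : groupType).
Variables (G : gsheaf (circle l) F) (L : gsheaf (line R) F).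
Hypothesis GL : lifted_sheaf G L.
Variable c : R -> F.
Hypothesis adm_c : forall x, adm L x c.

Local Notation chart := (chart (circle l)).

(** Values off U are normalized to 1, so that sections agreeing over U are equal as functions. *)
Definition is_equivariant (U : oset (circle l)) (f : R -> F) :=
  [/\ forall x, U (chart x) -> adm L x f,
      forall x, U (chart x) -> f (x + l) = (c x * f x)%g
    & forall x, ~ U (chart x) -> f x = 1%g].

Definition equivariant (U : oset (circle l)) := {f : R -> F | is_equivariant U f}.

Lemma equivariant_eq U (p q : equivariant U) :
  (forall x, U (chart x) -> sval p x = sval q x) -> p = q.
Proof.
case: p q => [f Hf] [g Hg] /= fg; have e : f = g.
  apply/funext => x; have [/fg//|NUx] := pselect (U (chart x)).
  by case: Hf Hg => [_ _ ->] // [_ _ ->].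
by case: _ / e Hg {fg} => Hg; congr exist; exact: Prop_irrelevance.
Qed.

Definition cut (U : oset (circle l)) (f : R -> F) (x : R) : F :=
  if `[< U (chart x) >] then f x else 1%g.

Lemma cutE (U : oset (circle l)) f x : U (chart x) -> cut U f x = f x.
Proof. by move=> Ux; rewrite /cut asboolT. Qed.

Lemma cut_equivariant (U : oset (circle l)) f : (forall x, U (chart x) -> adm L x f) ->
  (forall x, U (chart x) -> f (x + l) = (c x * f x)%g) -> is_equivariant U (cut U f).
Proof.
move=> af fc; split=> [x Ux|x Ux|x NUx].
- apply: (adm_near _ (af x Ux)); near=> y; rewrite cutE //=.
  by near: y; exact: near_oset.
- by rewrite !cutE ?chart_addl //; exact: fc.
- by rewrite /cut asboolF.
Unshelve. all: by end_near. Qed.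

Lemma res_equivariant (U V : oset (circle l)) (h : V `<=` U) (p : equivariant U) :
  is_equivariant V (cut V (sval p)).
Proof.
case: (svalP p) => a e _.
by apply: cut_equivariant => x /h; [exact: a|exact: e].
Qed.

Definition equivariant_res (U V : oset (circle l)) (h : V `<=` U) (p : equivariant U) :
  equivariant V := exist _ _ (res_equivariant h p).

Lemma act_equivariant (U : oset (circle l)) (p : equivariant U) g : gsec G U g ->
  is_equivariant U (cut U (fun x => sval p x * g (chart x))%g).
Proof.
move=> sg; case: (svalP p) => a e _; apply: cut_equivariant => x Ux.
  by apply: admM (a x Ux) _; apply/(lift_adm GL)/sg.
by rewrite e // chart_addl mulgA.
Qed.

(** The action takes arbitrary functions; a g that is not a section leaves p unchanged. *)
Definition equivariant_act (U : oset (circle l)) (p : equivariant U)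
    (g : circle l -> F) : equivariant U :=
  if pselect (gsec G U g) is left sg then exist _ _ (act_equivariant p sg) else p.

Lemma equivariant_resE (U V : oset (circle l)) (h : V `<=` U) p x : V (chart x) ->
  sval (equivariant_res h p) x = sval p x.
Proof. exact: cutE. Qed.

Lemma equivariant_actE (U : oset (circle l)) (p : equivariant U) g x : gsec G U g ->
  U (chart x) -> sval (equivariant_act p g) x = (sval p x * g (chart x))%g.
Proof.
by move=> sg Ux; rewrite /equivariant_act; case: pselect => // sg' /=; rewrite cutE.
Qed.

(** U is the image of an open interval of length l around a lift of z. Its preimage is the disjoint
    union of the translates of that interval; the section is 1 on the base sheet and the iterated
    factor on the k-th one. *)
Lemma equivariant_nonempty (z : circle l) :
  exists2 U : oset (circle l), U z & inhabited (equivariant U).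
Proof.
have [x0 <-] := chart_surj z.
pose a := x0 - l / 2.
pose S : set (circle l) := [set z | exists2 y : R, a < y < a + l & chart y = z].
have oS : open (chart @^-1` S).
  rewrite openE => x [y /andP[ay yb] /chart_eqP[k e]].
  have h1 : \forall x' \near x, a - (y - x) < x' by apply: lt_nbhsr; lra.
  have h2 : \forall x' \near x, x' < a + l - (y - x) by apply: lt_nbhsl; lra.
  near=> x'; exists (x' + (y - x)); last by apply/chart_eqP; exists k; rewrite -e; ring.
  have h1' : a - (y - x) < x' by near: x'.
  have h2' : x' < a + l - (y - x) by near: x'.
  by apply/andP; split; lra.
pose U := OSet oS.
pose k y := sheet l (y - a).
pose f y := iterz_factor l c (k y) (y - (k y)%:~R * l).
(* The preimage of U avoids all a + k l, so the sheet number is locally constant on it. *)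
have U_pos y : U (chart y) -> 0 < y - a - (k y)%:~R * l.
  move=> [y' /andP[h1 h2] /chart_eqP[n e]].
  have h1' : 0 < y - a - n%:~R * l by rewrite -e; lra.
  have h2' : y - a - n%:~R * l < l by rewrite -e; lra.
  by have -> : k y = n by apply: sheet_def => //; apply/andP; split; first exact: ltW.
have ax0 : a < x0 by have := l_gt0; rewrite /a; lra.
have x0a : x0 < a + l by have := l_gt0; rewrite /a; lra.
exists U; first by exists x0 => //; apply/andP.
split; exists (cut U f); apply: cut_equivariant => y Uy.
  have kn : \forall y' \near y, k y' = k y.
    have /nbhs_ballP[e /= e0 he] := sheet_near l_gt0 (U_pos y Uy).
    apply/nbhs_ballP; exists e => //= y' yy'; apply: (he (y' - a)).
    by move: yy'; rewrite /ball /=; have -> : y - a - (y' - a) = y - y' by ring.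
  have := iterz_factor_adm l (lift_shift GL) (k y) adm_c (y - (k y)%:~R * l).
  move=> /(lift_shift GL (a := - ((k y)%:~R * l))); apply: adm_near.
  by near=> y'; rewrite /f; have -> : k y' = k y by near: y'.
rewrite /f; have -> : k (y + l) = k y + 1 by rewrite /k addrAC sheetD.
rewrite intrD mulrDl mul1r opprD addrACA subrr addr0 iterz_factorS.
by rewrite subrK.
Unshelve. all: by end_near. Qed.

Definition factor_torsor : torsor G.
Proof.
refine (@Torsor _ _ _ _ equivariant equivariant_res _ _ _ _ equivariant_act _ _ _ _ _ _
  equivariant_nonempty).
- by move=> U h p; apply: equivariant_eq => x Ux; rewrite equivariant_resE.
- move=> U V W h h' h'' p; apply: equivariant_eq => x Wx.
  by rewrite !equivariant_resE //; exact: h'.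
- move=> I U V h p q UV e; apply: equivariant_eq => x /UV[i Vx].
  by rewrite -(equivariant_resE (h i)) // e equivariant_resE.
- move=> I U V h p UV e.
  (* Each point takes its value from a chosen member of the covering; [fE] shows that the choice
     does not matter. *)
  pose i x (Ux : U (chart x)) := sval (cid (UV _ Ux)).
  have iP x (Ux : U (chart x)) : V (i x Ux) (chart x) by rewrite /i; case: cid.
  pose f x := if pselect (U (chart x)) is left Ux then sval (p (i x Ux)) x else 1%g.
  have fE j x : V j (chart x) -> f x = sval (p j) x.
    move=> Vx; rewrite /f; case: pselect => [Ux|[]]; last exact: (h j).
    have Vi := iP x Ux; move: (i x Ux) Vi => i' Vi.
    have := e i' j _ (@ointerl _ _ _ _) (@ointerr _ _ _ _).
    move/(congr1 (fun q => sval q x)); rewrite !equivariant_resE //.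
  have eqf : is_equivariant U f.
    split=> [x /UV[j Vx]|x /UV[j Vx]|x NUx].
    + have [a _ _] := svalP (p j); apply: (adm_near _ (a x Vx)).
      by near=> y; rewrite -fE //; near: y; exact: near_oset.
    + have [_ a _] := svalP (p j).
      by rewrite (fE j) ?chart_addl // a // (fE j).
    + by rewrite /f; case: pselect.
  exists (exist _ f eqf) => j; apply: equivariant_eq => x Vx.
  by rewrite equivariant_resE //= (fE j).
- move=> U p g g' sg sg' gg'; apply: equivariant_eq => x Ux.
  by rewrite !equivariant_actE // gg'.
- move=> U p; apply: equivariant_eq => x Ux.
  rewrite !equivariant_actE ?mulg1 // => y _; exact: adm1.
- move=> U p g g' sg sg'; apply: equivariant_eq => x Ux.
  rewrite !equivariant_actE ?mulgA // => y Uy.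
  by apply: admM; [exact: sg|exact: sg'].
- move=> U V h p g sg; apply: equivariant_eq => x Vx.
  have Ux := h _ Vx.
  rewrite equivariant_resE // !equivariant_actE ?equivariant_resE //.
  exact: gsec_sub sg.
- move=> U p g g' sg sg' e z; have [x <-] := chart_surj z => Ux.
  by move/(congr1 (fun q => sval q x)): e; rewrite !equivariant_actE // => /mulgI.
- move=> U p q; have [pa pe _] := svalP p; have [qa qe _] := svalP q.
  (* The common factor c cancels in this quotient, so it is periodic and descends to the circle. *)
  pose f x := ((sval p x)^-1 * sval q x)%g.
  pose g (z : circle l) := f (repr (z : circle_pt l)).
  have gE x : U (chart x) -> g (chart x) = f x.
    move=> Ux; rewrite /g; set y := repr _.
    have /chart_eqP[n yx] : chart x = chart y by rewrite chart_repr.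
    have -> : y = x + n%:~R * l by rewrite -yx addrC subrK.
    apply: (periodicz (U := U)) => // x' Ux'.
    by rewrite /f pe // qe // invgM -mulgA mulKg.
  have sg : gsec G U g.
    move=> x Ux; apply/(lift_adm GL).
    apply: adm_near (admM (admV (pa x Ux)) (qa x Ux)).
    by near=> y; rewrite /= gE //; near: y; exact: near_oset.
  exists g => //; apply: equivariant_eq => x Ux.
  by rewrite equivariant_actE // gE // mulVKg.
Unshelve. all: by end_near.
Defined.

Lemma factor_torsorP : exists d : forall U, factor_torsor U -> R -> F,
  factored (Y := circle l) l L id c d.
Proof.
exists (fun U p => sval p); split; last first.
  by move=> U p x Ux; have [_ e _] := svalP p; exact: e.
split=> [U p x _ Ux|U V h p x _ Vx|U p g x _ sg Ux].
- by have [a _ _] := svalP p; exact: a.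
- exact: equivariant_resE.
- exact: equivariant_actE.
Qed.
End FactorTorsor.

(** * Every torsor has a factor of automorphy *)

Section FactorExists.
Variables (R : realType) (l : R) (l_gt0 : 0 < l) (F : groupType).
Variables (G : gsheaf (circle l) F) (L : gsheaf (line R) F).
Hypothesis GL : lifted_sheaf G L.
Variable P : torsor G.

Local Notation chart := (chart (circle l)).

Definition trivial_on (a b : R) := exists d : forall U : oset (circle l), P U -> R -> F,
  twisted_on (Y := circle l) L id (fun x => a < x < b) d.

Lemma trivial_on_sub a b a' b' : a <= a' -> b' <= b -> trivial_on a b -> trivial_on a' b'.
Proof.
move=> aa' bb' [d td]; exists d; apply: twisted_sub td => x /andP[h1 h2].
by rewrite (le_lt_trans aa') // (lt_le_trans h2).
Qed.

Lemma near_itv (a b x : R) : a < x < b -> \forall y \near x, a < y < b.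
Proof.
move=> /andP[ax xb]; near=> y; apply/andP; split; near: y.
  exact: lt_nbhsr.
exact: lt_nbhsl.
Unshelve. all: by end_near. Qed.

(** A section p0 near x0 trivializes P there: p is sent to the g with p = p0 g. *)
Lemma trivial_near x0 : exists2 e, 0 < e & trivial_on (x0 - e) (x0 + e).
Proof.
have [U0 U0x [p0]] := tnonempty P (chart x0).
have /nbhs_ballP[e /= e0 he] := near_oset U0x.
have inU0 x : x0 - e < x < x0 + e -> U0 (chart x).
  move=> /andP[h1 h2]; apply: he; rewrite /ball /= ltr_norml; apply/andP; split; lra.
exists e => //.
pose g (U : oset (circle l)) p :=
  sval (cid2 (ttrans (tres (@ointerl _ _ U0 U) p0) (tres (@ointerr _ _ U0 U) p))).
have gs (U : oset (circle l)) p : gsec G (ointer U0 U) (g U p).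
  by rewrite /g; case: cid2.
have gE (U : oset (circle l)) p :
    tres (@ointerr _ _ U0 U) p = tact (tres (@ointerl _ _ U0 U) p0) (g U p).
  by rewrite /g; case: cid2.
exists (fun U p x => g U p (chart x)); split.
- move=> U p x /inU0 U0x' Ux; apply/(lift_adm GL x (g U p))/gs; split=> //.
- move=> U V h p x /inU0 U0x' Vx.
  have VU : ointer U0 V `<=` ointer U0 U by move=> c [? /h].
  apply: (@tfree _ _ _ _ P (ointer U0 V) (tres (@ointerl _ _ U0 V) p0)); last by [].
  + exact: gs.
  + exact: gsec_sub (gs _ _).
  rewrite -gE -[in RHS](tres_comp (@ointerl _ _ U0 U) VU).
  rewrite -tact_res; last exact: gs.
  rewrite -gE (tres_comp _ _ (subset_trans (@ointerr _ _ U0 V) h)).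
  by rewrite (tres_comp _ _ (subset_trans (@ointerr _ _ U0 V) h)).
- move=> U p g' x /inU0 U0x' sg' Ux.
  have sg'' : gsec G (ointer U0 U) g' by apply: gsec_sub sg'; exact: ointerr.
  apply: (@tfree _ _ _ _ P (ointer U0 U) (tres (@ointerl _ _ U0 U) p0)
    (g U (tact p g')) (fun c => g U p c * g' c)%g); last by [].
  + exact: gs.
  + by move=> y Uy; apply: admM; [exact: gs|exact: sg''].
  by rewrite -gE tact_res // gE tactM.
Qed.

(** On the overlap d = g0 d'. Extending g0 to a section g on the whole line makes g d' a
    continuation of d. *)
Lemma trivial_glue a b a' b' : a <= a' -> a' < b -> b <= b' ->
  trivial_on a b -> trivial_on a' b' -> trivial_on a b'.
Proof.
move=> aa' a'b bb' [d td] [d' td'].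
have nI x : a' < x < b -> \forall y \near x, a' < y < b by exact: near_itv.
have td1 : twisted_on (Y := circle l) L id (fun x => a' < x < b) d.
  by apply: twisted_sub td => x /andP[h ->]; rewrite (le_lt_trans aa').
have td1' : twisted_on (Y := circle l) L id (fun x => a' < x < b) d'.
  by apply: twisted_sub td' => x /andP[-> h]; rewrite (lt_le_trans h).
have [g0 [ag0 hg0]] := compare_twisted nI td1' td1.
have [g ag gg0] := lift_extend GL ag0.
have [da dr dt] := td; have [da' dr' dt'] := td'.
pose d2 (U : oset (circle l)) (p : P U) x := if x < b then d U p x else (g x * d' U p x)%g.
have d2E (U : oset (circle l)) (p : P U) x : a' < x < b' -> U (chart x) -> d2 U p x = (g x * d' U p x)%g.
  move=> /andP[h1 h2] Ux; rewrite /d2; case: ifP => // xb.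
  by rewrite hg0 ?gg0 ?h1.
have cases x : a < x < b' -> a < x < b \/ (b <= x /\ a' < x < b').
  move=> /andP[h1 h2]; case: (ltP x b) => xb; first by left; rewrite h1.
  by right; rewrite h2 (lt_le_trans a'b xb).
exists d2; split.
- move=> U p x /cases[I1|[bx I1]] Ux.
    apply: (adm_near _ (da U p x I1 Ux)).
    near=> y; rewrite /d2; suff -> : y < b by [].
    by near: y; apply: lt_nbhsl; case/andP: I1.
  apply: adm_near (admM (ag x) (da' U p x I1 Ux)).
  near=> y; rewrite d2E //; last by near: y; exact: near_oset.
  by near: y; exact: near_itv.
- move=> U V h p x /cases[I1|[bx I1]] Vx; last by rewrite !d2E ?dr' //; exact: h.
  by case/andP: (I1) => _ xb; rewrite /d2 xb dr.
- move=> U p g1 x /cases[I1|[bx I1]] sg1 Ux.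
    by case/andP: (I1) => _ xb; rewrite /d2 xb dt.
  by rewrite !d2E // dt' // mulgA.
Unshelve. all: by end_near. Qed.

(** Let x be the supremum of the right ends c up to which P is trivial from a. Gluing with a
    trivialization around x passes beyond x, so the ends cannot be bounded by b. *)
Lemma trivial_everywhere a b : trivial_on a b.
Proof.
have [ba|ab] := leP b a.
  have [e _ [d td]] := trivial_near 0; exists d; apply: twisted_sub td => x /andP[h1 h2].
  by have := lt_trans h1 h2; rewrite ltNge ba.
apply: contrapT => nab.
pose S := [set c | a < c /\ trivial_on a c].
have Sb c : S c -> c <= b.
  move=> [_ tac]; rewrite leNgt; apply/negP => bc; apply: nab.
  by apply: trivial_on_sub tac => //; exact: ltW.
have [e e0 te] := trivial_near a.
have Sae : S (a + e).
  split; first by rewrite ltrDl.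
  by apply: trivial_on_sub te => //; rewrite gerBl ltW.
have hS : has_sup S by split; [exists (a + e)|exists b].
pose x := sup S.
have ax : a < x.
  apply: (@lt_le_trans _ _ (a + e)); first by rewrite ltrDl.
  by apply: ub_le_sup => //; exists b.
have [e' e'0 te'] := trivial_near x.
have [c [ac tac] xc] := sup_adherent e'0 hS.
have : S (x + e').
  split; first by rewrite (lt_trans ax) // ltrDl.
  have cx : c <= x by apply: ub_le_sup => //; exists b.
  apply: (@trivial_glue a c (Num.max a (x - e'))) => //.
  - by rewrite le_max lexx.
  - by rewrite gt_max ac.
  - by rewrite (le_trans cx) // lerDl ltW.
  - by apply: trivial_on_sub te' => //; rewrite le_max lexx orbT.
move=> Sxe; have : x + e' <= x by apply: ub_le_sup => //; exists b.
by rewrite gerDl leNgt e'0.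
Qed.

(** A trivialization d0 over the interval from -l to l is compared with its own translate on the
    overlap from 0 to l. The transition g, shifted by l, is the factor c, and iterating c extends d0
    from the base sheet to the line. *)
Lemma factor_exists : exists (c : R -> F) (d : forall U : oset (circle l), P U -> R -> F),
  (forall x, adm L x c) /\ factored (Y := circle l) l L id c d.
Proof.
have [d0 td0] := trivial_everywhere (- l) l.
have [a0 r0 t0] := td0.
have tdl : twisted_on (Y := circle l) L id (fun x => 0 < x < l) (fun U p x => d0 U p (x - l)).
  have I0 x : 0 < x < l -> - l < x - l < l.
    by move=> /andP[h1 h2]; apply/andP; split; have := l_gt0; lra.
  have cl x : chart (x - l) = chart x by rewrite -(chart_addl l (x - l)) subrK.
  split=> [U p x I Ux|U V h p x I Vx|U p g x I sg Ux].
  - by apply: (lift_shift GL (a := - l)); apply: a0; rewrite ?cl //; exact: I0.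
  - by rewrite r0 ?cl //; exact: I0.
  - by rewrite t0 ?cl //; exact: I0.
have td0' : twisted_on (Y := circle l) L id (fun x => 0 < x < l) d0.
  by apply: twisted_sub td0 => x /andP[h ->]; rewrite (lt_trans _ h) // oppr_lt0.
have [g0 [ag0 hg0]] := compare_twisted (@near_itv 0 l) tdl td0'.
have [g ag gg0] := lift_extend GL ag0.
pose c x := g (x + l).
have ac x : adm L x c by apply: (lift_shift GL).
pose d (U : oset (circle l)) (p : P U) y := let k := sheet l y in
  (iterz_factor l c k (y - k%:~R * l) * d0 U p (y - k%:~R * l))%g.
have chartB y (k : int) : chart (y - k%:~R * l) = chart y.
  by rewrite -(chart_addz l (y - k%:~R * l) k) subrK.
(* Between - l and 0 relative to sheet k, the sheets k and k - 1 give the same value by the choice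
   of c. Hence one formula is valid on both sides of a sheet boundary, which is what admissibility
   there requires. *)
have dE (U : oset (circle l)) (p : P U) y (k : int) : U (chart y) ->
    - l < y - k%:~R * l < l ->
    d U p y = (iterz_factor l c k (y - k%:~R * l) * d0 U p (y - k%:~R * l))%g.
  move=> Uy /andP[h1 h2]; case: (lerP 0 (y - k%:~R * l)) => hk.
    by rewrite /d; have -> : sheet l y = k by apply: sheet_def; rewrite ?hk.
  set x := y - k%:~R * l in h1 h2 hk *.
  have exl : y - (k - 1)%:~R * l = x + l by rewrite /x intrB; ring.
  rewrite /d; have -> : sheet l y = k - 1.
    by apply: sheet_def => //; rewrite exl; apply/andP; split; lra.
  rewrite exl -{2}[k](subrK 1) iterz_factorSr -mulgA; congr (_ * _)%g.
  have I1 : 0 < x + l < l by apply/andP; split; lra.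
  have Uxl : U (chart (x + l)) by rewrite chart_addl /x chartB.
  by rewrite hg0 // addrK /c gg0.
exists c, d; split=> //.
have Ik y : - l < y - (sheet l y)%:~R * l < l.
  by have /andP[h ->] := sheet_bounds l_gt0 y; rewrite (lt_le_trans _ h) // oppr_lt0.
split; [split|].
- move=> U p y _ Uy; set k := sheet l y.
  have h : adm L y (fun y => iterz_factor l c k (y - k%:~R * l) * d0 U p (y - k%:~R * l))%g.
    apply: (lift_shift GL (a := - (k%:~R * l)) (g := fun y => iterz_factor l c k y * d0 U p y)%g).
    apply: admM; first by apply: iterz_factor_adm => //; exact: (lift_shift GL).
    by apply: a0; rewrite ?chartB //; exact: Ik.
  apply: adm_near h; near=> y'; apply/esym/dE; near: y'; first exact: near_oset.
  have [h1 h2] := andP (Ik y).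
  have : k%:~R * l - l < y < k%:~R * l + l by rewrite -/k in h1 h2; apply/andP; split; lra.
  move/near_itv; apply: filterS => y' /andP[h1' h2'].
  by rewrite ltrBrDr ltrBlDr [- l + _]addrC [l + _]addrC h1' h2'.
- by move=> U V h p x _ Vx; rewrite /d r0 ?chartB.
- by move=> U p g' x _ sg Ux; rewrite /d t0 ?chartB // mulgA.
- move=> U p x Ux; rewrite /d sheetD // intrD mulrDl mul1r opprD addrACA subrr addr0.
  by rewrite iterz_factorS subrK mulgA.
Unshelve. all: by end_near. Qed.
End FactorExists.

(** * Locally constant and harmonic functions on the line *)

Section LocallyConstant.
Variable R : realType.

(** The locus where f equals f x meets I in a nonempty relatively open and closed set, and I is
    connected. Interiors are taken to obtain sets open in the whole line. *)
Lemma locally_constant_interval (T : Type) (I : set R) (f : R -> T) : is_interval I ->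
  (forall x, I x -> \forall y \near x, I y -> f y = f x) ->
  forall x y, I x -> I y -> f y = f x.
Proof.
move=> /connected_intervalP cI fc x y Ix Iy.
pose A := [set z | I z -> f z = f x]; pose B := [set z | I z -> f z <> f x].
have : I `&` A° = I.
  apply: cI.
  - by exists x; split=> //; exact: fc.
  - by exists A°; first exact: open_interior.
  exists (~` B°); first by apply: open_closedC; exact: open_interior.
  apply/seteqP; split=> z [Iz h]; split=> //.
    by move=> /nbhs_singleton /(_ Iz); apply; exact: (nbhs_singleton h).
  have [zx|zx] := pselect (f z = f x).
    by rewrite /interior /= /A -zx; exact: fc.
  case: h; have := fc z Iz; apply: filterS => t ft It; rewrite ft //.
by move/seteqP => [_ /(_ _ Iy) [_ /nbhs_singleton]]; exact.
Qed.

Lemma is_interval_oo (a b : R) : is_interval [set x : R | a < x < b].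
Proof.
move=> x y /andP[ax _] /andP[_ yb] z /andP[xz zy] /=.
by rewrite (lt_le_trans ax) // (le_lt_trans zy).
Qed.

Lemma is_intervalT : is_interval [set: R]. Proof. by []. Qed.
End LocallyConstant.

Section Harmonic.
Variables (R : realType) (s : nat).
Implicit Types (h : R -> 'cV[R]_s) (m : 'cV[int]_s) (v : 'cV[R]_s).

Lemma realmx_inj : injective (fun m => realmx R m).
Proof.
move=> m m' /matrixP e; apply/matrixP => i j.
by have := e i j; rewrite !mxE => /intr_inj.
Qed.

Definition affine_at x h m := \forall y \near x, h y = h x + (y - x) *: realmx R m.

Lemma harmonicP x h : Defs.harmonic (X := line R) x h <-> exists m, affine_at x h m.
Proof.
split=> [[a [b [ab /nbhs_ballP[e /= e0 H]]]]|[a H]].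
  exists a; apply/nbhs_ballP; exists e => //= y; rewrite /ball /= => xy.
  have [yx|yx|->] := ltgtP y x; last by rewrite subrr scale0r addr0.
    have xy0 : 0 < x - y by rewrite subr_gt0.
    have [|_] := H (x - y) _ xy0; first by rewrite /ball /= sub0r normrN ger0_norm ?ltW // gtr0_norm in xy *.
    have -> : b = - a by apply/eqP; rewrite -addr_eq0 addrC ab.
    by rewrite /= subKr map_mxN scalerN -scaleNr opprB.
  have xy0 : 0 < y - x by rewrite subr_gt0.
  have [|+ _] := H (y - x) _ xy0; first by rewrite /ball /= sub0r normrN distrC.
  by rewrite /= addrC subrK.
exists a, (- a); split; first by rewrite subrr.
have := near_sides H; apply: filterS => t [e1 e2]; split.
  by rewrite [LHS]e1 addrAC subrr add0r.
by rewrite [LHS]e2 addrAC subrr add0r map_mxN scalerN scaleNr.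
Qed.

Lemma affine_at_inj x h m m' : affine_at x h m -> affine_at x h m' -> m = m'.
Proof.
move=> H H'; apply: realmx_inj.
have /nbhs_ballP[e /= e0 he] : \forall y \near x, (y - x) *: realmx R m = (y - x) *: realmx R m'.
  by apply: filterS2 H H' => y e1 e2; apply: (@addrI _ (h x)); rewrite -e1.
have : (x + e / 2 - x) *: realmx R m = (x + e / 2 - x) *: realmx R m'.
  apply: he; rewrite /ball /= opprD addrA subrr sub0r normrN gtr0_norm ?divr_gt0 //.
  by rewrite ltr_pdivrMr // ltr_pMr // ltr1n.
rewrite addrAC subrr add0r => /(congr1 (fun u => (e / 2)^-1 *: u)).
by rewrite !scalerA mulVf ?scale1r // gt_eqF // divr_gt0.
Qed.

Lemma affine_at_near x h m : affine_at x h m -> \forall y \near x, affine_at y h m.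
Proof.
move=> /[dup] H /near_join H'; near=> z.
have ez : h z = h x + (z - x) *: realmx R m by near: z.
have Hz : \forall y \near z, h y = h x + (y - x) *: realmx R m by near: z.
apply: filterS Hz => y ->; rewrite ez -addrA -scalerDl; congr (_ + _ *: _); ring.
Unshelve. all: by end_near. Qed.

Lemma pic_fun_harmonic m v x : Defs.harmonic (X := line R) x (pic_fun m v).
Proof.
apply/harmonicP; exists m; near=> y; rewrite /pic_fun -addrA -scalerDl.
by congr (_ + _ *: _); ring.
Unshelve. all: by end_near. Qed.

(** The slope is locally constant, hence a constant m on I; then h - x m is locally constant as
    well. *)
Lemma harmonic_interval (I : set R) h : is_interval I ->
  (forall x, I x -> Defs.harmonic (X := line R) x h) ->
  exists m v, forall x, I x -> h x = pic_fun m v x.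
Proof.
move=> II hI; have [[x0 Ix0]|nI] := pselect (exists x, I x); last first.
  by exists 0, 0 => x Ix; case: nI; exists x.
have ex x : exists m, I x -> affine_at x h m.
  have [/hI/harmonicP[m H]|nIx] := pselect (I x); [by exists m|by exists 0].
pose m x := sval (cid (ex x)).
have mP x : I x -> affine_at x h (m x) by rewrite /m; case: cid.
have mc x : I x -> \forall y \near x, I y -> m y = m x.
  move=> /mP/affine_at_near; apply: filterS => y h1 Iy.
  exact: affine_at_inj (mP y Iy) h1.
have mE x : I x -> m x = m x0 by move=> Ix; exact: (locally_constant_interval II mc).
pose k x := h x - x *: realmx R (m x0).
have kc x : I x -> \forall y \near x, I y -> k y = k x.
  move=> Ix; have := mP x Ix; rewrite mE //; apply: filterS => y e _.
  by rewrite /k e scalerBl [_ *: _ - _]addrC addrA addrK.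
exists (m x0), (k x0) => x Ix.
by rewrite /pic_fun -(locally_constant_interval II kc Ix0 Ix) subrK.
Qed.
End Harmonic.

Section Lifted.
Variables (R : realType) (l : R).

Lemma near_translate (a x : R) (A : R -> Prop) :
  (\forall y \near x + a, A y) -> \forall y \near x, A (y + a).
Proof.
move=> /nbhs_ballP[e /= e0 he]; apply/nbhs_ballP; exists e => //= y xy.
by apply: he; move: xy; rewrite /ball /= opprD addrACA subrr addr0.
Qed.

Lemma const_lifted (A : groupType) :
  lifted_sheaf (const_sheaf (circle l) A) (const_sheaf (line R) A).
Proof.
split=> [x g|a x g|a b g ag]; [by []|by move=> /near_translate|].
have [ab|ab] := ltP a b; last first.
  exists (fun=> 1%g) => x; first exact: (adm1 (const_sheaf (line R) A)).
  by move=> /andP[h1 h2]; have := lt_trans h1 h2; rewrite ltNge ab.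
have I0 : a < (a + b) / 2 < b by rewrite !midf_lt.
exists (fun=> g ((a + b) / 2)) => x; first by near=> y.
move=> Ix; apply: (locally_constant_interval (@is_interval_oo _ a b)) => // y Iy.
by apply: filterS (ag y Iy).
Unshelve. all: by end_near. Qed.

Lemma locally_constant_line (A : groupType) (g : R -> A) :
  (forall x, adm (const_sheaf (line R) A) x g) -> forall x, g x = g 0.
Proof.
move=> h x; apply: (locally_constant_interval (@is_intervalT _)) => // y _.
exact: filterS (h y).
Qed.

Lemma harm_lifted s : lifted_sheaf (harm_sheaf (circle l) s) (harm_sheaf (line R) s).
Proof.
split=> [x g|a x g|a b g ag]; first by [].
  move=> [u [v [uv H]]]; exists u, v; split=> //.
  by apply: filterS H => t; rewrite /= ![x + a + _]addrAC.
have [m [v e]] := harmonic_interval (@is_interval_oo _ a b) ag.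
by exists (pic_fun m v) => x; [exact: pic_fun_harmonic|move/e].
Qed.

Lemma harmonic_line s (g : R -> 'cV[R]_s) :
  (forall x, adm (harm_sheaf (line R) s) x g) -> exists m v, g = pic_fun m v.
Proof.
move=> h; have [m [v e]] := harmonic_interval (@is_intervalT _) (fun x _ => h x).
by exists m, v; apply/funext => x; exact: e.
Qed.

Variables (r : nat) (D : root_datum r).

Definition G_fun (m : 'cV[int]_r) (v : 'cV[R]_r) (w : weyl D) (x : R) : tropG D R :=
  (pic_fun m v x, w).

Lemma G_fun_adm m v w x : adm (G_sheaf D (line R)) x (G_fun m v w).
Proof. by split; [exact: pic_fun_harmonic|near=> y]. Unshelve. all: by end_near. Qed.

Lemma G_lifted : lifted_sheaf (G_sheaf D (circle l)) (G_sheaf D (line R)).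
Proof.
split=> [x g|a x g [h1 h2]|a b g ag]; first by [].
  by split; [exact: (lift_shift (harm_lifted _) h1)|exact: (lift_shift (const_lifted _) h2)].
have [m [v e]] := harmonic_interval (@is_interval_oo _ a b) (fun x Ix => (ag x Ix).1).
have [w aw ew] := lift_extend (const_lifted _) (fun x Ix => (ag x Ix).2).
exists (fun x => (pic_fun m v x, w x)) => x; first by split; [exact: pic_fun_harmonic|exact: aw].
by move=> Ix; rewrite -(e x Ix) ew //; case: (g x).
Qed.

Lemma G_line (g : R -> tropG D R) :
  (forall x, adm (G_sheaf D (line R)) x g) -> exists m v w, g = G_fun m v w.
Proof.
move=> h; have [m [v e]] := harmonic_line (fun x => (h x).1).
exists m, v, (g 0).2; apply/funext => x; rewrite /G_fun -e.
by rewrite -(locally_constant_line (fun x => (h x).2) x); case: (g x).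
Qed.
End Lifted.

(** * Root data of type A *)

Section TypeALattice.
Variables (r : nat) (D : root_datum r) (k : nat) (n : 'I_k -> nat) (tA : typeA D n).

Local Notation E := {i : 'I_k & 'I_(n i)}.
Local Notation src := (src tA).
Local Notation tgt := (tgt tA).

Lemma ffun_mulrz (f : {ffun E -> int}) (z : int) e : (f *~ z) e = f e * z.
Proof.
case: z => m; rewrite ?NegzE ?mulrNz ?mulrN ?ffunE -?pmulrn ?ffunMnE.
  by rewrite -mulr_natr natz.
by rewrite -mulr_natr natz.
Qed.

Lemma std_rootE (s t e : E) : std_root s t e = (e == s)%:R - (e == t)%:R.
Proof. by rewrite ffunE. Qed.

(** At most one index contributes, so this is the root e_s - e_t, or 0 when there is none; in
    particular it is 0 for s = t, which spares case distinctions. *)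
Definition root_at (s t : E) : 'rV[int]_r := \sum_(j | (src j == s) && (tgt j == t)) rd_root j.

Definition coroot_at (s t : E) : 'cV[int]_r := \sum_(j | (src j == s) && (tgt j == t)) rd_coroot j.

Lemma std_root_inj j j' : std_root (src j) (tgt j) = std_root (src j') (tgt j') -> j = j'.
Proof.
move=> e; have [->//|jj'] := eqVneq j j'.
pose c i : int := (i == j)%:R - (i == j')%:R.
have cs (V : lmodType int) (f : ridx D -> V) : \sum_i c i *: f i = f j - f j'.
  under eq_bigr do rewrite /c scalerBl.
  rewrite big_split /= (bigD1 j) //= eqxx scale1r big1 ?addr0; last first.
    by move=> i /negPf ->; rewrite scale0r.
  rewrite (bigD1 j') //= eqxx scale1r big1 ?addr0 //.
  by move=> i /negPf ->; rewrite scale0r oppr0.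
have : \sum_i std_root (src i) (tgt i) *~ c i = 0.
  apply/ffunP => x; have /ffunP/(_ x) ex := e.
  rewrite sum_ffunE; under eq_bigr do rewrite ffun_mulrz mulrC.
  have := cs int^o (fun i => std_root (src i) (tgt i) x); rewrite /GRing.scale /= => ->.
  by rewrite ex subrr ffunE.
move/(typeA_lin tA c); rewrite cs => /eqP; rewrite subr_eq0 => /eqP.
exact: root_inj.
Qed.

Lemma src_tgt_inj j j' : src j = src j' -> tgt j = tgt j' -> j = j'.
Proof. by move=> es et; apply: std_root_inj; rewrite es et. Qed.

Lemma sum_src_tgt (V : zmodType) (f : ridx D -> V) j :
  \sum_(j' | (src j' == src j) && (tgt j' == tgt j)) f j' = f j.
Proof.
rewrite (bigD1 j) /= ?eqxx // big1 ?addr0 // => i /andP[/andP[/eqP es /eqP et]].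
by rewrite (src_tgt_inj es et) eqxx.
Qed.

Lemma root_atE j : root_at (src j) (tgt j) = rd_root j. Proof. exact: sum_src_tgt. Qed.
Lemma coroot_atE j : coroot_at (src j) (tgt j) = rd_coroot j. Proof. exact: sum_src_tgt. Qed.

Lemma sum_diag (V : zmodType) (f : ridx D -> V) s :
  \sum_(j' | (src j' == s) && (tgt j' == s)) f j' = 0.
Proof.
rewrite big_pred0 // => j; apply/andP => -[/eqP es /eqP et].
by case: (src_tgt tA j) => _; rewrite es et.
Qed.

Lemma root_at_diag s : root_at s s = 0. Proof. exact: sum_diag. Qed.
Lemma coroot_at_diag s : coroot_at s s = 0. Proof. exact: sum_diag. Qed.

Lemma pair_case (s t : E) : tag s = tag t -> s = t \/ exists j, s = src j /\ t = tgt j.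
Proof.
move=> st; have [->|/eqP nst] := eqVneq s t; first by left.
by right; have [j [<- <-]] := typeA_surj tA st nst; exists j.
Qed.

Lemma sum_std s t : tag s = tag t ->
  \sum_(j | (src j == s) && (tgt j == t)) std_root (src j) (tgt j) = std_root s t.
Proof.
case/pair_case => [->|[j [-> ->]]]; last exact: sum_src_tgt.
by rewrite sum_diag; apply/ffunP => e; rewrite std_rootE subrr ffunE.
Qed.

(** Carries linear relations between the e_s - e_t over to the roots and back, for lists in which
    pairs may repeat or be degenerate. *)
Lemma root_at_lin (q : seq (int * (E * E))) :
  (forall x, x \in q -> tag x.2.1 = tag x.2.2) ->
  \sum_(x <- q) x.1 *: root_at x.2.1 x.2.2 = 0 <->
  \sum_(x <- q) std_root x.2.1 x.2.2 *~ x.1 = 0.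
Proof.
move=> tq.
pose c j := \sum_(x <- q) (if (src j == x.2.1) && (tgt j == x.2.2) then x.1 else 0).
have -> : \sum_(x <- q) x.1 *: root_at x.2.1 x.2.2 = \sum_j c j *: rd_root j.
  under [RHS]eq_bigr do rewrite scaler_suml.
  rewrite exchange_big /=; apply: eq_bigr => x _.
  rewrite /root_at scaler_sumr big_mkcond /=; apply: eq_bigr => j _.
  by case: ifP => // _; rewrite scale0r.
have -> : \sum_(x <- q) std_root x.2.1 x.2.2 *~ x.1 =
    \sum_j std_root (src j) (tgt j) *~ c j.
  under [RHS]eq_bigr do rewrite mulrz_sumr.
  rewrite exchange_big /=; apply: eq_big_seq => x /tq tx.
  rewrite -sum_std // mulrz_suml big_mkcond /=; apply: eq_bigr => j _.
  by case: ifP => // _; rewrite mulr0z.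
exact: typeA_lin.
Qed.

Lemma root_atD s t q : tag s = tag t -> tag t = tag q -> root_at s t + root_at t q = root_at s q.
Proof.
move=> st tq; apply/eqP; rewrite -subr_eq0; apply/eqP.
have := root_at_lin (q := [:: (1, (s, t)); (1, (t, q)); (-1, (s, q))]).
rewrite !big_cons !big_nil /= !scale1r scaleN1r !addr0 !mulr1z mulrN1z addrA => -[x|_ ->//].
  by rewrite !inE => /orP[/eqP->|/orP[/eqP->|/eqP->]] //=; rewrite st.
by apply/ffunP => e; rewrite !ffunE; ring.
Qed.

Lemma root_atN s t : tag s = tag t -> root_at t s = - root_at s t.
Proof. by move=> st; apply/eqP; rewrite -addr_eq0 root_atD // root_at_diag. Qed.

Definition pairing (f : 'rV[int]_r) (v : 'cV[int]_r) : int := (f *m v) 0 0.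

Lemma pairingDl f f' v : pairing (f + f') v = pairing f v + pairing f' v.
Proof. by rewrite /pairing mulmxDl mxE. Qed.
Lemma pairingNl f v : pairing (- f) v = - pairing f v.
Proof. by rewrite /pairing mulNmx mxE. Qed.
Lemma pairingDr f v v' : pairing f (v + v') = pairing f v + pairing f v'.
Proof. by rewrite /pairing mulmxDr mxE. Qed.
Lemma pairingNr f v : pairing f (- v) = - pairing f v.
Proof. by rewrite /pairing mulmxN mxE. Qed.
Lemma pairing0l v : pairing 0 v = 0. Proof. by rewrite /pairing mul0mx mxE. Qed.
Lemma pairing0r f : pairing f 0 = 0. Proof. by rewrite /pairing mulmx0 mxE. Qed.
Lemma pairingZr f z v : pairing f (z *: v) = z * pairing f v.
Proof. by rewrite /pairing -scalemxAr mxE. Qed.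
Lemma pairing_sumr f I (q : seq I) (P : pred I) (v : I -> 'cV[int]_r) :
  pairing f (\sum_(i <- q | P i) v i) = \sum_(i <- q | P i) pairing f (v i).
Proof. by rewrite /pairing mulmx_sumr summxE. Qed.
Lemma pairing_mulr f (A : 'M[int]_r) v : pairing f (A *m v) = pairing (f *m A) v.
Proof. by rewrite /pairing mulmxA. Qed.

(** A reflected root is again a root. Read in coordinates, e_s - e_t - p (e_a - e_b) must again be a
    difference of two basis vectors, which confines the Cartan integer p. *)
Lemma root_string i s t : tag s = tag t -> s <> t ->
  exists k', [/\ tag (src k') = tag (tgt k'), src k' <> tgt k' &
  forall e, std_root s t e - pairing (root_at s t) (rd_coroot i) * std_root (src i) (tgt i) e =
    std_root (src k') (tgt k') e].
Proof.
move=> st nst; case: (pair_case st) => [//|[j [es et]]].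
have [k' ek'] := root_refl i j; exists k'; have [tk nk] := src_tgt tA k'; split=> // e.
set p := pairing _ _.
have := root_at_lin (q := [:: (1, (s, t)); (- p, (src i, tgt i)); (-1, (src k', tgt k'))]).
rewrite !big_cons !big_nil /= => -[x|+ _].
  rewrite !inE => /orP[/eqP->|/orP[/eqP->|/eqP->]] //=.
  by case: (src_tgt tA i).
have -> : 1 *: root_at s t + (- p *: root_at (src i) (tgt i) + (-1 *: root_at (src k') (tgt k') + 0)) = 0.
  rewrite scale1r scaleN1r addr0 !root_atE ek' scaleNr /p es et root_atE /pairing.
  by rewrite opprB addrA addrA subrK subrr.
move/(_ erefl)/ffunP/(_ e); rewrite !ffunE !ffun_mulrz !ffunE => h.
apply/eqP; rewrite -subr_eq0; apply/eqP; rewrite -[RHS]h; ring.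
Qed.

(* The Cartan integers are those of type A: a root sharing exactly one     *)
(* index with a coroot pairs to 0 or 1 up to sign, and two such add up to 2. *)
Lemma pairing_coroot i s t : tag s = tag t ->
  pairing (root_at s t) (rd_coroot i) = std_root (src i) (tgt i) s - std_root (src i) (tgt i) t.
Proof.
set a := src i; set b := tgt i; have [tab nab] : tag a = tag b /\ a <> b := src_tgt tA i.
have ab2 : pairing (root_at a b) (rd_coroot i) = 2 by rewrite /a /b root_atE; exact: root_coroot.
have bound (t' u' e : E) (x : int) : x = std_root t' u' e -> -1 <= x <= 1.
  by move=> ->; rewrite std_rootE; case: (e == t'); case: (e == u').
have key e : tag e = tag a -> pairing (root_at e b) (rd_coroot i) = std_root a b e + 1.
  move=> ea; have [->|/eqP nea] := eqVneq e a.
    by rewrite ab2 std_rootE eqxx (introF eqP nab).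
  have [->|/eqP neb] := eqVneq e b.
    by rewrite root_at_diag pairing0l std_rootE eqxx (introF eqP (nesym nab)).
  have [k1 [_ _ e1]] := root_string i (etrans ea tab) neb.
  have [k2 [_ _ e2]] := root_string i (esym ea) (nesym nea).
  have := bound _ _ _ _ (e1 a); have := bound _ _ _ _ (e1 b).
  have := bound _ _ _ _ (e2 a); have := bound _ _ _ _ (e2 b).
  have := ab2; rewrite -(root_atD (esym ea) (etrans ea tab)) pairingDl -/a -/b !std_rootE.
  rewrite !eqxx (introF eqP nea) (introF eqP neb) (introF eqP (nesym nea)).
  rewrite (introF eqP (nesym neb)) (introF eqP nab) (introF eqP (nesym nab)) /=.
  lia.
move=> st; have [sa|/eqP nsa] := eqVneq (tag s) (tag a).
  have := key _ sa; have := key t (etrans (esym st) sa).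
  rewrite -(root_atD (s := s) (t := b) (q := t)) -?st ?sa // pairingDl.
  rewrite (root_atN (s := t)) -?st ?sa // pairingNl => -> ->; ring.
have ns e : tag e <> tag a -> std_root a b e = 0.
  move=> ne; rewrite std_rootE.
  case: eqP => [ea|_]; first by case: ne; rewrite ea.
  case: eqP => [eb|_]; first by case: ne; rewrite eb -tab.
  by rewrite subrr.
have nta : tag t <> tag a by rewrite -st.
rewrite (ns s nsa) (ns t nta) subrr.
have [->|/eqP nst] := eqVneq s t; first by rewrite root_at_diag pairing0l.
(* The root lies in another block than the coroot. The reflected vector still has entries 1 at s and
   -1 at t, so it is e_s - e_t, and its entry -p at a vanishes. *)
have [k1 [tk nk e1]] := root_string i st nst.
have := e1 s; have := e1 t; have := e1 a.
rewrite -/a -/b (ns s nsa) (ns t nta) !mulr0 !subr0 !std_rootE !eqxx (introF eqP nst).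
rewrite (introF eqP (nesym nst)) (introF eqP nab).
have -> : (a == s) = false by apply/eqP => as'; apply: nsa; rewrite as'.
have -> : (a == t) = false by apply/eqP => at'; apply: nta; rewrite at'.
move=> ea; case: (t =P tgt k1) => [et|_]; last by case: (t == _).
case: (s =P src k1) => [es|_]; last by case: (s == _).
move: ea; rewrite -et -es.
have -> : (a == s) = false by apply/eqP => as'; apply: nsa; rewrite as'.
have -> : (a == t) = false by apply/eqP => at'; apply: nta; rewrite at'.
lia.
Qed.

Lemma pairing_coroot_at (a b s t : E) : tag a = tag b -> tag s = tag t ->
  pairing (root_at s t) (coroot_at a b) = std_root a b s - std_root a b t.
Proof.
move=> /pair_case[->|[j [-> ->]]] st; last by rewrite coroot_atE pairing_coroot.
by rewrite coroot_at_diag pairing0r !std_rootE; ring.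
Qed.

(** Recognizes a coroot from a single pairing: the value 2 occurs in type A only between a root and
    its own coroot. *)
Lemma std_root_eq2 (a b s t : E) : std_root a b s - std_root a b t = 2 -> a = s /\ b = t.
Proof.
rewrite !std_rootE (eq_sym s a) (eq_sym t b).
case: (a =P s) => [->|_]; case: (b =P t) => [->|_] //.
- by case: (s == b); case: (t == s) => /eqP.
- by case: (s == t); case: (t == a) => /eqP.
- by case: (s == b); case: (t == a) => /eqP.
Qed.

(** [typeA] gives linear relations between roots only; those between coroots are recovered from
    reflections. Here the reflected coroot pairs to 2 with the root at t, s, which identifies it. *)
Lemma coroot_atN s t : tag s = tag t -> coroot_at t s = - coroot_at s t.
Proof.
move=> /pair_case[->|[j [es et]]]; first by rewrite coroot_at_diag oppr0.
have [k' ek] := coroot_refl j j; have [tj _] := src_tgt tA j.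
have e2 : rd_coroot k' = - rd_coroot j.
  by rewrite ek root_coroot scaler_nat mulr2n opprD addrA subrr sub0r.
have : pairing (root_at t s) (rd_coroot k') = 2.
  rewrite e2 root_atN ?es ?et // root_atE pairingNl pairingNr opprK; exact: root_coroot.
rewrite pairing_coroot ?es ?et // => /std_root_eq2[e1 e1'].
by rewrite -[in LHS]e1 -[in LHS]e1' coroot_atE e2 coroot_atE.
Qed.

(** For three distinct indices, reflecting the first coroot in the second adds them, and the
    resulting coroot pairs to 2 with the root at s, q. *)
Lemma coroot_atD s t q : tag s = tag t -> tag t = tag q -> coroot_at s t + coroot_at t q = coroot_at s q.
Proof.
move=> st tq.
have [->|/eqP nst] := eqVneq s t; first by rewrite coroot_at_diag add0r.
have [<-|/eqP ntq] := eqVneq t q; first by rewrite coroot_at_diag addr0.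
have [<-|/eqP nsq] := eqVneq s q; first by rewrite (coroot_atN st) subrr coroot_at_diag.
have [//|[j [es et]]] := pair_case st; have [//|[i [es' et']]] := pair_case tq.
have [k' ek] := coroot_refl i j.
have pij : pairing (root_at t q) (coroot_at s t) = -1.
  rewrite pairing_coroot_at // !std_rootE eqxx (introF eqP (nesym nst)).
  by rewrite (introF eqP (nesym nsq)) (introF eqP (nesym ntq)).
have cj : coroot_at s t = rd_coroot j by rewrite es et coroot_atE.
have ci : coroot_at t q = rd_coroot i by rewrite es' et' coroot_atE.
have ri : root_at t q = rd_root i by rewrite es' et' root_atE.
have e2 : rd_coroot k' = coroot_at s t + coroot_at t q.
  by move: pij; rewrite ek cj ci ri /pairing => ->; rewrite scaleN1r opprK.
have : pairing (root_at s q) (rd_coroot k') = 2.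
  rewrite e2 pairingDr !pairing_coroot_at //; last by rewrite st.
    rewrite !std_rootE !eqxx (introF eqP nst) (introF eqP nsq).
    by rewrite (introF eqP (nesym nsq)) (introF eqP (nesym ntq)).
  by rewrite st.
rewrite pairing_coroot ?st // => /std_root_eq2[e1 e1'].
by rewrite -[in RHS]e1 -[in RHS]e1' coroot_atE e2.
Qed.
End TypeALattice.

(** * The coroot lattice in coordinates, and the action of a Coxeter element *)

Section CorootLattice.
Variables (r : nat) (D : root_datum r) (k : nat) (n : 'I_k -> nat) (tA : typeA D n).

Local Notation E := {i : 'I_k & 'I_(n i)}.
Local Notation src := (src tA).
Local Notation tgt := (tgt tA).
Local Notation root_at := (root_at tA).
Local Notation coroot_at := (coroot_at tA).

Definition base (e : E) : E := Tagged (fun i => 'I_(n i)) (Ordinal (typeA_gt0 tA (tag e))).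

Definition block_sum (y : E -> int) (i : 'I_k) : int := \sum_(e | tag e == i) y e.

(** When the block sums of y vanish, the contributions of the base points cancel, and this is the
    element of the coroot lattice with coordinates y. *)
Definition coroot_comb (y : E -> int) : 'cV[int]_r := \sum_e y e *: coroot_at e (base e).

Lemma coroot_at_lattice s t : coroot_lattice D (coroot_at s t).
Proof.
apply/asboolP; exists (fun j => if (src j == s) && (tgt j == t) then 1 else 0).
by rewrite /coroot_at big_mkcond; apply: eq_bigr => j _; case: ifP; rewrite ?scale1r ?scale0r.
Qed.

Lemma lattice0 : coroot_lattice D 0. Proof. exact: (coroot_lattice_closed D).1. Qed.
Lemma latticeB v v' : coroot_lattice D v -> coroot_lattice D v' -> coroot_lattice D (v - v').
Proof. exact: (coroot_lattice_closed D).2. Qed.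
Lemma latticeN v : coroot_lattice D v -> coroot_lattice D (- v).
Proof. by move=> h; rewrite -sub0r; apply: latticeB => //; exact: lattice0. Qed.
Lemma latticeD v v' : coroot_lattice D v -> coroot_lattice D v' -> coroot_lattice D (v + v').
Proof. by move=> h h'; rewrite -[v']opprK; apply: latticeB => //; exact: latticeN. Qed.
Lemma latticeZ z v : coroot_lattice D v -> coroot_lattice D (z *: v).
Proof.
move=> /asboolP[c ->]; apply/asboolP; exists (fun j => z * c j).
by rewrite scaler_sumr; apply: eq_bigr => j _; rewrite scalerA.
Qed.
Lemma lattice_sum I (q : seq I) (P : pred I) (F : I -> 'cV[int]_r) :
  (forall i, P i -> coroot_lattice D (F i)) -> coroot_lattice D (\sum_(i <- q | P i) F i).
Proof. move=> h; apply: (big_ind (fun v => is_true (coroot_lattice D v))) => //; [exact: lattice0|exact: latticeD]. Qed.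

Lemma coroot_comb_lattice y : coroot_lattice D (coroot_comb y).
Proof. by apply: lattice_sum => e _; apply: latticeZ; exact: coroot_at_lattice. Qed.

Lemma coroot_comb_std s t : tag s = tag t -> coroot_comb (std_root s t) = coroot_at s t.
Proof.
move=> st; rewrite /coroot_comb; under eq_bigr do rewrite std_rootE scalerBl.
rewrite big_split /= (bigD1 s) //= eqxx scale1r big1 ?addr0; last first.
  by move=> e /negPf ->; rewrite scale0r.
rewrite (bigD1 t) //= eqxx scale1r big1 ?addr0; last first.
  by move=> e /negPf ->; rewrite scale0r oppr0.
have <- : base s = base t by rewrite /base; case: s t st => i a [j b] /= e; case: _ / e b.
by rewrite -(coroot_atN tA (s := t)) ?coroot_atD // -?st.
Qed.

Lemma lattice_comb v : coroot_lattice D v -> exists z : ridx D -> int,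
  v = coroot_comb (fun e => \sum_j std_root (src j) (tgt j) e * z j).
Proof.
move=> /asboolP[z ->]; exists z; rewrite /coroot_comb.
under [RHS]eq_bigr do rewrite scaler_suml.
rewrite exchange_big /=; apply: eq_bigr => j _.
rewrite -(coroot_atE tA) -coroot_comb_std; last by case: (src_tgt tA j).
by rewrite scaler_sumr; apply: eq_bigr => e _; rewrite scalerA mulrC.
Qed.

Lemma block_sum_std s t i : tag s = tag t -> block_sum (std_root s t) i = 0.
Proof.
move=> st; rewrite /block_sum; under eq_bigr do rewrite std_rootE.
rewrite big_split /= sumrN.
have h (s0 : E) : \sum_(e | tag e == i) (e == s0)%:R = (tag s0 == i)%:R :> int.
  rewrite big_mkcond (bigD1 s0) //= eqxx big1 ?addr0; first by case: ifP.
  by move=> e /negPf ->; rewrite if_same.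
by rewrite !h st subrr.
Qed.

Lemma pairing_comb y s t : (forall i, block_sum y i = 0) -> tag s = tag t ->
  pairing (root_at s t) (coroot_comb y) = y s - y t.
Proof.
move=> y0 st; rewrite pairing_sumr.
under eq_bigr do rewrite pairingZr pairing_coroot_at // !std_rootE !mulrBr.
rewrite !(big_split, sumrN) /=.
have h1 (s0 : E) : \sum_e y e * (s0 == e)%:R = y s0.
  rewrite (bigD1 s0) //= eqxx mulr1 big1 ?addr0 // => e.
  by rewrite eq_sym => /negPf ->; rewrite mulr0.
have h2 (s0 : E) : \sum_e y e * (s0 == base e)%:R = 0.
  have [s0b|s0b] := eqVneq s0 (base s0).
    rewrite -[RHS](y0 (tag s0)) /block_sum [RHS]big_mkcond /=; apply: eq_bigr => e _.
    have -> : (s0 == base e) = (tag e == tag s0); last by case: ifP; rewrite ?mulr1 ?mulr0.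
    apply/eqP/eqP => [->//|es]; rewrite s0b /base.
    by case: e s0 es {s0b} => i a [j b] /= e; case: _ / e b.
  rewrite big1 // => e _; case: eqP => [es|_]; last by rewrite mulr0.
  by case/eqP: s0b; rewrite es.
by rewrite !h1 !h2; ring.
Qed.

Lemma block_sum_const i (c : int) : \sum_(e : E | tag e == i) c = c * (n i)%:Z.
Proof.
have inj : injective (fun a : 'I_(n i) => Tagged (fun i => 'I_(n i)) a).
  by move=> a b /eqP; rewrite eq_Tagged => /eqP.
rewrite sumr_const -mulr_natr natz; congr (c * _%:Z).
rewrite -[RHS]card_ord -(fintype.card_image inj).
apply: eq_card => e; apply/idP/fintype.imageP.
  by move=> /eqP/val_inj ei; case: _ / ei; exists (tagged e) => //; case: e.
by case=> a _ ->; exact: (eqxx i).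
Qed.

(** Vanishing pairings make the coordinates constant on each block; their block sums are 0, so they
    vanish. Identities in the coroot lattice are proved below by this criterion. *)
Lemma lattice_pairing_eq0 v : coroot_lattice D v ->
  (forall s t, tag s = tag t -> pairing (root_at s t) v = 0) -> v = 0.
Proof.
move=> /lattice_comb[z ->]; set y := (X in coroot_comb X) => h.
have y0 i : block_sum y i = 0.
  rewrite /block_sum exchange_big big1 //= => j _.
  by rewrite -mulr_suml -/(block_sum _ i) block_sum_std ?mul0r //; case: (src_tgt tA j).
rewrite /coroot_comb big1 // => e _; rewrite (_ : y e = 0) ?scale0r //.
have : y e * (n (tag e))%:Z = 0.
  rewrite -block_sum_const -[RHS](y0 (tag e)) /block_sum; apply: eq_bigr => e' /eqP ee'.
  by apply/esym/eqP; rewrite -subr_eq0 -pairing_comb // h.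
move/eqP; rewrite mulf_eq0 => /orP[/eqP//|]; have := typeA_gt0 tA (tag e).
by case: (n _).
Qed.

(** Says that u moves coordinates by tau. Products of permutations compose from left to right,
    whence the reversed order in [actsM]. *)
Definition acts (u : 'M[int]_r) (tau : {perm E}) :=
  (forall e, tag (tau e) = tag e) /\
  forall s t, tag s = tag t -> root_at s t = root_at (tau s) (tau t) *m u.

Lemma actsM u u' tau tau' : acts u tau -> acts u' tau' -> acts (u *m u') (tau' * tau)%g.
Proof.
move=> [t h] [t' h']; split=> [e|s s' ss']; first by rewrite permM t t'.
by rewrite !permM mulmxA -h ?t' // -h'.
Qed.

Lemma acts1 : acts 1%:M 1%g.
Proof. by split=> [e|s t st]; rewrite !perm1 // mulmx1. Qed.

Lemma acts_refl j : acts (refl j) (tperm (src j) (tgt j)).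
Proof.
have [tj nj] := src_tgt tA j.
have tt e : tag (tperm (src j) (tgt j) e) = tag e by case: tpermP => // ->.
split=> // s t st.
(* The difference between an index and its transpose is a multiple of the reflecting root, with
   coefficient minus its coordinate at e. *)
have swap e : root_at (tperm (src j) (tgt j) e) e = - std_root (src j) (tgt j) e *: root_at (src j) (tgt j).
  rewrite std_rootE; case: tpermP => [->|->|/eqP/negPf -> /eqP/negPf ->].
  - by rewrite eqxx (introF eqP nj) subr0 scaleN1r root_atN.
  - by rewrite eqxx (introF eqP (nesym nj)) sub0r opprK scale1r.
  - by rewrite subrr oppr0 scale0r root_at_diag.
have -> : root_at (tperm (src j) (tgt j) s) (tperm (src j) (tgt j) t) = root_at s t *m refl j.
  rewrite -(root_atD tA (t := s)) ?tt // -(root_atD tA (s := s) (t := t)) ?tt //.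
  rewrite (root_atN tA (s := tperm _ _ t)) ?tt // !swap /refl mulmxBr mulmx1.
  rewrite mulmxA [root_at s t *m _]mx11_scalar mul_scalar_mx.
  rewrite -[_ 0 0]/(pairing _ _) pairing_coroot // -(root_atE tA) scalerBl !scaleNr !opprD opprK.
  exact: addrCA.
by rewrite -mulmxA reflK mulmx1.
Qed.

Lemma is_weyl_refl (j : ridx D) : is_weyl D (refl j).
Proof. by apply/asboolP; exists [:: j]; rewrite /= mulmx1. Qed.

(** Induction on the number of moved points: composing with the transposition of e and tau e fixes e
    and moves no new point. *)
Lemma weyl_realize (tau : {perm E}) : (forall e, tag (tau e) = tag e) ->
  exists u : weyl D, acts u tau.
Proof.
have [N] := ubnP #|[pred e | tau e != e]|; elim: N => // N IH in tau * => hN tt.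
have [e te|fix_all] := pickP (fun e => tau e != e); last first.
  have -> : tau = 1%g by apply/permP => e; rewrite perm1; apply/eqP/negbFE/fix_all.
  by exists (weyl_one D); exact: acts1.
have [|j [sj tj]] := typeA_surj tA (esym (tt e)); first by apply/eqP; rewrite eq_sym.
pose tau' := (tau * tperm (src j) (tgt j))%g.
have tt' x : tag (tau' x) = tag x.
  by rewrite permM (acts_refl j).1 tt.
have [|u hu] := IH tau' _ tt'.
  rewrite ltnS in hN; apply: leq_trans hN; apply: proper_card.
  apply/properP; split; last first.
    by exists e; rewrite !inE // permM sj tj tpermR negbK.
  apply/fintype.subsetP => x; rewrite !inE; apply: contra => /eqP tx.
  rewrite permM tx sj tj; case: tpermP => [xe|xe|//].
    by rewrite -xe tx in te *; rewrite eqxx in te.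
  by rewrite xe in tx; move/perm_inj: tx => tx; rewrite tx eqxx in te.
exists (weyl_mul (Weyl (is_weyl_refl j)) u) => /=.
have -> : tau = (tau' * tperm (src j) (tgt j))%g.
  by rewrite /tau' -mulgA tperm2 mulg1.
exact: actsM (acts_refl j) hu.
Qed.

Lemma weyl_sub_lattice (u : weyl D) v : coroot_lattice D (u *m v - v).
Proof.
have /asboolP[q ->] := weylP u; elim: q => [|j q IH] /=.
  by rewrite mul1mx subrr; exact: lattice0.
rewrite -mulmxA; set v' := _ *m v in IH *; rewrite /refl mulmxBl mul1mx addrAC.
apply: latticeB => //; rewrite -mulmxA [rd_root j *m v']mx11_scalar mul_mx_scalar.
by apply: latticeZ; rewrite -(coroot_atE tA); exact: coroot_at_lattice.
Qed.

Lemma acts_perm_onto (tau : {perm E}) : (forall e, tag (tau e) = tag e) ->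
  forall e, tag ((tau^-1)%g e) = tag e.
Proof. by move=> tt e; rewrite -[in RHS](permKV tau e) tt. Qed.

Lemma acts_pairing u tau s t v : acts u tau -> tag s = tag t ->
  pairing (root_at s t) (u *m v) = pairing (root_at ((tau^-1)%g s) ((tau^-1)%g t)) v.
Proof.
move=> [tt h] st; rewrite pairing_mulr -{1}[s](permKV tau) -{1}[t](permKV tau) -h //.
by rewrite !acts_perm_onto.
Qed.

(** The difference u v - u' v lies in the coroot lattice, since the Weyl group acts trivially modulo
    coroots, and all roots kill it. *)
Lemma acts_inj (u u' : weyl D) tau : acts u tau -> acts u' tau -> u = u'.
Proof.
move=> au au'; apply/val_inj/matrixP => i j /=.
pose v : 'cV[int]_r := delta_mx j 0.
suff : u *m v - u' *m v = 0.
  move/eqP; rewrite subr_eq0 => /eqP /matrixP /(_ i 0).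
  by rewrite -!colE !mxE.
apply: lattice_pairing_eq0.
  rewrite -[u *m v](subrK v) -addrA; apply: latticeD; first exact: weyl_sub_lattice.
  by rewrite -opprB; apply: latticeN; exact: weyl_sub_lattice.
move=> s t st; rewrite pairingDr pairingNr (acts_pairing _ au) // (acts_pairing _ au') //.
by rewrite subrr.
Qed.

Variables (w : weyl D) (sigma : {perm E}).
Hypothesis aw : acts w sigma.
Hypothesis sigma_trans : forall e e', tag e = tag e' -> e' \in porbit sigma e.

(** The action of w on coordinates. *)
Definition twist (y : E -> int) (e : E) : int := y ((sigma^-1)%g e).

(** As s and t lie on one cycle, t = sigma^m s, and e_s - e_t telescopes into 1 - w applied to the
    sum of the e_(sigma^i s) for i < m. *)
Lemma std_root_twist s t : tag s = tag t -> exists y : E -> int,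
  forall e, std_root s t e = y e - twist y e.
Proof.
move=> /sigma_trans/porbitP[m ->].
exists (fun e => \sum_(i < m) (e == (sigma ^+ i)%g s)%:R) => e.
rewrite /twist -sumrB std_rootE.
have tw i : ((sigma^-1)%g e == (sigma ^+ i)%g s) = (e == (sigma ^+ i.+1)%g s).
  by rewrite expgSr permM -(inj_eq (@perm_inj _ sigma)) permKV.
under eq_bigr do rewrite tw.
rewrite -opprB; apply/esym.
rewrite (eq_bigr (fun i : 'I_m => - ((e == (sigma ^+ i.+1)%g s)%:R - (e == (sigma ^+ i)%g s)%:R))).
  by rewrite sumrN -(big_mkord xpredT (fun i => (e == (sigma ^+ i.+1)%g s)%:R - (e == (sigma ^+ i)%g s)%:R))
    telescope_sumr // expg0 perm1.
by move=> i _; rewrite opprB.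
Qed.

(** Here y is an arbitrary integral function, a lift of a coweight: its block sums need not vanish,
    and this is the obstruction that stability removes. *)
Lemma lattice_twist z : coroot_lattice D z -> exists y : E -> int,
  (forall i, block_sum (fun e => y e - twist y e) i = 0) /\
  z = coroot_comb (fun e => y e - twist y e).
Proof.
move=> /lattice_comb[c ->].
have hy j : {y : E -> int | forall e, std_root (src j) (tgt j) e = y e - twist y e}.
  by apply: cid; apply: std_root_twist; case: (src_tgt tA j).
pose y e := \sum_j sval (hy j) e * c j.
have yE e : \sum_j std_root (src j) (tgt j) e * c j = y e - twist y e.
  rewrite /y /twist -sumrB; apply: eq_bigr => j _.
  by rewrite (svalP (hy j)) mulrBl.
exists y; split=> [i|]; last by congr coroot_comb; apply/funext.
rewrite /block_sum; under eq_bigr do rewrite -yE.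
rewrite exchange_big big1 //= => j _.
by rewrite -mulr_suml -/(block_sum _ i) block_sum_std ?mul0r //; case: (src_tgt tA j).
Qed.

Lemma block_sum_reindex (tau : {perm E}) y i : (forall e, tag (tau e) = tag e) ->
  block_sum (fun e => y (tau e)) i = block_sum y i.
Proof.
by move=> tt; rewrite /block_sum [RHS](reindex_inj (@perm_inj _ tau)); apply: eq_bigl => e; rewrite tt.
Qed.

Lemma block_sumD y y' i :
  block_sum (fun e => y e + y' e) i = block_sum y i + block_sum y' i.
Proof. exact: big_split. Qed.

Lemma block_sumB y y' i :
  block_sum (fun e => y e - y' e) i = block_sum y i - block_sum y' i.
Proof. exact: sumrB. Qed.

Lemma block_sum_tag (c : 'I_k -> int) i :
  block_sum (fun e => c (tag e)) i = c i * (n i)%:Z.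
Proof. by rewrite -block_sum_const; apply: eq_bigr => e /eqP ->. Qed.

(** Scaling by the product of the n_i lets the block averages of y be subtracted integrally. Being
    constant on blocks, they are fixed by w, and mu lands in the coroot lattice. *)
Lemma coxeter_image (j : ridx D) : exists c : nat, exists mu : 'cV[int]_r,
  (0 < c)%N /\ c%:Z *: rd_coroot j = mu - w *m mu.
Proof.
have [|y [y0 ey]] := @lattice_twist (rd_coroot j); first by rewrite -(coroot_atE tA) coroot_at_lattice.
pose c := (\prod_i n i)%N.
have c0 : (0 < c)%N by apply: prodn_gt0 => i; exact: typeA_gt0 tA i.
have cn i : (c %/ n i * n i)%N = c by apply/divnK; rewrite /c (bigD1 i) //= dvdn_mulr.
pose y' e := c%:Z * y e - (c %/ n (tag e))%N%:Z * block_sum y (tag e).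
have y'0 i : block_sum y' i = 0.
  rewrite block_sumB (block_sum_tag (fun i => (c %/ n i)%N%:Z * block_sum y i)).
  rewrite [X in X - _](_ : _ = c%:Z * block_sum y i); last by rewrite /block_sum mulr_sumr.
  by rewrite mulrAC -PoszM cn subrr.
exists c, (coroot_comb y'); split=> //; apply/eqP; rewrite -subr_eq0; apply/eqP.
apply: lattice_pairing_eq0.
  apply: latticeB; first by apply: latticeZ; rewrite -(coroot_atE tA) coroot_at_lattice.
  by rewrite -opprB; apply: latticeN; exact: weyl_sub_lattice.
move=> s t st; rewrite ey !(pairingDr, pairingNr) pairingZr (acts_pairing _ aw) //.
rewrite !pairing_comb // ?(acts_perm_onto aw.1) // /twist /y' !(acts_perm_onto aw.1) st; ring.
Qed.

(** Write z as 1 - w applied to y and let u be w^a_i on block i. Then z - (u m - m) is 1 - w applied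
    to y + X, with X a geometric sum along the orbits. It remains to give y + X zero block sums by
    subtracting block constants. *)
Lemma stable_orbit (m z : 'cV[int]_r) (x : E -> int) :
  (forall j, pairing (rd_root j) m = x (src j) - x (tgt j)) ->
  (forall i, coprime (absz (block_sum x i)) (n i)) ->
  coroot_lattice D z ->
  exists u : weyl D, exists mu : 'cV[int]_r,
  [/\ (u * w = w * u)%g, coroot_lattice D mu & z = (u *m m - m) + (mu - w *m mu)].
Proof.
move=> xm xcop /lattice_twist[y [y0 ->]].
have xrt s t : tag s = tag t -> pairing (root_at s t) m = x s - x t.
  case/(pair_case tA) => [->|[j [-> ->]]]; last by rewrite root_atE.
  by rewrite root_at_diag pairing0l subrr.
have tsig := aw.1.
have tsigX a e : tag ((sigma ^+ a)%g e) = tag e.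
  by elim: a => [|a IH]; rewrite ?expg0 ?perm1 // expgSr permM tsig.
(* Bezout for d_i and n_i solves for the exponent a_i modulo n_i; its nonnegative residue is taken,
   since permutations are raised to natural powers. *)
have ex i : {a : nat * int | block_sum y i + a.1%:Z * block_sum x i = a.2 * (n i)%:Z}.
  apply: cid; have n0 : (n i)%:Z != 0 by have := typeA_gt0 tA i; case: (n i).
  have : coprimez (block_sum x i) (n i)%:Z by exact: xcop.
  move=> /coprimezP[[u v] /= uv].
  pose a := - block_sum y i * u.
  have ea := divz_eq a (n i)%:Z; have a0 := modz_ge0 a n0.
  set q := (a %/ _)%Z in ea; set b := (a %% _)%Z in ea a0.
  exists (`|b|%N, block_sum y i * v - q * block_sum x i) => /=.
  rewrite gez0_abs //; have -> : b = a - q * (n i)%:Z by rewrite ea; ring.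
  have e1 : block_sum y i = block_sum y i * (u * block_sum x i + v * (n i)%:Z).
    by rewrite uv mulr1.
  by rewrite {1}e1 /a; ring.
pose a i := (sval (ex i)).1; pose c i := (sval (ex i)).2.
have ac i : block_sum y i + (a i)%:Z * block_sum x i = c i * (n i)%:Z := svalP (ex i).
have tau_inj : injective (fun e => (sigma ^+ a (tag e))%g e).
  move=> e e' ee; have te : tag e = tag e' by rewrite -(tsigX (a (tag e)) e) ee tsigX.
  by move: ee; rewrite te => /perm_inj.
pose tau := perm tau_inj.
have tauE e : tau e = (sigma ^+ a (tag e))%g e by rewrite permE.
have ttau e : tag (tau e) = tag e by rewrite tauE tsigX.
have [u au] := weyl_realize ttau.
have comm : (tau * sigma = sigma * tau)%g.
  apply/permP => e; rewrite !permM !tauE tsig -!permM.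
  by rewrite -expgSr -expgS.
have uw : (u * w = w * u)%g.
  apply: (@acts_inj _ _ (tau * sigma)%g); last by exact: actsM aw au.
  by rewrite comm; exact: actsM au aw.
have tauV e : (tau^-1)%g e = ((sigma^-1) ^+ a (tag e))%g e.
  apply: (@perm_inj _ tau); rewrite permKV tauE.
  have te : tag (((sigma^-1) ^+ a (tag e))%g e) = tag e.
    by rewrite expVgn -[in RHS](permKV (sigma ^+ a (tag e))%g e) tsigX.
  by rewrite te expVgn permKV.
(* 1 - w sends this partial geometric sum to x - u x, and its total over block i is a_i d_i. *)
pose X e := \sum_(i < a (tag e)) x (((sigma^-1) ^+ i)%g e).
have tsigV e : tag ((sigma^-1)%g e) = tag e by exact: acts_perm_onto.
have tsigVX b e : tag (((sigma^-1) ^+ b)%g e) = tag e.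
  by rewrite expVgn -[in RHS](permKV (sigma ^+ b)%g e) tsigX.
have XE e : X e - twist X e = x e - x ((tau^-1)%g e).
  rewrite /twist /X tsigV -sumrB tauV.
  rewrite (eq_bigr (fun i : 'I_(a (tag e)) =>
      - (x (((sigma^-1) ^+ i.+1)%g e) - x (((sigma^-1) ^+ i)%g e)))); last first.
    by move=> i _; rewrite opprB expgS permM.
  rewrite sumrN -(big_mkord xpredT (fun i => x (((sigma^-1) ^+ i.+1)%g e) - x (((sigma^-1) ^+ i)%g e))).
  by rewrite telescope_sumr // opprB expg0 perm1.
have Xsum i : block_sum X i = (a i)%:Z * block_sum x i.
  rewrite /block_sum (eq_bigr (fun e => \sum_(b < a i) x (((sigma^-1) ^+ b)%g e))); last first.
    by move=> e /eqP ei; rewrite /X ei.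
  rewrite exchange_big /= (eq_bigr (fun=> block_sum x i)); last first.
    by move=> b _; rewrite -(block_sum_reindex x i (tsigVX b)).
  by rewrite sumr_const card_ord -mulr_natl natz.
(* c_i is the integral average of y + X over block i, so Y has zero block sums and defines an
   element of the coroot lattice. *)
pose Y e := y e + X e - c (tag e).
have Y0 i : block_sum Y i = 0.
  by rewrite block_sumB block_sumD Xsum ac (block_sum_tag c) subrr.
exists u, (coroot_comb Y); split=> //; first exact: coroot_comb_lattice.
apply/eqP; rewrite -subr_eq0; apply/eqP; apply: lattice_pairing_eq0.
  apply: latticeB; first exact: coroot_comb_lattice.
  apply: latticeD; first exact: weyl_sub_lattice.
  by rewrite -opprB; apply: latticeN; exact: weyl_sub_lattice.
move=> s t st; rewrite !(pairingDr, pairingNr) (acts_pairing _ aw) // (acts_pairing _ au) //.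
rewrite !pairing_comb // ?(acts_perm_onto aw.1) // !xrt ?(acts_perm_onto ttau) //.
have := XE s; have := XE t; rewrite /twist /Y !tsigV st => e1 e2.
have -> : x ((tau^-1)%g s) = x s - (X s - X ((sigma^-1)%g s)) by rewrite e2; ring.
have -> : x ((tau^-1)%g t) = x t - (X t - X ((sigma^-1)%g t)) by rewrite e1; ring.
ring.
Qed.
End CorootLattice.

(** * The determinant on cocharacters and its real kernel *)

Section DetMatrix.
Variables (r : nat) (D : root_datum r) (s : nat) (Q : 'M[int]_(s, r)).
Hypothesis Q_det : is_det_matrix D Q.
Variables (k : nat) (n : 'I_k -> nat) (tA : typeA D n).

Lemma det_lattice v : coroot_lattice D v -> Q *m v = 0.
Proof. by move=> h; apply/(Q_det.2 v); exists 1%N. Qed.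

Lemma det_weyl (u : weyl D) : Q *m u = Q.
Proof.
apply/matrixP => i j; have := det_lattice (weyl_sub_lattice tA u (delta_mx j 0)).
rewrite mulmxBr mulmxA => /eqP; rewrite subr_eq0 => /eqP/matrixP/(_ i 0).
by rewrite -!colE !mxE.
Qed.

Lemma det_section : exists B : 'M[int]_(r, s), Q *m B = 1%:M.
Proof.
exists (\matrix_(i, j) sval (cid (Q_det.1 (delta_mx j 0))) i 0).
apply/matrixP => i j; rewrite !mxE.
have := svalP (cid (Q_det.1 (delta_mx j 0))).
move=> /matrixP/(_ i 0); rewrite !mxE andbT => <-.
by apply: eq_bigr => i' _; rewrite !mxE.
Qed.

Variables (w : weyl D) (sigma : {perm {i : 'I_k & 'I_(n i)}}).
Hypothesis aw : acts tA w sigma.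
Hypothesis sigma_trans : forall e e' : {i : 'I_k & 'I_(n i)}, tag e = tag e' ->
  e' \in porbit sigma e.
Variable R : realType.

Definition in_image (x : 'cV[R]_r) := exists a : 'cV[R]_r, x = a - realmx R w *m a.

Lemma in_image_scale c x : in_image x -> in_image (c *: x).
Proof. by move=> [a ->]; exists (c *: a); rewrite -scalemxAr scalerBr. Qed.

Lemma in_image_unscale c x : c != 0 -> in_image (c *: x) -> in_image x.
Proof. by move=> c0 /(in_image_scale c^-1); rewrite scalerA mulVf // scale1r. Qed.

Lemma in_image_sum I (q : seq I) (F : I -> 'cV[R]_r) :
  (forall i, in_image (F i)) -> in_image (\sum_(i <- q) F i).
Proof.
move=> h; apply: (big_ind in_image) => //; first by exists 0; rewrite mulmx0 subr0.
by move=> _ _ [a ->] [b ->]; exists (a + b); rewrite mulmxDr opprD addrACA.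
Qed.

Lemma coroot_in_image (j : ridx D) : in_image (realmx R (rd_coroot j)).
Proof.
have [c [mu [c0 e]]] := coxeter_image aw sigma_trans j.
have c0' : c%:R != 0 :> R by rewrite pnatr_eq0 -lt0n.
apply: (in_image_unscale c0').
exists (realmx R mu); have := congr1 (fun A => realmx R A) e.
by rewrite map_mxZ map_mxB map_mxM /= -pmulrn.
Qed.

(** The real kernel of Q is spanned by integral vectors in its kernel. Such a vector lies in the
    saturation, so a multiple is a combination of coroots, and over R each coroot is in the image of
    1 - w. *)
Lemma det_kernel (v : 'cV[R]_r) : realmx R Q *m v = 0 -> in_image v.
Proof.
move=> Qv; have [B QB] := det_section.
(* The projector 1 - B Q onto the kernel of Q is integral, so its columns are the required integral
   vectors. *)
have -> : v = \sum_i v i 0 *: realmx R (delta_mx i 0 - B *m Q *m delta_mx i 0).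
  have e : v = (1%:M - realmx R (B *m Q)) *m v.
    by rewrite mulmxBl mul1mx map_mxM -mulmxA Qv mulmx0 subr0.
  rewrite {1}e {1}[v]matrix_sum_delta mulmx_sumr; apply: eq_bigr => i _.
  rewrite big_ord1 -scalemxAr; congr (_ *: _).
  have <- : realmx R (delta_mx i 0) = delta_mx i 0 :> 'cV[R]_r.
    by apply/matrixP => a b; rewrite !mxE; case: (_ && _).
  by rewrite map_mxB !map_mxM mulmxBl mul1mx.
apply: in_image_sum => i; apply: in_image_scale.
set x := _ - _.
have : Q *m x = 0 by rewrite mulmxBr !mulmxA QB mul1mx subrr.
move/(Q_det.2 x) => [c c0 /asboolP[z e]].
have c0' : c%:R != 0 :> R by rewrite pnatr_eq0 -lt0n.
apply: (in_image_unscale c0').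
have -> : c%:R *: realmx R x = \sum_j (z j)%:~R *: realmx R (rd_coroot j).
  rewrite scaler_nat -raddfMn /= e raddf_sum; apply: eq_bigr => j _.
  by apply/matrixP => a b; rewrite !mxE; exact: intrM.
by apply: in_image_sum => j; apply: in_image_scale; exact: coroot_in_image.
Qed.
End DetMatrix.

(** * Classification of torsors by factors of automorphy *)

Section Isomorphisms.
Variables (R : realType) (l : R) (l_gt0 : 0 < l) (F : groupType).
Variables (G : gsheaf (circle l) F) (L : gsheaf (line R) F).
Hypothesis GL : lifted_sheaf G L.

Lemma has_factor (P : torsor G) :
  exists2 c : R -> F, (forall x, adm L x c) & has_automorphy L P c.
Proof.
have [c [d [ac dc]]] := factor_exists l_gt0 GL P.
by exists c => //; apply/has_automorphyP; exists d.
Qed.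

Lemma factor_realize c : (forall x, adm L x c) -> exists P : torsor G, has_automorphy L P c.
Proof.
move=> ac; exists (factor_torsor l_gt0 GL ac).
by apply/has_automorphyP; have [d dc] := factor_torsorP l_gt0 GL ac; exists d.
Qed.

Lemma iso_of_factored (P Q : torsor G) c (d : forall U : oset (circle l), P U -> R -> F)
    (d' : forall U : oset (circle l), Q U -> R -> F) :
  factored (Y := circle l) l L id c d -> factored (Y := circle l) l L id c d' ->
  exists m : tmor id id P Q, (forall U, bijective (m U U (@subset_refl _ U))) /\
    forall (U : oset (circle l)) p x, U (chart _ x) ->
      d' U (m U U (@subset_refl _ U) p) x = d U p x.
Proof.
move=> dc dc'.
have sec (x : R) (g : circle l -> F) : adm G x g -> adm G x (id g) by [].
have [m mE] := tmor_of_factored (f := id) (phi := id) GL (fun=> erefl) sec dc' dc.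
have [m' mE'] := tmor_of_factored (f := id) (phi := id) GL (fun=> erefl) sec dc dc'.
exists m; split=> [U|U p x Ux]; last exact: mE.
exists (m' U U (@subset_refl _ U)) => p.
  by apply: (eq_section dc) => x Ux; rewrite mE' // mE.
by apply: (eq_section dc') => x Ux; rewrite mE // mE'.
Qed.

Lemma iso_of_factor (P Q : torsor G) c :
  has_automorphy L P c -> has_automorphy L Q c -> torsor_iso P Q.
Proof.
move=> /has_automorphyP[d dc] /has_automorphyP[d' dc'].
by have [m [mb _]] := iso_of_factored dc dc'; exists m.
Qed.

Lemma factor_of_iso (P Q : torsor G) c :
  torsor_iso P Q -> has_automorphy L Q c -> has_automorphy L P c.
Proof.
move=> [m _] /has_automorphyP[d dc]; apply/has_automorphyP.
have sec (x : R) (g : circle l -> F) : adm G x g -> adm G x (id g) by [].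
have [e ec _] := factored_of_tmor (f := id) (phi := id) (fun=> erefl) sec m
  (fun U => @oset_open _ _ U) dc.
by exists e.
Qed.

(** Uses a common factor in both directions, so no inverse family of maps has to be assembled. *)
Lemma torsor_iso_sym (P Q : torsor G) : torsor_iso P Q -> torsor_iso Q P.
Proof.
move=> PQ; have [c _ Qc] := has_factor Q.
exact: iso_of_factor Qc (factor_of_iso PQ Qc).
Qed.

Lemma torsor_iso_trans (P Q T : torsor G) :
  torsor_iso P Q -> torsor_iso Q T -> torsor_iso P T.
Proof.
move=> PQ QT; have [c _ Tc] := has_factor T.
exact: iso_of_factor (factor_of_iso PQ (factor_of_iso QT Tc)) Tc.
Qed.

Lemma torsor_iso_refl (P : torsor G) : torsor_iso P P.
Proof. by have [c _ Pc] := has_factor P; exact: (iso_of_factor Pc). Qed.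
End Isomorphisms.

Section Classes.
Variables (T : Type) (e : T -> T -> Prop).
Hypotheses (e_refl : forall x, e x x) (e_sym : forall x y, e x y -> e y x).
Hypothesis e_trans : forall x y z, e x y -> e y z -> e x z.

Lemma classes_eq (c c' : Defs.classes e) : sval c = sval c' -> c = c'.
Proof. by case: c c' => [C hC] [C' hC'] /= E; subst C'; congr exist; exact: Prop_irrelevance. Qed.

Lemma class_of_eq x y : e x y -> class_of e x = class_of e y.
Proof.
move=> xy; apply: classes_eq; apply/funext => z /=; apply/propext; split=> h.
  exact: e_trans (e_sym xy) h.
exact: e_trans xy h.
Qed.

Lemma class_of_inj x y : class_of e x = class_of e y -> e x y.
Proof. by move=> /(congr1 (fun c => sval c y)) /= ->; exact: e_refl. Qed.

Lemma class_nonempty (c : Defs.classes e) : exists x, c = class_of e x.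
Proof. by have [x ex] := svalP c; exists x; apply: classes_eq. Qed.

Lemma in_class_of (c : Defs.classes e) x : in_class c x -> c = class_of e x.
Proof. by have [y ->] := class_nonempty c => /= yx; exact: class_of_eq. Qed.
End Classes.

Section Pushforward.
Variables (R : realType) (l : R) (l_gt0 : 0 < l) (F F' : groupType).
Variables (G : gsheaf (circle l) F) (G' : gsheaf (circle l) F') (L' : gsheaf (line R) F').
Hypothesis GL' : lifted_sheaf G' L'.
Variable phi : (circle l -> F) -> circle l -> F'.
Hypothesis phi_sec : forall x g, adm G x g -> adm G' x (phi g).
Variable P : torsor G.
Variables (c : R -> F') (e : forall U : oset (circle l), P U -> R -> F').
Hypothesis ec : factored (Y := circle l) l L' phi c e.

(** Both conditions on P' say that e comes from a trivialization of P'. Any two factors arising from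
    a map P -> P' are conjugate, and the conjugating b corrects the trivialization to have factor
    exactly c. *)
Lemma pushforwardP (P' : torsor G') :
  is_pushforward phi P P' <-> has_automorphy L' P' c.
Proof.
split=> [[m]|/has_automorphyP[d' dc']].
  have [c' [d' [_ dc']]] := factor_exists l_gt0 GL' P'.
  have [e' ec' _] := factored_of_tmor (f := id) (fun=> erefl) phi_sec m
    (fun U => @oset_open _ _ U) dc'.
  have [b [ab _ bc]] := compare_factored (@chart_addl _ l) ec' ec.
  apply/has_automorphyP; exists (fun U p x => b x * d' U p x)%g.
  have := factored_mul ab dc'.
  have -> // : (fun x => b (x + l) * c' x * (b x)^-1)%g = c.
  by apply/funext => x; rewrite bc mulgK.
have [m _] := tmor_of_factored (f := id) GL' (fun=> erefl) phi_sec dc' ec.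
by constructor.
Qed.
End Pushforward.

Section ConstantFactor.
Variables (R : realType) (l : R) (l_gt0 : 0 < l) (A : zmodType).

Lemma const_factor_inj (E : torsor (const_sheaf (circle l) (GRing.to_multiplicative A))) (a a' : A) :
  has_automorphy (const_sheaf (line R) _) E (fun=> a) ->
  has_automorphy (const_sheaf (line R) _) E (fun=> a') -> a = a'.
Proof.
move=> /has_automorphyP[d dc] /has_automorphyP[d' dc'].
have [b [ab _ bc]] := compare_factored (@chart_addl _ l) dc dc'.
have := bc 0; rewrite (locally_constant_line ab) => h.
have {}h : (b 0 : A) + a = a' + (b 0 : A) by exact: h.
by apply: (@addrI _ (b 0 : A)); rewrite h addrC.
Qed.
End ConstantFactor.

Section Slopes.
Variables (R : realType) (s : nat).
Implicit Types (h : R -> 'cV[R]_s) (a : 'cV[int]_s).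

Lemma affine_at_ext x h h' a : (\forall y \near x, h y = h' y) ->
  affine_at x h a -> affine_at x h' a.
Proof.
move=> hh' H; have e := nbhs_singleton hh'.
by apply: filterS2 hh' H => y -> ->; rewrite e.
Qed.

Lemma affine_atD x h h' a a' : affine_at x h a -> affine_at x h' a' ->
  affine_at x (fun y => h y + h' y) (a + a').
Proof.
move=> H H'; apply: filterS2 H H' => y -> ->.
by rewrite map_mxD scalerDr addrACA.
Qed.

Lemma affine_at_mul (s' : nat) (A : 'M[int]_(s', s)) x h a : affine_at x h a ->
  affine_at x (fun y => realmx R A *m h y) (A *m a).
Proof.
by apply: filterS => y ->; rewrite map_mxM mulmxDr scalemxAr.
Qed.

Lemma affine_at_shift (l : R) x h a : affine_at (x + l) h a -> affine_at x (fun y => h (y + l)) a.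
Proof. by move=> /near_translate; apply: filterS => y ->; congr (_ + _ *: _); ring. Qed.

Lemma affine_at_pic_fun (x : R) (m : 'cV[int]_s) (v : 'cV[R]_s) : affine_at x (pic_fun m v) m.
Proof.
near=> y; rewrite /pic_fun -addrA -scalerDl; by congr (_ + _ *: _); ring.
Unshelve. all: by end_near. Qed.

(** [slope] quantifies over all chart representatives of a point; the first hypothesis reduces them
    to one. *)
Lemma slope_homogeneous (X : curve R) (h : X -> 'cV[R]_s) x a :
  (forall x' t, chart X x' = chart X x -> chart X (x' + t) = chart X (x + t)) ->
  affine_at x (h \o chart X) a -> Defs.slope h (chart X x) = a.
Proof.
move=> hX H; apply: xget_unique.
  move=> x' /hX ex; apply: filterS (near_sides H) => t [+ _].
  by rewrite /= addrAC subrr add0r ex.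
move=> a' /= /(_ x erefl) H'; apply/(@realmx_inj R).
have H0 : \forall t \near (0 : R)^'+, 0 < t by exact: nbhs_right_gt.
have [t [t0 [[e _] e']]] := filter_ex (filterI H0 (filterI (near_sides H) H')).
move: e'; rewrite [LHS]e /= addrAC subrr add0r => /addrI /esym.
move/(congr1 (fun u => t^-1 *: u)); rewrite !scalerA mulVf ?scale1r //.
by rewrite gt_eqF.
Qed.

Lemma slope_chart (l : R) (h : circle l -> 'cV[R]_s) x a :
  affine_at x (h \o chart (circle l)) a -> Defs.slope h (chart (circle l) x) = a.
Proof.
apply: slope_homogeneous => x' t /chart_eqP[n e]; apply/chart_eqP; exists n.
by rewrite -e; ring.
Qed.

Lemma slope_line x h a : affine_at x h a -> Defs.slope (X := line R) h x = a.
Proof. by apply: (slope_homogeneous (X := line R)) => x' t /= ->. Qed.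

End Slopes.

(** * Factors and degrees for Picard groups *)

Section PicardFactors.
Variables (R : realType) (l : R) (l_gt0 : 0 < l) (s : nat).
Implicit Types (m mu : 'cV[int]_s) (v : 'cV[R]_s).
Local Notation bundle := (torsor (harm_sheaf (circle l) s)).

Definition pic_factor (P : bundle) m v :=
  has_automorphy (harm_sheaf (line R) s) P (pic_fun m v).

Lemma pic_factor_exists P : exists m v, pic_factor P m v.
Proof.
have [c ac Pc] := has_factor l_gt0 (harm_lifted l s) P.
by have [m [v ec]] := harmonic_line ac; exists m, v; rewrite /pic_factor -ec.
Qed.

Lemma pic_factor_realize m v : exists P : bundle, pic_factor P m v.
Proof.
by apply: (factor_realize l_gt0 (harm_lifted l s)) => x; exact: pic_fun_harmonic.
Qed.

Lemma pic_factor_iso P Q m v : pic_factor P m v -> pic_factor Q m v -> torsor_iso P Q.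
Proof. exact: (iso_of_factor (harm_lifted l s)). Qed.

Lemma pic_factor_of_iso P Q m v : torsor_iso P Q -> pic_factor Q m v -> pic_factor P m v.
Proof. exact: factor_of_iso. Qed.

(** A change of trivialization al + x mu commutes with the factor, so only its increment l mu over
    one period is seen. *)
Lemma pic_factor_unique P m v m' v' : pic_factor P m v -> pic_factor P m' v' ->
  m = m' /\ exists mu, v' = v + l *: realmx R mu.
Proof.
move=> /has_automorphyP[d dc] /has_automorphyP[d' dc'].
have [b [ab _ bc]] := compare_factored (@chart_addl _ l) dc dc'.
have [mu [al eb]] := harmonic_line ab.
have {}bc x : al + (x + l) *: realmx R mu + (v + x *: realmx R m) =
    v' + x *: realmx R m' + (al + x *: realmx R mu) by have := bc x; rewrite eb.
split; [apply: (@realmx_inj R)|exists mu]; apply/matrixP => i j.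
  have := congr1 (fun M : 'cV[R]_s => M i j) (bc 0); have := congr1 (fun M : 'cV[R]_s => M i j) (bc 1).
  rewrite !mxE; lra.
have := congr1 (fun M : 'cV[R]_s => M i j) (bc 0); rewrite !mxE; lra.
Qed.

Lemma pic_factor_shift P m v mu : pic_factor P m v -> pic_factor P m (v + l *: realmx R mu).
Proof.
move=> /has_automorphyP[d dc]; apply/has_automorphyP.
exists (fun U p x => (pic_fun mu 0 x * d U p x)%g).
have := factored_mul (fun x => pic_fun_harmonic mu 0 x : adm (harm_sheaf (line R) s) x _) dc.
set c' := (X in factored _ _ _ X _).
suff -> : pic_fun m (v + l *: realmx R mu) = c' by [].
apply/funext => x; apply/esym.
change ((0 + (x + l) *: realmx R mu) + (v + x *: realmx R m) - (0 + x *: realmx R mu) =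
  (v + l *: realmx R mu) + x *: realmx R m).
by apply/matrixP => i j; rewrite !mxE; ring.
Qed.

Lemma harm_affine_at x (h : R -> 'cV[R]_s) : adm (harm_sheaf (line R) s) x h ->
  affine_at x h (Defs.slope (X := line R) h x).
Proof. by move=> /harmonicP[a ha]; have := ha; rewrite -(slope_line ha). Qed.

Lemma slope_constant x (h : R -> 'cV[R]_s) : adm (harm_sheaf (line R) s) x h ->
  \forall y \near x, Defs.slope (X := line R) h y = Defs.slope (X := line R) h x.
Proof.
move=> /harm_affine_at/affine_at_near; apply: filterS => y; exact: slope_line.
Qed.

Lemma to_slope_sec (x : R) (g : circle l -> GRing.to_multiplicative 'cV[R]_s) :
  adm (harm_sheaf (circle l) s) x g ->
  adm (const_sheaf (circle l) (GRing.to_multiplicative 'cV[int]_s)) x (to_slope g).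
Proof.
move=> /(lift_adm (harm_lifted l s))/harm_affine_at ha.
have := affine_at_near ha; apply: filterS => y /slope_chart e.
by rewrite /to_slope e (slope_chart ha).
Qed.

Lemma pic_factor_degree P m v d : pic_factor P m v -> pic_has_degree P d <-> m = d.
Proof.
move=> /has_automorphyP[e [[ea er et] ec]].
pose e' (U : oset (circle l)) (p : P U) x : GRing.to_multiplicative 'cV[int]_s :=
  Defs.slope (X := line R) (e U p) x.
have e'E (U : oset (circle l)) (p : P U) x : U (chart _ x) -> affine_at x (e U p) (e' U p x).
  by move=> Ux; apply: harm_affine_at; exact: ea.
have ec' : factored (Y := circle l) l (const_sheaf (line R) _) (@to_slope R s (circle l)) (fun=> m) e'.
  split; [split=> [U p x _ Ux|U V h p x _ Vx|U p g x _ sg Ux]|move=> U p x Ux].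
  - by apply: slope_constant; exact: ea.
  - apply: slope_line; apply: affine_at_ext (e'E _ p _ (h _ Vx)).
    by near=> y; rewrite er //; near: y; exact: near_oset.
  - have := harm_affine_at ((lift_adm (harm_lifted l s) _ _).1 (sg x Ux)) => ag.
    apply: slope_line; rewrite /to_slope (slope_chart ag).
    apply: affine_at_ext (affine_atD (e'E _ p _ Ux) ag).
    by near=> y; rewrite et //; near: y; exact: near_oset.
  have Uxl : U (chart _ (x + l)) by rewrite chart_addl.
  have h1 := affine_at_shift (e'E U p _ Uxl).
  have h2 : affine_at x (fun y => e U p (y + l)) (m + e' U p x).
    apply: affine_at_ext (affine_atD (affine_at_pic_fun x m v) (e'E _ p _ Ux)).
    by near=> y; rewrite ec //; near: y; exact: near_oset.
  exact: affine_at_inj h1 h2.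
have push := pushforwardP l_gt0 (const_lifted l _) to_slope_sec ec'.
split=> [[E /push h1 h2]|<-]; first exact: const_factor_inj h1 h2.
have [|E hE] := factor_realize l_gt0 (const_lifted l (GRing.to_multiplicative 'cV[int]_s)) (c := fun=> m).
  by move=> x; near=> y.
by exists E => //; apply/push.
Unshelve. all: by end_near. Qed.
End PicardFactors.

(** * Factors, determinants and degrees of G-bundles *)

Section BundleFactors.
Variables (R : realType) (l : R) (l_gt0 : 0 < l).
Variables (r : nat) (D : root_datum r) (k : nat) (n : 'I_k -> nat) (tA : typeA D n).
Implicit Types (m mu : 'cV[int]_r) (v a : 'cV[R]_r) (u w : weyl D) (P : bundle l D).

Definition G_factor P m v w := has_automorphy (G_sheaf D (line R)) P (G_fun m v w).

Lemma G_factor_iso P P' m v w : G_factor P m v w -> G_factor P' m v w -> torsor_iso P P'.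
Proof. exact: (iso_of_factor (G_lifted l D)). Qed.

Lemma G_factor_of_iso P P' m v w : torsor_iso P P' -> G_factor P' m v w -> G_factor P m v w.
Proof. exact: factor_of_iso. Qed.

Lemma pic_fun_mul (s : nat) (A : 'M[int]_(s, r)) m v x :
  realmx R A *m pic_fun m v x = pic_fun (A *m m) (realmx R A *m v) x.
Proof. by rewrite /pic_fun mulmxDr -scalemxAr map_mxM. Qed.

Lemma G_fun_conj m v w mu a u x : (u * w = w * u)%g ->
  (G_fun mu a u (x + l) * G_fun m v w x * (G_fun mu a u x)^-1)%g =
  G_fun (u *m m + (mu - w *m mu)) (realmx R u *m v + (a - realmx R w *m a) + l *: realmx R mu) w x.
Proof.
move=> uw.
have uwu : (u * w * u^-1)%g = w by rewrite uw mulgK.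
congr pair; last exact: uwu.
have e1 : realmx R (weyl_mx (u * w)%g) *m (- (realmx R (weyl_mx (u^-1)%g) *m pic_fun mu a x)) =
    - (realmx R w *m pic_fun mu a x).
  by rewrite mulmxN mulmxA -(realmxM R (u * w)%g) uwu.
change (pic_fun mu a (x + l) + realmx R u *m pic_fun m v x +
  realmx R (weyl_mx (u * w)%g) *m (- (realmx R (weyl_mx (u^-1)%g) *m pic_fun mu a x)) =
  pic_fun (u *m m + (mu - w *m mu)) (realmx R u *m v + (a - realmx R w *m a) + l *: realmx R mu) x
  :> 'cV[R]_r).
rewrite e1 !pic_fun_mul /pic_fun !map_mxD map_mxN.
by apply/matrixP => i j; rewrite !mxE; ring.
Qed.

Lemma G_factor_move P m v w mu a u : (u * w = w * u)%g -> G_factor P m v w ->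
  G_factor P (u *m m + (mu - w *m mu))
    (realmx R u *m v + (a - realmx R w *m a) + l *: realmx R mu) w.
Proof.
move=> uw /has_automorphyP[d dc]; apply/has_automorphyP.
exists (fun U p x => (G_fun mu a u x * d U p x)%g).
have := factored_mul (fun x => G_fun_adm mu a u x : adm (G_sheaf D (line R)) x _) dc.
set c' := (X in factored _ _ _ X _).
suff -> : G_fun (u *m m + (mu - w *m mu))
    (realmx R u *m v + (a - realmx R w *m a) + l *: realmx R mu) w = c' by [].
by apply/funext => x; rewrite /c' G_fun_conj.
Qed.

Lemma G_affine_at x (h : R -> tropG D R) : adm (G_sheaf D (line R)) x h ->
  affine_at x (fun y => (h y).1) (Defs.slope (X := line R) (fun y => (h y).1) x).
Proof. by case=> + _; exact: harm_affine_at. Qed.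

Section Determinant.
Variables (s : nat) (Q : 'M[int]_(s, r)) (Q_det : is_det_matrix D Q).

Lemma det_map_sec (x : R) (g : circle l -> tropG D R) : adm (G_sheaf D (circle l)) x g ->
  adm (harm_sheaf (circle l) s) x (det_map Q g).
Proof.
case=> /(lift_adm (harm_lifted l r))/harm_affine_at ha _.
apply/(lift_adm (harm_lifted l s))/harmonicP.
by exists (Q *m Defs.slope (X := line R) (fun y => (g (chart (circle l) y)).1) x); exact: affine_at_mul.
Qed.

Lemma realmx_det_weyl u : realmx R Q *m realmx R u = realmx R Q.
Proof. by rewrite -map_mxM (det_weyl Q_det tA). Qed.

Lemma G_factor_det P m v w (P' : torsor (harm_sheaf (circle l) s)) : G_factor P m v w ->
  is_pushforward (det_map Q) P P' <-> pic_factor P' (Q *m m) (realmx R Q *m v).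
Proof.
move=> /has_automorphyP[d [[da dr dt] dc]].
pose e (U : oset (circle l)) (p : P U) x : GRing.to_multiplicative 'cV[R]_s :=
  realmx R Q *m (d U p x).1.
apply: (pushforwardP l_gt0 (harm_lifted l s) det_map_sec (e := e)).
split; [split=> [U p x _ Ux|U V h p x _ Vx|U p g x _ sg Ux]|move=> U p x Ux].
- apply/harmonicP; exists (Q *m Defs.slope (X := line R) (fun y => (d U p y).1) x).
  by apply: affine_at_mul; apply: G_affine_at; exact: da.
- by rewrite /e dr.
- rewrite /e dt // /det_map.
  change (realmx R Q *m ((d U p x).1 + realmx R (d U p x).2 *m (g (chart _ x)).1) =
    realmx R Q *m (d U p x).1 + realmx R Q *m (g (chart _ x)).1 :> 'cV[R]_s).
  by rewrite mulmxDr mulmxA realmx_det_weyl.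
rewrite /e dc //.
change (realmx R Q *m (pic_fun m v x + realmx R w *m (d U p x).1) =
    pic_fun (Q *m m) (realmx R Q *m v) x + realmx R Q *m (d U p x).1 :> 'cV[R]_s).
by rewrite mulmxDr mulmxA realmx_det_weyl pic_fun_mul.
Qed.
End Determinant.

Lemma pi1_class_eq x y : pi1_class D x = pi1_class D y <-> coroot_lattice D (x - y).
Proof.
rewrite /pi1_class; split=> [/eqP|h].
  by rewrite -Quotient.idealrBE.
by apply/eqP; rewrite -Quotient.idealrBE.
Qed.

Lemma pi1_classD x y : pi1_class D (x + y) = pi1_class D x + pi1_class D y.
Proof. exact: (raddfD (\pi_(pi1 D))%qT). Qed.

(** The slope of h h' is that of h plus u times that of h', with u the locally constant Weyl part; u
    is trivial modulo coroots. *)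
Lemma to_pi1_slope (x : R) (h h' : R -> tropG D R) :
  adm (G_sheaf D (line R)) x h -> adm (G_sheaf D (line R)) x h' ->
  pi1_class D (Defs.slope (X := line R) (fun y => (h y * h' y)%g.1) x) =
  pi1_class D (Defs.slope (X := line R) (fun y => (h y).1) x) +
  pi1_class D (Defs.slope (X := line R) (fun y => (h' y).1) x).
Proof.
move=> ah ah'; have [_ lc] := ah; have sh := G_affine_at ah; have sh' := G_affine_at ah'.
have e : \forall y \near x, (h y).1 + realmx R (h x).2 *m (h' y).1 = (h y * h' y)%g.1.
  by apply: filterS lc => y <-.
rewrite (slope_line (affine_at_ext e (affine_atD sh (affine_at_mul (h x).2 sh')))).
rewrite pi1_classD; congr (_ + _); apply/pi1_class_eq; exact: (weyl_sub_lattice tA (h x).2).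
Qed.

Lemma to_pi1_sec (x : R) (g : circle l -> tropG D R) : adm (G_sheaf D (circle l)) x g ->
  adm (const_sheaf (circle l) (GRing.to_multiplicative (pi1 D))) x (to_pi1 g).
Proof.
case=> ha _; have := to_slope_sec ha; apply: filterS => y e.
by rewrite /to_pi1; congr pi1_class; exact: e.
Qed.

Lemma G_factor_degree P m v w lam : G_factor P m v w ->
  has_degree P lam <-> pi1_class D m = lam.
Proof.
move=> /has_automorphyP[d [[da dr dt] dc]].
pose e (U : oset (circle l)) (p : P U) x : GRing.to_multiplicative (pi1 D) :=
  pi1_class D (Defs.slope (X := line R) (fun y => (d U p y).1) x).
have sext (x : R) (h h' : R -> tropG D R) : adm (G_sheaf D (line R)) x h ->
    (\forall y \near x, h y = h' y) ->
    Defs.slope (X := line R) (fun y => (h' y).1) x = Defs.slope (X := line R) (fun y => (h y).1) x.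
  move=> ah hh'; apply: slope_line; apply: affine_at_ext (G_affine_at ah).
  by apply: filterS hh' => y ->.
have ec : factored (Y := circle l) l (const_sheaf (line R) _) (@to_pi1 R r D (circle l))
    (fun=> pi1_class D m) e.
  split; [split=> [U p x _ Ux|U V h p x _ Vx|U p g x _ sg Ux]|move=> U p x Ux].
  - have [ha _] := da U p x I Ux.
    by have := slope_constant ha; apply: filterS => y ey; congr pi1_class.
  - congr pi1_class; apply: sext; first by apply: da => //; exact: h.
    by near=> y; rewrite dr //; near: y; exact: near_oset.
  - have ag := (lift_adm (G_lifted l D) _ _).1 (sg x Ux).
    have -> : to_pi1 g (chart (circle l) x) =
        pi1_class D (Defs.slope (X := line R) (fun y => (g (chart (circle l) y)).1) x).
      by congr pi1_class; apply: slope_chart; exact: (G_affine_at ag).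
    rewrite -[RHS](to_pi1_slope (da U p x I Ux) ag); congr pi1_class.
    apply: sext; first exact: admM (da U p x I Ux) ag.
    by near=> y; rewrite dt //; near: y; exact: near_oset.
  have Uxl : U (chart _ (x + l)) by rewrite chart_addl.
  have h1 := affine_at_shift (G_affine_at (da U p _ I Uxl)).
  have ac := G_fun_adm m v w x.
  have := to_pi1_slope ac (da U p x I Ux).
  rewrite (slope_line (affine_at_pic_fun x m v)) => e1; rewrite -[RHS]e1.
  congr pi1_class; rewrite -(slope_line h1).
  apply: (sext x (fun y => G_fun m v w y * d U p y)%g); first exact: admM ac (da U p x I Ux).
  by near=> y; rewrite dc //; near: y; exact: near_oset.
have push := pushforwardP l_gt0 (const_lifted l _) to_pi1_sec ec.
split=> [[E /push h1 h2]|<-]; first exact: const_factor_inj h1 h2.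
have [|E hE] := factor_realize l_gt0 (const_lifted l (GRing.to_multiplicative (pi1 D)))
    (c := fun=> pi1_class D m).
  by move=> x; near=> y.
by exists E => //; apply/push.
Unshelve. all: by end_near. Qed.
End BundleFactors.

(** * Framed bundles and their reductions *)

Section FramedBundles.
Variables (R : realType) (l : R) (l_gt0 : 0 < l).
Variables (r : nat) (D : root_datum r).

Lemma to_W_sec (l1 : R) (x : R) (g : circle l1 -> tropG D R) :
  adm (G_sheaf D (circle l1)) x g -> adm (const_sheaf (circle l1) (weyl D)) x (to_W g).
Proof. by case. Qed.

Lemma snd_factored (l1 : R) (P : bundle l1 D) m v u
    (d : forall U : oset (circle l1), P U -> R -> tropG D R) :
  factored (Y := circle l1) l1 (G_sheaf D (line R)) id (G_fun m v u) d ->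
  factored (Y := circle l1) l1 (const_sheaf (line R) (weyl D)) (@to_W R r D (circle l1)) (fun=> u)
    (fun U p x => (d U p x).2).
Proof.
move=> [[da dr dt] dc]; split; [split=> [U p x _ Ux|U V h p x _ Vx|U p g x _ sg Ux]|].
- by have [] := da U p x I Ux.
- by rewrite dr.
- by rewrite dt.
- by move=> U p x Ux; rewrite dc.
Qed.

Variables (w : weyl D) (ind : W_torsor D (circle l)).
Variable dl : forall U : oset (circle l), ind U -> R -> weyl D.
Hypothesis dlw : factored (Y := circle l) l (const_sheaf (line R) (weyl D)) id (fun=> w) dl.

Definition framed_triv (P : framed ind) m v
    (d : forall U : oset (circle l), fbundle P U -> R -> tropG D R) :=
  factored (Y := circle l) l (G_sheaf D (line R)) id (G_fun m v w) d /\
  forall (U : oset (circle l)) p x, U (chart _ x) ->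
    (d U p x).2 = dl (framing P U U (@subset_refl _ U) p) x.

Definition framed_factor (P : framed ind) m v := exists d, @framed_triv P m v d.

Lemma framed_G_factor P m v : framed_factor P m v -> G_factor (fbundle P) m v w.
Proof. by move=> [d [dc _]]; apply/has_automorphyP; exists d. Qed.

(** The Weyl part of any trivialization differs from the one transported from [ind] by a constant b
    0. Multiplying by (0, b 0) matches the framing and turns the Weyl part of the factor into w. *)
Lemma framed_factor_exists P : exists m v, framed_factor P m v.
Proof.
have [c0 [d0 [ac0 dc0]]] := factor_exists l_gt0 (G_lifted l D) (fbundle P).
have [m0 [v0 [u ec0]]] := G_line ac0.
have [e ee eE] := factored_of_tmor (f := id) (fun=> erefl) (@to_W_sec l) (framing P)
    (fun U => @oset_open _ _ U) dlw.
rewrite ec0 in dc0.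
have [b [ab be bc]] := compare_factored (@chart_addl _ l) (snd_factored dc0) ee.
have eb := locally_constant_line ab.
pose g := @G_fun R r D 0 0 (b 0).
have ag x : adm (G_sheaf D (line R)) x g by exact: G_fun_adm.
have dc := factored_mul ag dc0.
have [m1 [v1 [w1 ec1]]] : exists m v w', (fun x => g (x + l) * G_fun m0 v0 u x * (g x)^-1)%g = G_fun m v w'.
  apply: G_line => x; apply: admM (admM _ (G_fun_adm m0 v0 u x)) (admV (ag x)).
  exact: (lift_shift (G_lifted l D)).
have ew1 : w1 = w.
  have := congr1 (fun h : R -> tropG D R => (h 0).2) ec1 => /= <-.
  have := bc 0; rewrite add0r (eb l) => e1.
  change (b 0 * u * (b 0)^-1 = w)%g.
  by rewrite e1 mulgK.
rewrite ec1 ew1 in dc.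
exists m1, v1, (fun U p x => g x * d0 U p x)%g; split=> // U p x Ux.
rewrite eE // be // (eb x) //.
Qed.

Lemma framed_iso_of_factor P P' m v :
  framed_factor P m v -> framed_factor P' m v -> framed_iso P P'.
Proof.
move=> [d [dc df]] [d' [dc' df']].
have [mm [mb mE]] := iso_of_factored (G_lifted l D) dc dc'.
exists mm => // U p; apply: (eq_section dlw) => x Ux.
by rewrite -df' // mE // df.
Qed.

Lemma framed_factor_of_iso P P' m v :
  framed_iso P P' -> framed_factor P' m v -> framed_factor P m v.
Proof.
move=> [mm _ mf] [d [dc df]].
have sec (x : R) (g : circle l -> tropG D R) : adm (G_sheaf D (circle l)) x g ->
  adm (G_sheaf D (circle l)) x (id g) by [].
have [e ee eE] := factored_of_tmor (f := id) (fun=> erefl) sec mm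
  (fun U => @oset_open _ _ U) dc.
by exists e; split=> // U p x Ux; rewrite -(eE U U (@subset_refl _ U)) // df // mf.
Qed.

Lemma framed_iso_refl (P : framed ind) : framed_iso P P.
Proof.
by have [m [v Pf]] := framed_factor_exists P; exact: (framed_iso_of_factor Pf).
Qed.

Lemma framed_iso_sym (P P' : framed ind) : framed_iso P P' -> framed_iso P' P.
Proof.
have [m [v Pf]] := framed_factor_exists P' => PP'.
exact: framed_iso_of_factor Pf (framed_factor_of_iso PP' Pf).
Qed.

Lemma framed_iso_trans (P P' P'' : framed ind) : framed_iso P P' -> framed_iso P' P'' -> framed_iso P P''.
Proof.
have [m [v Pf]] := framed_factor_exists P'' => h1 h2.
exact: framed_iso_of_factor (framed_factor_of_iso h1 (framed_factor_of_iso h2 Pf)) Pf.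
Qed.

Lemma framed_realize m v : exists P, framed_factor P m v.
Proof.
have [P0 /has_automorphyP[d dc]] := factor_realize l_gt0 (G_lifted l D)
  (fun x => G_fun_adm m v w x : adm (G_sheaf D (line R)) x _).
have [fr frE] := tmor_of_factored (f := id) (const_lifted l (weyl D)) (fun=> erefl)
  (@to_W_sec l) dlw (snd_factored dc).
by exists (Framed fr), d; split=> // U p x Ux; rewrite frE.
Qed.

End FramedBundles.

(** * Iterated factors and pullback along the cover *)

Section Iteration.
Variables (R : realType) (l : R) (r : nat) (D : root_datum r) (w : weyl D).

(* iter_factor of (v + x m, w) is (x S_n m + S_n v + l T_n m, w^n). *)
Fixpoint iter_slope (n : nat) : 'M[int]_r :=
  if n is n'.+1 then 1%:M + w *m iter_slope n' else 0.

Fixpoint iter_shift (n : nat) : 'M[int]_r :=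
  if n is n'.+1 then n'%:R%:M + w *m iter_shift n' else 0.

Lemma iter_G_fun m v n x : iter_factor l (@G_fun R r D m v w) n x =
  G_fun (iter_slope n *m m)
    (realmx R (iter_slope n) *m v + l *: realmx R (iter_shift n *m m))
    (iter_factor l (fun=> w) n x) x.
Proof.
elim: n => [|n IH].
  rewrite /G_fun /pic_fun /= !map_mx0 !mul0mx !map_mx0 !scaler0 !addr0.
  by [].
rewrite [LHS]/= IH; congr pair.
change (pic_fun m v (x + n%:R * l) + realmx R w *m pic_fun (iter_slope n *m m)
    (realmx R (iter_slope n) *m v + l *: realmx R (iter_shift n *m m)) x =
  pic_fun (iter_slope n.+1 *m m)
    (realmx R (iter_slope n.+1) *m v + l *: realmx R (iter_shift n.+1 *m m)) x :> 'cV[R]_r).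
rewrite pic_fun_mul /pic_fun /= !mulmxDl !mul1mx mul_scalar_mx !map_mxD map_mx1 map_mxZ.
rewrite !mulmxDl mul1mx !mulmxDr -!scalemxAr !mulmxA -!map_mxM !mulmxA.
by apply/matrixP => i j; rewrite !mxE; ring.
Qed.

Lemma det_iter_slope s (Q : 'M[int]_(s, r)) n : Q *m w = Q -> Q *m iter_slope n = n%:R *: Q.
Proof.
move=> Qw; elim: n => [|n IH] /=; first by rewrite mulmx0 scale0r.
by rewrite mulmxDr mulmx1 mulmxA Qw IH mulrS scalerDl scale1r.
Qed.

Lemma det_iter_shift s (Q : 'M[int]_(s, r)) n : Q *m w = Q ->
  exists c : int, Q *m iter_shift n = c *: Q.
Proof.
move=> Qw; elim: n => [|n [c IH]] /=; first by exists 0; rewrite mulmx0 scale0r.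
by exists (n%:R + c); rewrite mulmxDr mulmxA Qw IH mul_mx_scalar scalerDl.
Qed.
End Iteration.

Section Covering.
Variables (R : realType) (l : R) (N : nat).
Local Notation l' := (N%:R * l).
Local Notation f := (@circle_cover R l N).

Lemma cover_chart x : f (chart (circle l') x) = chart (circle l) x.
Proof.
have /chart_eqP[n e] := esym (chart_repr (chart (circle l') x)).
apply/esym/chart_eqP; exists (n * N%:Z); rewrite [LHS]e intrM -pmulrn; ring.
Qed.

Lemma cover_open (U : oset (circle l)) : open (chart (circle l') @^-1` (f @^-1` U)).
Proof.
suff -> : chart (circle l') @^-1` (f @^-1` U) = chart (circle l) @^-1` U by exact: oset_open.
by apply/seteqP; split=> x /=; rewrite cover_chart.
Qed.

Lemma chart_cover_period x : chart (circle l) (x + l') = chart (circle l) x.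
Proof. by rewrite -[N%:R]/((N%:Z)%:~R) chart_addz. Qed.

(** The cover is the identity on universal covers, so the same d serves; its period is N l and its
    factor the N-fold iterate. *)
Lemma factored_cover (F : groupType) (G : gsheaf (circle l) F) (L : gsheaf (line R) F)
    (P : torsor G) c (d : forall U : oset (circle l), P U -> R -> F) :
  factored (Y := circle l) l L id c d ->
  factored (Y := circle l') l' L (fun g => g \o f) (iter_factor l c N) d.
Proof.
move=> [[da dr dt] dc]; split; [split=> // U p g x _ sg Ux|move=> U p x Ux].
  by rewrite /= cover_chart; exact: dt.
elim: N => [|n IH]; first by rewrite mul0r addr0 mul1g.
have -> : x + n.+1%:R * l = x + n%:R * l + l by rewrite mulrS; ring.
rewrite dc; first by rewrite IH mulgA.
by rewrite -[n%:R]/((n%:Z)%:~R) chart_addz.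
Qed.
End Covering.

Section Reduction.
Variables (R : realType) (l : R) (l_gt0 : 0 < l) (N : nat) (N_gt0 : (0 < N)%N).
Variables (r : nat) (D : root_datum r).
Variables (w : weyl D) (ind : W_torsor D (circle l)).
Variable dl : forall U : oset (circle l), ind U -> R -> weyl D.
Hypothesis dlw : factored (Y := circle l) l (const_sheaf (line R) (weyl D)) id (fun=> w) dl.
Local Notation l' := (N%:R * l).
Local Notation f := (@circle_cover R l N).
Variables (ind' : W_torsor D (circle l')) (pull : tmor f (fun g => g \o f) ind ind').
Variable triv : ind' (ofull _).

Let l'_gt0 : 0 < l'. Proof. by rewrite mulr_gt0 // ltr0n. Qed.

Lemma pull_W_sec (x : R) (g : circle l -> weyl D) :
  adm (const_sheaf (circle l) (weyl D)) x g ->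
  adm (const_sheaf (circle l') (weyl D)) x (g \o f).
Proof.
apply: filterS => y e; rewrite /= !cover_chart; exact: e.
Qed.

Lemma pull_G_sec (x : R) (g : circle l -> tropG D R) :
  adm (G_sheaf D (circle l)) x g -> adm (G_sheaf D (circle l')) x (g \o f).
Proof.
move=> h; apply/(lift_adm (G_lifted l' D)).
have -> : (g \o f) \o chart (circle l') = g \o chart (circle l).
  by apply/funext => y; rewrite /= cover_chart.
exact/(lift_adm (G_lifted l D)).
Qed.

Lemma incl_mod_sec (x : R) (g : circle l' -> GRing.to_multiplicative 'cV[R]_r) :
  adm (harm_sheaf (circle l') r) x g -> adm (G_sheaf D (circle l')) x (incl_mod D g).
Proof. by move=> ag; split=> //; near=> y. Unshelve. all: by end_near. Qed.

(** Normalize a trivialization of [ind'] so that [triv] has value 1. A global section forces the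
    factor to be 1; comparison with the pullback of [ind] leaves a constant t and yields w^N = 1. *)
Lemma trivialized_pull : exists (dl' : forall V : oset (circle l'), ind' V -> R -> weyl D) (t : weyl D),
  [/\ factored (Y := circle l') l' (const_sheaf (line R) (weyl D)) id (fun=> 1%g) dl',
    forall (V : oset (circle l')) x, V (chart _ x) ->
      dl' V (tres (U := ofull _) (@subsetT _ V) triv) x = 1%g,
    forall (U : oset (circle l)) (V : oset (circle l')) (h : V `<=` f @^-1` U) p x,
      V (chart _ x) -> dl' V (pull U V h p) x = (t * dl p x)%g
    & forall x, iter_factor l (fun=> w) N x = 1%g].
Proof.
have [c' [d' [ac' dc']]] := factor_exists l'_gt0 (const_lifted l' (weyl D)) ind'.
have [[da' dr' _] dl1] := dc'.
pose t0 := d' (ofull _) triv.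
have t0E x : t0 x = t0 0 by apply: locally_constant_line => y; exact: da'.
have ec' x : c' x = 1%g.
  have := dl1 (ofull _) triv x I; rewrite -/t0 t0E [in RHS]t0E -{1}[t0 0]mul1g.
  by move/mulIg.
have acst (b : weyl D) x : adm (const_sheaf (line R) (weyl D)) x (fun=> b) by near=> y.
pose dl' V (q : ind' V) x := ((t0 0)^-1 * d' V q x)%g.
have fdl' : factored (Y := circle l') l' (const_sheaf (line R) (weyl D)) id (fun=> 1%g) dl'.
  have := factored_mul (acst (t0 0)^-1%g) dc'.
  set c1 := (X in factored _ _ _ X _); suff -> : c1 = (fun=> 1%g) by [].
  by apply/funext => x; rewrite /c1 ec' mulg1 mulgV.
have [e ee eE] := factored_of_tmor (@cover_chart R l N) pull_W_sec pull
  (@cover_open R l N) fdl'.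
have [b [ab be bc]] := compare_factored (@chart_cover_period R l N) (factored_cover N dlw) ee.
have b0 := locally_constant_line ab.
exists dl', (b 0); split=> //.
- move=> V x Vx; rewrite /dl' dr' // -/t0 t0E mulVg //.
- move=> U V h p x Vx; rewrite (eE U V h p x Vx) be ?b0 // -(@cover_chart R l N).
  exact: (h _ Vx).
- by move=> x; have := bc x; rewrite b0 [in RHS]b0 mul1g -{2}[b 0]mulg1 => /mulgI.
Unshelve. all: by end_near. Qed.

Section Trivialized.
Variable dl' : forall V : oset (circle l'), ind' V -> R -> weyl D.
Variable t : weyl D.
Hypothesis dl'1 :
  factored (Y := circle l') l' (const_sheaf (line R) (weyl D)) id (fun=> 1%g) dl'.
Hypothesis dl'triv : forall (V : oset (circle l')) x, V (chart _ x) ->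
  dl' (tres (U := ofull _) (@subsetT _ V) triv) x = 1%g.
Hypothesis dl'pull : forall (U : oset (circle l)) (V : oset (circle l')) (h : V `<=` f @^-1` U) p x,
  V (chart _ x) -> dl' (pull U V h p) x = (t * dl p x)%g.
Hypothesis wN : forall x, iter_factor l (fun=> w) N x = 1%g.

Definition red_slope m : 'cV[int]_r := t *m (iter_slope w N *m m).
Definition red_value (m : 'cV[int]_r) (v : 'cV[R]_r) : 'cV[R]_r :=
  realmx R t *m (realmx R (iter_slope w N) *m v + l *: realmx R (iter_shift w N *m m)).

Lemma iter_GN m v : iter_factor l (@G_fun R r D m v w) N = G_fun (iter_slope w N *m m)
    (realmx R (iter_slope w N) *m v + l *: realmx R (iter_shift w N *m m)) 1%g.
Proof. by apply/funext => x; rewrite iter_G_fun wN. Qed.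

(** The pullback P' has the iterated factor, with trivial Weyl part. Sections of Q map to sections
    with Weyl part t^-1, since they lie over [triv]; applying t to their vector part trivializes
    Q. *)
Lemma reduction_factor (P : framed ind) m v (Q : torsor (harm_sheaf (circle l') r)) :
  framed_factor w dl P m v -> is_reduction pull triv P Q ->
  pic_factor Q (red_slope m) (red_value m v).
Proof.
move=> [d [dc df]] [P' [b [s [i [bs si]]]]].
have [c1 [d1 [_ dc1]]] := factor_exists l'_gt0 (G_lifted l' D) P'.
have [e1 ee1 e1E] := factored_of_tmor (@cover_chart R l N) pull_G_sec b (@cover_open R l N) dc1.
have [b0 [ab0 b0e b0c]] := compare_factored (@chart_cover_period R l N) ee1 (factored_cover N dc).
pose d2 V (p : P' V) x := (b0 x * d1 V p x)%g.
set M := iter_slope w N *m m.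
set V0 := realmx R (iter_slope w N) *m v + l *: realmx R (iter_shift w N *m m).
have dc2 : factored (Y := circle l') l' (G_sheaf D (line R)) id (G_fun M V0 1%g) d2.
  have := factored_mul ab0 dc1.
  set c2 := (X in factored _ _ _ X _); suff -> : c2 = G_fun M V0 1%g by [].
  by apply/funext => x; rewrite /c2 b0c mulgK iter_GN.
have d2b (U : oset (circle l)) (V : oset (circle l')) (h : V `<=` f @^-1` U) p x : V (chart _ x) ->
    d2 V (b U V h p) x = d U p x.
  move=> Vx; rewrite /d2 (e1E U V h p x Vx) -b0e // -(@cover_chart R l N); exact: (h _ Vx).
have [es ees esE] := factored_of_tmor (f := id) (fun=> erefl) (@to_W_sec R r D l') s
  (fun U => @oset_open _ _ U) dl'1.
have [bt [abt bte _]] := compare_factored (@chart_addl _ l') (snd_factored dc2) ees.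
have sE (V : oset (circle l')) (q : P' V) x : V (chart _ x) -> dl' (s V V (@subset_refl _ V) q) x = (t * (d2 V q x).2)%g.
  move=> Vx; rewrite (esE V V (@subset_refl _ V) q x Vx) bte // (locally_constant_line abt).
  congr (_ * _)%g.
  (* The constant comparing the two Weyl trivializations is identified as t by testing one pulled
     back section at 0. *)
  have [U Ux [p]] := tnonempty (fbundle P) (chart _ 0).
  pose V1 := OSet (@cover_open R l N U).
  have V1x : V1 (chart _ 0) by rewrite /V1 /omem /= /preimage /= cover_chart.
  have := dl'pull (U := U) (V := V1) (@subset_refl _ _) (framing P U U (@subset_refl _ U) p) V1x.
  rewrite -bs (esE V1 V1 _ _ _ V1x) bte // d2b // df // => /mulIg.
  by [].
have [e3 [[ea3 er3 et3] ec3] e3E] := factored_of_tmor (f := id) (fun=> erefl)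
  incl_mod_sec i (fun U => @oset_open _ _ U) dc2.
have e3t (V : oset (circle l')) (q : Q V) x : V (chart _ x) -> (t * (e3 V q x).2)%g = 1%g.
  move=> Vx; rewrite -(e3E V V (@subset_refl _ V) q x Vx) -sE // si; exact: dl'triv.
have e3t' (V : oset (circle l')) (q : Q V) x : V (chart _ x) ->
    realmx R t *m realmx R (e3 V q x).2 = 1%:M.
  by move=> Vx; rewrite -(realmxM R t) e3t // realmx1.
pose e4 (V : oset (circle l')) (q : Q V) x : GRing.to_multiplicative 'cV[R]_r :=
  realmx R t *m (e3 V q x).1.
apply/has_automorphyP; exists e4.
split; [split=> [U q x _ Ux|U V h q x _ Vx|U q g x _ sg Ux]|move=> U q x Ux].
- by apply/harmonicP; exists (t *m Defs.slope (X := line R) (fun y => (e3 U q y).1) x);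
    apply: affine_at_mul; apply: G_affine_at; exact: ea3.
- by rewrite /e4 er3.
- rewrite /e4 et3 //.
  change (realmx R t *m ((e3 U q x).1 + realmx R (e3 U q x).2 *m g (chart _ x)) =
    realmx R t *m (e3 U q x).1 + g (chart _ x) :> 'cV[R]_r).
  by rewrite mulmxDr mulmxA e3t' // mul1mx.
rewrite /e4 ec3 //.
change (realmx R t *m (pic_fun M V0 x + realmx R (weyl_mx (1%g : weyl D)) *m (e3 U q x).1) =
  pic_fun (red_slope m) (red_value m v) x + realmx R t *m (e3 U q x).1 :> 'cV[R]_r).
by rewrite realmx1 mul1mx mulmxDr pic_fun_mul.
Qed.

(** P', Q and the three maps between them are built from their factors; the Weyl part t^-1 given to
    sections of Q is what sends them to [triv]. *)
Lemma reduction_exists (P : framed ind) m v : framed_factor w dl P m v ->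
  exists Q : torsor (harm_sheaf (circle l') r), is_reduction pull triv P Q.
Proof.
move=> [d [dc df]].
set M := iter_slope w N *m m.
set V0 := realmx R (iter_slope w N) *m v + l *: realmx R (iter_shift w N *m m).
have [P' /has_automorphyP[d1 dc1]] := factor_realize l'_gt0 (G_lifted l' D)
  (fun x => G_fun_adm M V0 1%g x : adm (G_sheaf D (line R)) x _).
have dcN : factored (Y := circle l') l' (G_sheaf D (line R)) (fun g => g \o f)
    (G_fun M V0 1%g) d.
  by rewrite /M /V0 -iter_GN; exact: factored_cover.
have [b bE] := tmor_of_factored (G_lifted l' D) (@cover_chart R l N) pull_G_sec dc1 dcN.
have acst (u : weyl D) x : adm (const_sheaf (line R) (weyl D)) x (fun=> u) by near=> y.
have es : factored (Y := circle l') l' (const_sheaf (line R) (weyl D)) (@to_W R r D (circle l'))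
    (fun=> 1%g) (fun U p x => t * (d1 U p x).2)%g.
  have := factored_mul (acst t) (snd_factored dc1).
  set c1 := (X in factored _ _ _ X _); suff -> : c1 = (fun=> 1%g) by [].
  by apply/funext => x; rewrite /c1 mulg1 mulgV.
have [s sE] := tmor_of_factored (f := id) (const_lifted l' (weyl D)) (fun=> erefl)
  (@to_W_sec R r D l') dl'1 es.
have [Q /has_automorphyP[dQ [[aQ rQ tQ] cQ]]] := pic_factor_realize l'_gt0 (red_slope m) (red_value m v).
have tV : realmx R (weyl_mx (t^-1)%g) *m realmx R t = 1%:M by rewrite -(realmxM R (t^-1)%g) mulVg realmx1.
have ei : factored (Y := circle l') l' (G_sheaf D (line R)) (@incl_mod R r D (circle l'))
    (G_fun M V0 1%g)
    (fun U q x => (realmx R (weyl_mx (t^-1)%g) *m (dQ U q x : 'cV[R]_r), (t^-1)%g) : tropG D R).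
  split; [split=> [U q x _ Ux|U V h q x _ Vx|U q g x _ sg Ux]|move=> U q x Ux].
  - split; last exact: acst.
    apply/harmonicP; exists (weyl_mx (t^-1)%g *m Defs.slope (X := line R) (dQ U q) x).
    by apply: affine_at_mul; apply: harm_affine_at; exact: aQ.
  - by rewrite rQ.
  - rewrite tQ //; congr pair; last by rewrite mulg1.
    exact: mulmxDr.
  rewrite cQ //; congr pair; last by rewrite mul1g.
  change (realmx R (weyl_mx (t^-1)%g) *m (pic_fun (red_slope m) (red_value m v) x + dQ U q x) =
    pic_fun M V0 x + realmx R (weyl_mx (1%g : weyl D)) *m
      (realmx R (weyl_mx (t^-1)%g) *m (dQ U q x : 'cV[R]_r))).
  rewrite mulmxDr realmx1 mul1mx; congr (_ + _).
  by rewrite -[pic_fun _ _ x](pic_fun_mul (weyl_mx t)) mulmxA tV mul1mx.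
have [i iE] := tmor_of_factored (f := id) (G_lifted l' D) (fun=> erefl) incl_mod_sec dc1 ei.
exists Q, P', b, s, i; split=> [U V h p|V q]; apply: (eq_section dl'1) => x Vx.
  have Ux : U (chart (circle l) x) by rewrite -(@cover_chart R l N); exact: (h _ Vx).
  by rewrite sE // bE // dl'pull // df.
by rewrite sE // iE //= mulgV dl'triv.
Unshelve. all: by end_near. Qed.
End Trivialized.
End Reduction.

(** * The determinant *)

Lemma open_affine (R : realType) (p q : nat) (A : 'M[R]_(q, p)) (b : 'cV[R]_q) (O : set 'cV[R]_q) :
  open O -> open [set v : 'cV[R]_p | O (A *m v + b)].
Proof.
rewrite !openE => oO v /= /oO /nbhs_ballP[e /= e0 he].
(* The added 1 keeps K positive when A is 0 and gives the strict inequality below. *)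
pose K : R := 1 + \sum_i \sum_j `|A i j|.
have K0 : 0 < K by rewrite ltr_pwDl // sumr_ge0 // => i _; rewrite sumr_ge0.
apply/nbhs_ballP; exists (e / K) => /= [|y [_ vy]]; first by rewrite divr_gt0.
apply: he; split=> // i j; rewrite /ball /= !mxE opprD addrACA subrr addr0 -sumrB.
rewrite -[e](divfK (lt0r_neq0 K0)) mulrC.
apply: (@le_lt_trans _ _ ((\sum_i \sum_j `|A i j|) * (e / K))); last first.
  by rewrite ltr_pM2r ?divr_gt0 // ltrDr.
apply: (@le_trans _ _ (\sum_k `|A i k| * (e / K))); last first.
  rewrite -mulr_suml ler_pM2r ?divr_gt0 //.
  by rewrite [leRHS](bigD1 i) //= lerDl sumr_ge0 // => i' _; rewrite sumr_ge0.
apply: le_trans (ler_norm_sum _ _ _) _; apply: ler_sum => k' _.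
rewrite -mulrBr normrM ler_wpM2l //; apply/ltW; have := vy k' j.
by rewrite /ball.
Qed.

Lemma cover_degree_gt0 (k : nat) (n : 'I_k -> nat) : (forall i, (0 < n i)%N) ->
  (0 < cover_degree n)%N.
Proof.
move=> n0; rewrite /cover_degree; apply: (big_ind (fun m => 0 < m)%N) => //.
by move=> a b a0 b0; rewrite lcmn_gt0 a0.
Qed.

Lemma coxeter_acts (r : nat) (D : root_datum r) (k : nat) (n : 'I_k -> nat) (tA : typeA D n)
    (w : weyl D) : is_coxeter tA w -> exists sigma : {perm {i : 'I_k & 'I_(n i)}},
  acts tA w sigma /\ forall e e', tag e = tag e' -> e' \in porbit sigma e.
Proof.
move=> [sigma [st sr so]]; exists sigma; split=> //; split=> // s t /(pair_case tA).
case=> [->|[j [-> ->]]]; first by rewrite !root_at_diag mul0mx.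
by have [j' [<- <- e]] := sr j; rewrite !root_atE.
Qed.

Lemma scale_nat_inj (p q N : nat) (A B : 'M[int]_(p, q)) : (0 < N)%N ->
  N%:Z *: A = N%:Z *: B -> A = B.
Proof.
move=> N0 /matrixP e; apply/matrixP => i j; have := e i j; rewrite !mxE.
by apply: mulfI; rewrite eqz_nat -lt0n.
Qed.

(** * Bijectivity and continuity of the determinant in both directions *)

Section Main.
Variables (R : realType) (l : R) (l_gt0 : 0 < l).
Variables (r : nat) (D : root_datum r) (k : nat) (n : 'I_k -> nat) (tA : typeA D n).
Variables (w : weyl D) (sigma : {perm {i : 'I_k & 'I_(n i)}}).
Hypothesis aw : acts tA w sigma.
Hypothesis sigma_trans : forall e e' : {i : 'I_k & 'I_(n i)}, tag e = tag e' ->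
  e' \in porbit sigma e.
Variable ind : W_torsor D (circle l).
Variable dl : forall U : oset (circle l), ind U -> R -> weyl D.
Hypothesis dlw : factored (Y := circle l) l (const_sheaf (line R) (weyl D)) id (fun=> w) dl.
Variables (s : nat) (Q : 'M[int]_(s, r)) (Q_det : is_det_matrix D Q).

Local Notation H1G := (H1 (G_sheaf D (circle l))).
Local Notation H1T := (H1 (harm_sheaf (circle l) s)).
Local Notation cls := (class_of (@torsor_iso R _ _ _)).

Let G_lift := G_lifted l D.
Let harm_lift := harm_lifted l s.

Lemma G_class_eq (P P' : bundle l D) :
  class_of (@torsor_iso _ _ _ _) P = class_of _ P' <-> torsor_iso P P'.
Proof.
split; first exact: (class_of_inj (torsor_iso_refl l_gt0 G_lift)).
exact: (class_of_eq (torsor_iso_sym l_gt0 G_lift) (torsor_iso_trans l_gt0 G_lift)).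
Qed.

Lemma pic_class_eq (l1 : R) (s1 : nat) (P P' : torsor (harm_sheaf (circle l1) s1)) : 0 < l1 ->
  class_of (@torsor_iso _ _ _ _) P = class_of _ P' <-> torsor_iso P P'.
Proof.
move=> l1_gt0; have HL1 := harm_lifted l1 s1.
split; first exact: (class_of_inj (torsor_iso_refl l1_gt0 HL1)).
exact: (class_of_eq (torsor_iso_sym l1_gt0 HL1) (torsor_iso_trans l1_gt0 HL1)).
Qed.

Lemma framed_class_eq (P P' : framed ind) :
  class_of (@framed_iso _ _ _ _ _) P = class_of _ P' <-> framed_iso P P'.
Proof.
split; first exact: (class_of_inj (framed_iso_refl l_gt0 dlw)).
exact: (class_of_eq (framed_iso_sym l_gt0 dlw) (framed_iso_trans l_gt0 dlw)).
Qed.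

Lemma det_exists (c : H1G) : exists y : H1T, forall (P : bundle l D) P',
  in_class c P -> (in_class y P' <-> is_pushforward (det_map Q) P P').
Proof.
have [P0 ->] := class_nonempty c.
have [c0 ac0 hP0] := has_factor l_gt0 G_lift P0.
have [m [v [u ec0]]] := G_line ac0; rewrite ec0 in hP0.
have [P1 hP1] := pic_factor_realize l_gt0 (Q *m m) (realmx R Q *m v).
exists (class_of _ P1) => P P' PP0.
have hP : G_factor P m v u.
  by apply: G_factor_of_iso hP0; exact: (torsor_iso_sym l_gt0 G_lift PP0).
rewrite (G_factor_det l_gt0 tA Q_det P' hP); split=> [P1P'|hP'].
  by apply: pic_factor_of_iso hP1; exact: (torsor_iso_sym l_gt0 harm_lift P1P').
exact: pic_factor_iso hP1 hP'.
Qed.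

Definition det_H1 (c : H1G) : H1T := sval (cid (det_exists c)).

Lemma det_H1P (c : H1G) (P : bundle l D) P' :
  in_class c P -> (in_class (det_H1 c) P' <-> is_pushforward (det_map Q) P P').
Proof. exact: (svalP (cid (det_exists c))). Qed.

Lemma det_H1_factor (P : bundle l D) m v u P' : G_factor P m v u ->
  pic_factor P' (Q *m m) (realmx R Q *m v) -> det_H1 (class_of _ P) = class_of _ P'.
Proof.
move=> hP hP'; apply: (in_class_of (torsor_iso_sym l_gt0 harm_lift) (torsor_iso_trans l_gt0 harm_lift)).
apply/(det_H1P (P := P)); first exact: (torsor_iso_refl l_gt0 G_lift P).
exact/(G_factor_det l_gt0 tA Q_det P' hP).
Qed.

Variable lam : pi1 D.
Hypothesis lam_stable : stable tA lam.
Local Notation deg := (det_pi1 Q lam).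

Lemma pi1_lift : pi1_class D (repr lam) = lam.
Proof. exact: reprK. Qed.

Lemma det_degree m : pi1_class D m = lam -> Q *m m = deg.
Proof.
rewrite -{1}pi1_lift => /pi1_class_eq /(det_lattice Q_det); rewrite mulmxBr => /eqP.
by rewrite subr_eq0 => /eqP.
Qed.

(** First the slope is moved to m' by a commuting u and some mu2 with Q mu2 = mu. This also accounts
    for the shift l mu, so the rest of v' is killed by Q and is removed by a constant
    translation. *)
Lemma same_det_iso (P P' : bundle l D) m v m' v' mu :
  G_factor P m v w -> G_factor P' m' v' w ->
  pi1_class D m = lam -> pi1_class D m' = lam ->
  realmx R Q *m v' = realmx R Q *m v + l *: realmx R mu -> torsor_iso P P'.
Proof.
move=> hP hP' em em' eQ.
have [mu0 Qmu0] := Q_det.1 mu.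
have [x xm xcop] := lam_stable em.
(* Subtracting the effect of mu0 leaves a coroot-lattice element; the correction mu1 for it is
   itself in that lattice and does not disturb Q mu0 = mu. *)
pose z := m' - m - (mu0 - w *m mu0).
have hz : coroot_lattice D z.
  apply: latticeB; first by apply/pi1_class_eq; rewrite em em'.
  by rewrite -opprB; apply: latticeN; exact: (weyl_sub_lattice tA w).
have [u [mu1 [uw hmu1 ez]]] := stable_orbit aw sigma_trans xm xcop hz.
pose mu2 := mu0 + mu1.
have em2 : m' = u *m m + (mu2 - w *m mu2).
  have -> : m' = z + m + (mu0 - w *m mu0) by rewrite /z; apply/matrixP => i j; rewrite !mxE; ring.
  by rewrite ez /mu2 mulmxDr; apply/matrixP => i j; rewrite !mxE; ring.
have Qmu2 : Q *m mu2 = mu by rewrite mulmxDr Qmu0 (det_lattice Q_det hmu1) addr0.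
have [a ea] : in_image w (v' - realmx R u *m v - l *: realmx R mu2).
  apply: (det_kernel Q_det aw sigma_trans).
  rewrite !mulmxBr eQ mulmxA (realmx_det_weyl R tA Q_det) -scalemxAr -map_mxM Qmu2.
  by apply/matrixP => i j; rewrite !mxE; ring.
have := G_factor_move mu2 a uw hP; rewrite -em2.
have -> : realmx R u *m v + (a - realmx R w *m a) + l *: realmx R mu2 = v'.
  by rewrite -ea; apply/matrixP => i j; rewrite !mxE; ring.
by move=> h; exact: G_factor_iso h hP'.
Qed.

Local Notation N := (cover_degree n).
Variables (ind' : W_torsor D (circle (N%:R * l))).
Variables (pull : tmor (@circle_cover R l N) (fun g => g \o @circle_cover R l N) ind ind').
Variable triv : ind' (ofull _).

Local Notation MG := (M_ind_deg pull triv lam).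
Local Notation MT := (Pic_deg l deg).

Lemma M_ind_deg_eq (x x' : MG) : sval (sval x) = sval (sval x') -> x = x'.
Proof.
case: x x' => [[c hc] hx] [[c' hc'] hx'] /= e; subst c'.
have e2 : hc = hc' by exact: Prop_irrelevance.
by subst hc'; congr exist; exact: Prop_irrelevance.
Qed.

Lemma Pic_deg_eq (y y' : MT) : sval y = sval y' -> y = y'.
Proof. by case: y y' => [c hc] [c' hc'] /= e; subst c'; congr exist; exact: Prop_irrelevance. Qed.

Lemma M_ind_deg_factor (x : MG) : exists P m v, [/\ framed_factor w dl P m v,
  sval (sval x) = class_of _ (fbundle P) & pi1_class D m = lam].
Proof.
case: x => [[c [P eP]] /= [P' inP' dP']].
have [m [v hP]] := framed_factor_exists l_gt0 dlw P.
exists P, m, v; split=> //.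
have PP' : torsor_iso (fbundle P) P' by move: inP'; rewrite /= eP.
have hP' : G_factor P' m v w.
  apply: G_factor_of_iso (framed_G_factor hP).
  exact: (torsor_iso_sym l_gt0 G_lift PP').
exact/(G_factor_degree l_gt0 tA lam hP').
Qed.

Lemma M_ind_deg_realize m v : pi1_class D m = lam -> exists (x : MG) P,
  framed_factor w dl P m v /\ sval (sval x) = class_of _ (fbundle P).
Proof.
move=> em; have [P hP] := framed_realize l_gt0 dlw m v.
have h1 : exists P0 : framed ind, class_of (@torsor_iso _ _ _ _) (fbundle P) = class_of _ (fbundle P0).
  by exists P.
have h2 : exists2 P0, in_class (class_of (@torsor_iso _ _ _ _) (fbundle P)) P0 & has_degree P0 lam.
  exists (fbundle P); first exact: (torsor_iso_refl l_gt0 G_lift).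
  exact/(G_factor_degree l_gt0 tA lam (framed_G_factor hP)).
by exists (exist _ (exist _ _ h1) h2), P.
Qed.

Lemma Pic_deg_factor (y : MT) : exists P v, pic_factor P deg v /\ sval y = class_of _ P.
Proof.
case: y => [c [P inP dP]] /=.
have [m [v hP]] := pic_factor_exists l_gt0 P.
have em := (pic_factor_degree l_gt0 deg hP).1 dP; rewrite em in hP.
exists P, v; split=> //.
exact: (in_class_of (torsor_iso_sym l_gt0 harm_lift) (torsor_iso_trans l_gt0 harm_lift) inP).
Qed.

Lemma pic_has_degree_class (c : H1T) P v : c = class_of _ P -> pic_factor P deg v ->
  exists2 P0, in_class c P0 & pic_has_degree P0 deg.
Proof.
move=> -> hP; exists P; first exact: (torsor_iso_refl l_gt0 harm_lift).
exact/(pic_factor_degree l_gt0 deg hP).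
Qed.

Lemma Pic_deg_realize P v : pic_factor P deg v -> exists y : MT, sval y = class_of _ P.
Proof.
move=> hP; have h := pic_has_degree_class erefl hP.
by exists (exist _ (class_of (@torsor_iso _ _ _ (harm_sheaf (circle l) s)) P) h : MT).
Qed.

Lemma det_H1_framed (P : framed ind) m v P' : framed_factor w dl P m v ->
  pic_factor P' (Q *m m) (realmx R Q *m v) -> det_H1 (class_of _ (fbundle P)) = class_of _ P'.
Proof. by move=> hP; apply: det_H1_factor; exact: framed_G_factor hP. Qed.

Lemma det_H1_degree (x : MG) : exists2 P0, in_class (det_H1 (sval (sval x))) P0 & pic_has_degree P0 deg.
Proof.
have [P [m [v [hP ex em]]]] := M_ind_deg_factor x.
have [P' hP'] := pic_factor_realize l_gt0 (Q *m m) (realmx R Q *m v).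
have hP'2 := hP'; rewrite (det_degree em) in hP'2.
by apply: pic_has_degree_class hP'2; rewrite ex; exact: det_H1_framed hP hP'.
Qed.

Definition det_ind (x : MG) : MT := exist _ (det_H1 (sval (sval x))) (det_H1_degree x).

Lemma det_ind_inj x x' : det_ind x = det_ind x' -> x = x'.
Proof.
move=> /(congr1 sval) /= e; apply: M_ind_deg_eq.
have [P [m [v [hP ex em]]]] := M_ind_deg_factor x; have [P' [m' [v' [hP' ex' em']]]] := M_ind_deg_factor x'.
rewrite ex ex'; apply/G_class_eq.
have [P1 hP1] := pic_factor_realize l_gt0 (Q *m m) (realmx R Q *m v).
have [P2 hP2] := pic_factor_realize l_gt0 (Q *m m') (realmx R Q *m v').
have /(pic_class_eq _ _ l_gt0) P12 : class_of (@torsor_iso _ _ _ _) P1 = class_of _ P2.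
  by rewrite -(det_H1_framed hP hP1) -(det_H1_framed hP' hP2) -ex -ex'.
have hP1' := pic_factor_of_iso P12 hP2.
have [_ [mu emu]] := pic_factor_unique hP1 hP1'.
exact: same_det_iso (framed_G_factor hP) (framed_G_factor hP') em em' emu.
Qed.

Lemma det_ind_value m v (x : MG) (P : framed ind) (y : MT) P' :
  framed_factor w dl P m v -> sval (sval x) = class_of _ (fbundle P) ->
  pic_factor P' (Q *m m) (realmx R Q *m v) -> sval y = class_of _ P' -> det_ind x = y.
Proof.
by move=> hP ex hP' ey; apply: Pic_deg_eq; rewrite /= ex ey; exact: det_H1_framed hP hP'.
Qed.

Lemma det_ind_surj y : exists x, det_ind x = y.
Proof.
have [P' [v' [hP' ey]]] := Pic_deg_factor y; have [B QB] := det_section Q_det.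
have [x [P [hP ex]]] := M_ind_deg_realize (realmx R B *m v') pi1_lift.
exists x; apply: (det_ind_value hP ex) ey.
by rewrite mulmxA -map_mxM QB map_mx1 mul1mx.
Qed.

Let N_gt0 : (0 < N)%N. Proof. by apply: cover_degree_gt0; exact: typeA_gt0 tA. Qed.
Let l'_gt0 : 0 < N%:R * l. Proof. by rewrite mulr_gt0 // ltr0n. Qed.

(** An open set of factors (Q m, Q v) is pulled back to an open set B2 of factors on the cover, then
    carried through the three induced topologies: Picard classes ([Bp]), framed bundles ([A2]),
    bundles. *)
Lemma det_ind_continuous (B : MT -> Prop) : topen B -> @topen MG (fun x => B (det_ind x)).
Proof.
have [dl' [t [dl'1 dl'triv dl'pull wN]]] := trivialized_pull l_gt0 N_gt0 dlw pull triv.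
move=> [B1 [B0 oB0 hB0] hB].
have B0P P m v : pic_factor P m v -> B1 (class_of _ P) <-> B0 (existT _ m v).
  by move=> hP; apply: hB0; exists P.
have B0shift m v mu : B0 (existT _ m (v + l *: realmx R mu)) <-> B0 (existT _ m v).
  have [P hP] := pic_factor_realize l_gt0 m v.
  by rewrite -(B0P _ _ _ (pic_factor_shift mu hP)) (B0P _ _ _ hP).
have Qw := det_weyl Q_det tA w.
have QS := det_iter_slope N Qw; have [c QT] := det_iter_shift N Qw.
have QwR u : realmx R Q *m realmx R (weyl_mx u) = realmx R Q := realmx_det_weyl R tA Q_det u.
have N0 : N%:R != 0 :> R by rewrite pnatr_eq0 -lt0n.
(* Recovers Q v from V = t (S v + l T m), using Q t = Q, Q S = N Q and Q T = c Q; here mb stands for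
   Q m. *)
pose val (mb : 'cV[int]_s) (V : 'cV[R]_r) : 'cV[R]_s :=
  (N%:R^-1 *: realmx R Q) *m V + - (N%:R^-1 *: (l *: realmx R (c *: mb))).
(* Slopes M with Q M not divisible by N contribute nothing, so B2 is empty on those components. *)
pose B2 (q : {m : 'cV[int]_r & 'cV[R]_r}) := exists mb : 'cV[int]_s,
  Q *m tag q = N%:Z *: mb /\ B0 (existT _ mb (val mb (tagged q))).
have B2E m v : B2 (existT _ (red_slope N w t m) (red_value l N w t m v)) <->
    B0 (existT _ (Q *m m) (realmx R Q *m v)).
  have e1 : Q *m red_slope N w t m = N%:Z *: (Q *m m).
    by rewrite /red_slope !mulmxA (det_weyl Q_det tA t) QS -scalemxAl natz.
  have eN : realmx R ((N%:R : int) *: Q) = (N%:R : R) *: realmx R Q.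
    by apply/matrixP => i j; rewrite !mxE natz intrM.
  have e2 : val (Q *m m) (red_value l N w t m v) = realmx R Q *m v.
    rewrite /val /red_value -scalemxAl mulmxA QwR mulmxDr mulmxA -map_mxM QS.
    rewrite -scalemxAr -map_mxM mulmxA QT -!scalemxAl scalerDr addrK.
    by rewrite eN -scalemxAl scalerA mulVf // scale1r.
  split=> [[mb [/= e3 h]]|h]; last by exists (Q *m m); rewrite /= e2.
  have e4 : mb = Q *m m by apply: (scale_nat_inj N_gt0); rewrite -e3 e1.
  by move: h; rewrite e4 e2.
(* Descent to isomorphism classes: the period N l on the cover becomes l after division by N, and B0
   is invariant under l times the lattice. *)
have B2shift M V mu : B2 (existT _ M (V + (N%:R * l) *: realmx R mu)) <-> B2 (existT _ M V).
  have e mb : val mb (V + (N%:R * l) *: realmx R mu) = val mb V + l *: realmx R (Q *m mu).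
    rewrite /val mulmxDr -addrA [X in _ + X]addrC addrA; congr (_ + _).
    by rewrite -scalemxAl -scalemxAr scalerA mulrA mulVf // mul1r map_mxM.
  by split=> -[mb [h1 h2]]; exists mb; split=> //; move: h2; rewrite /= e B0shift.
have oB2 : open (B2 : set _).
  apply/sigT_openP => M.
  have [[mb eM]|nM] := pselect (exists mb : 'cV[int]_s, Q *m M = N%:Z *: mb); last first.
    rewrite (_ : _ @^-1` _ = set0); first exact: open0.
    by apply/seteqP; split=> V //= [mb [e _]]; apply: nM; exists mb.
  have oB0' := (sigT_openP _).1 oB0 mb.
  rewrite (_ : _ @^-1` _ = [set V | (existT _ mb @^-1` (B0 : set {m : 'cV[int]_s & 'cV[R]_s})) (val mb V)]).
    exact: open_affine.
  apply/seteqP; split=> V /= => [[mb' [/= e h]]|h]; last by exists mb.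
  by have -> : mb = mb' by apply: (scale_nat_inj N_gt0); rewrite -eM e.
pose Bp (q : H1 (harm_sheaf (circle (N%:R * l)) r)) := exists T M V,
  [/\ q = class_of _ T, pic_factor T M V & B2 (existT _ M V)].
have BpE T M V : pic_factor T M V -> Bp (class_of _ T) <-> B2 (existT _ M V).
  move=> hT; split=> [[T' [M' [V' [eT hT' h]]]]|h]; last by exists T, M, V.
  have TT' : torsor_iso T T' by apply/(pic_class_eq _ _ l'_gt0).
  have [eM [mu eV]] := pic_factor_unique hT (pic_factor_of_iso TT' hT').
  by move: h; rewrite -eM eV B2shift.
pose A2 (x : Defs.classes (@framed_iso R l r D ind)) :=
  exists P : framed ind, x = class_of _ P /\ B1 (det_H1 (class_of _ (fbundle P))).
have A2E (P : framed ind) : A2 (class_of _ P) <-> B1 (det_H1 (class_of _ (fbundle P))).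
  split=> [[P0 [eP h]]|h]; last by exists P.
  have /framed_class_eq [mm mb _] := eP.
  have -> : class_of (@torsor_iso _ _ _ _) (fbundle P) = class_of _ (fbundle P0) => //.
  by apply/G_class_eq; exists mm.
exists (fun c => B1 (det_H1 (sval c))); last first.
  by move=> x _ <-; exact: hB.
exists A2; last first.
  by move=> c0 x [P ec ->]; rewrite A2E ec.
exists Bp; last first.
  move=> x q [P [T [-> -> red]]]; rewrite A2E.
  have [m [v hP]] := framed_factor_exists l_gt0 dlw P.
  have hT := reduction_factor l_gt0 N_gt0 dl'1 dl'triv dl'pull wN hP red.
  rewrite (BpE _ _ _ hT) B2E.
  have [P' hP'] := pic_factor_realize l_gt0 (Q *m m) (realmx R Q *m v).
  by rewrite (det_H1_framed hP hP') (B0P _ _ _ hP').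
exists B2; first exact: oB2.
by move=> q [M V] [T -> hT]; exact: BpE.
Qed.

(** Bundles of degree lam can be chosen with the fixed slope m0 and with v = B v', so the inverse
    lifts to an affine map of factors, along which the open set on the cover is pulled back. *)
Lemma det_ind_open (g : MT -> MG) (A : MG -> Prop) : (forall x, g (det_ind x) = x) ->
  topen A -> @topen MT (fun y => A (g y)).
Proof.
move=> gK.
have [dl' [t [dl'1 dl'triv dl'pull wN]]] := trivialized_pull l_gt0 N_gt0 dlw pull triv.
move=> [A1 [A2 [Bp [B2 oB2 hB2] hBp] hA2] hA].
have [B QB] := det_section Q_det.
pose m0 : 'cV[int]_r := generic_quotient.repr lam.
pose V0 (v : 'cV[R]_s) := red_value l N w t m0 (realmx R B *m v).
(* Only the component of slope [deg] is occupied; on the others the set is empty, hence open. *)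
pose O (q : {m : 'cV[int]_s & 'cV[R]_s}) :=
  tag q = deg /\ B2 (existT _ (red_slope N w t m0) (V0 (tagged q))).
pose B1 (c : H1T) := exists y : MT, sval y = c /\ A (g y).
have AE (y : MT) P' v' : pic_factor P' deg v' -> sval y = class_of _ P' ->
    A (g y) <-> B2 (existT _ (red_slope N w t m0) (V0 v')).
  move=> hP' ey.
  have [x [P [hP ex]]] := M_ind_deg_realize (realmx R B *m v') pi1_lift.
  have -> : y = det_ind x.
    apply/esym/(det_ind_value hP ex _ ey).
    by rewrite mulmxA -map_mxM QB map_mx1 mul1mx.
  rewrite gK (hA x _ erefl).
  have [T red] := reduction_exists l_gt0 N_gt0 dl'1 dl'triv dl'pull wN hP.
  have hT := reduction_factor l_gt0 N_gt0 dl'1 dl'triv dl'pull wN hP red.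
  rewrite (hA2 (sval x) (class_of _ P)); last by exists P.
  rewrite (hBp _ (class_of _ T)); last by exists P, T.
  by apply: hB2; exists T.
exists B1; last first.
  move=> y _ <-; split=> [h|[y' [e h]]]; first by exists y.
  by have -> : y = y' by exact/esym/Pic_deg_eq.
exists O; last first.
  move=> c [m v] [P -> hP] /=; split=> [[y [ey h]]|[/= em h]].
    have [P1 [v1 [hP1 ey1]]] := Pic_deg_factor y.
    have PP1 : torsor_iso P P1 by apply/(pic_class_eq _ _ l_gt0); rewrite -ey1.
    have [em _] := pic_factor_unique hP (pic_factor_of_iso PP1 hP1).
    split=> //=; rewrite em in hP.
    exact/(AE y P v hP ey).
  rewrite em in hP.
  have [y ey] := Pic_deg_realize hP; exists y; split=> //.
  exact/(AE y P v hP ey).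
apply/sigT_openP => m.
have [em|em] := eqVneq m deg; last first.
  rewrite (_ : _ @^-1` _ = set0); first exact: open0.
  by apply/seteqP; split=> V //= [e _]; case/eqP: em.
have oB2' := (sigT_openP _).1 oB2 (red_slope N w t m0).
rewrite (_ : _ @^-1` _ = [set v | (existT _ (red_slope N w t m0) @^-1` (B2 : set {m : 'cV[int]_r & 'cV[R]_r}))
    ((realmx R t *m realmx R (iter_slope w N) *m realmx R B) *m v +
     realmx R t *m (l *: realmx R (iter_shift w N *m m0)))]).
  exact: open_affine.
have eV v : V0 v = (realmx R t *m realmx R (iter_slope w N) *m realmx R B) *m v +
     realmx R t *m (l *: realmx R (iter_shift w N *m m0)).
  by rewrite /V0 /red_value mulmxDr !mulmxA.
by apply/seteqP; split=> v /=; rewrite -eV; [case|move=> h; split].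
Qed.

Lemma det_ind_homeomorphism : @homeomorphism MG MT det_ind.
Proof.
pose g y := sval (cid (det_ind_surj y)).
have gK y : det_ind (g y) = y by rewrite /g; case: cid.
have Kg x : g (det_ind x) = x by apply: det_ind_inj; exact: gK.
exists g; split=> // [B|A oA]; first exact: det_ind_continuous.
exact: det_ind_open.
Qed.
End Main.

Theorem theorem4p20 (R : realType) (l : R) (l_gt0 : 0 < l)
    (r : nat) (D : root_datum r)
    (k : nat) (n : 'I_k -> nat) (tA : typeA D n)
    (w : weyl D) (w_cox : is_coxeter tA w)
    (ind : W_torsor D (circle l)) (ind_w : has_monodromy ind w)
    (ind' : W_torsor D (circle ((cover_degree n)%:R * l)))
    (pull : tmor (@circle_cover R l (cover_degree n))
              (fun g => g \o @circle_cover R l (cover_degree n)) ind ind')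
    (triv : ind' (ofull _))
    (s : nat) (Q : 'M[int]_(s, r)) (Q_det : is_det_matrix D Q)
    (lam : pi1 D) (lam_stable : stable tA lam) :
  exists det : M_ind_deg pull triv lam -> Pic_deg l (det_pi1 Q lam),
    homeomorphism det /\
    forall (c : M_ind_deg pull triv lam) (P : bundle l D)
        (P' : torsor (harm_sheaf (circle l) s)),
      in_class (sval (sval c)) P ->
      (in_class (sval (det c)) P' <-> is_pushforward (det_map Q) P P').
Proof.
have [sigma [aw sigma_trans]] := coxeter_acts w_cox.
have /has_automorphyP[dl dlw] := ind_w.
exists (det_ind l_gt0 tA dlw Q_det (lam := lam) (pull := pull) (triv := triv)); split.
  exact: (det_ind_homeomorphism l_gt0 aw sigma_trans dlw Q_det lam_stable).
by move=> c P P' cP; exact: det_H1P.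
Qed.
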